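(* Let $\mathcal{L}\in\mathcal{SP}$ with polynomial Euler product of order $m$ and degree $\mathrm{d}_{\mathcal{L}}$, and let $C>0$, $\ell>0$, $c\ge1$, $T\ge e$ be such that $$\log|\mathcal{L}(s)|\le\frac14\mathrm{d}_{\mathcal{L}}\log(c|t|)+\ell\log\log(c|t|)+\log^{+}C$$ for all $s=\sigma+\mathrm{i}t$ with $|t|\ge T$, $\sigma\ge1/2$ and $\mathcal{L}(s)\ne0$. Let $0<C_1\le1$, $0<C_2\le2C_1$ and $C_3\ge1$. Let $s=\sigma+\mathrm{i}t$ and $$|t|\ge t_0\ge T_1\ge\max\left\{\exp\left(e^{2C_2}\right),e^{4m/\mathrm{d}_{\mathcal{L}}},C_3,\exp\left(e^2\right)\right\}$$ be such that $$t_0-C_3\log\log(ct_0)-\frac12\ge T_2\ge\max\left\{T+1,\exp\left(e^2\right)\right\},\qquad T_1-2C_3\log\log T_1\ge0.$$ Assume that $\mathcal{L}(z)\ne0$ for $\Re\{z\}>1/2$ and $|\Im\{z\}-t|\le C_3\log\log(c|t|)+2$. Then $$|\log\mathcal{L}(s)|\le a_1\left(b_1\log(c|t|)\right)^{2(1-\sigma)}\log\log(c|t|)$$ for $$\sigma\in\left[\frac12+\frac{C_2}{\log\log(c|t|)},\ 1+\frac{C_2}{\log\log(c|t|)}\right],$$ where $$a_1=\frac{m}{C_2}\exp\left(\left(1+\frac{\log^{+}b_1}{\log\log T_1}\right)\mathcal{R}_1\right),$$ $$b_1=\frac1mK\left(\mathrm{d}_{\mathcal{L}},m,\ell,C,C_1,T_2\right)\left(1+\frac{\log\left(1+\frac{C_3\log\log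 T_1+3/2}{T_1}\right)}{\log T_1}\right)\left(1+\frac{\log\left(1+\frac{1}{\log T_1}\log\left(1+\frac{2C_3\log\log T_1+1}{T_1}\right)\right)}{\log\log T_1}\right),$$ $$\mathcal{R}_1=\left(2C_2+\frac{1}{2C_3}\right)\left(1-\frac{1}{4C_3\log\log T_1}\right)^{-1},$$ and $$K(\mathrm{d}_{\mathcal{L}},m,\ell,C,C_1,u)=\frac14\mathrm{d}_{\mathcal{L}}+\frac{C_1\mathrm{d}_{\mathcal{L}}}{2\log\log u}+\left(1+\frac{2C_1}{\log\log u}\right)\left(\frac{\ell\log\log u}{\log u}+\frac{m}{\log u}\left(\log\log\log u+\log\frac{1}{C_1}+\frac{\gamma C_1}{\log\log u}\right)+\frac{\log^{+}C}{\log u}\right).$$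
   Context: The class $\mathcal{SP}$ (Selberg class of functions with a polynomial Euler product) consists of Dirichlet series $\mathcal{L}(s)=\sum_{n\ge1}a(n)n^{-s}$ satisfying: (1) $a(n)\ll_{\varepsilon}n^{\varepsilon}$ for every $\varepsilon>0$. (2) There is an integer $k\ge0$ such that $(s-1)^k\mathcal{L}(s)$ is an entire function of finite order. (3) $\Lambda_{\mathcal{L}}(s)=\omega\overline{\Lambda_{\mathcal{L}}(1-\bar s)}$, where $\Lambda_{\mathcal{L}}(s)=\mathcal{L}(s)Q^s\prod_{j=1}^{f}\Gamma(\lambda_js+\mu_j)$ with $Q,\lambda_j>0$ real, $\mu_j,\omega\in\mathbb{C}$, $\Re\{\mu_j\}\ge0$, $|\omega|=1$. (4) Polynomial Euler product of order $m$: there is $m\in\mathbb{N}$ and for every prime $p$ numbers $\alpha_j(p)\in\mathbb{C}$, $1\le j\le m$, such that $\mathcal{L}(s)=\prod_p\prod_{j=1}^m(1-\alpha_j(p)p^{-s})^{-1}$. The degree is $\mathrm{d}_{\mathcal{L}}=2\sum_{j=1}^f\lambda_j$ (well defined). $\log^{+}u=\max\{0,\log u\}$ for $u>0$; $\gamma$ is the Euler–Mascheroni constant. $\log\mathcal{L}(s)$ denotes the branch which for $\sigma>1$ equals $\sum_p\sum_{k\ge1}\sum_{j=1}^m\frac{\alpha_j(p)^k}{kp^{ks}}$, continued holomorphically into the zero-free region under consideration. *)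

(* Defs.v *)
(* Stdlib real numbers, with the complex numbers of Coquelicot. *)
From Stdlib Require Export Reals ZArith Znumtheory.
From Coquelicot Require Export Coquelicot.

Open Scope R_scope.

Definition Cexp (z : C) : C := (exp (Re z) * cos (Im z), exp (Re z) * sin (Im z)).

(* [x ^ s] for a real base [x > 0] *)
Definition Rcpow (x : R) (s : C) : C := Cexp (s * ln x)%C.

(* the product of [g 1], ..., [g n] *)
Fixpoint Cprod (g : nat -> C) (n : nat) : C :=
  match n with
  | O => 1
  | S n' => (Cprod g n' * g n)%C
  end.

Definition Csum (g : nat -> C) (n : nat) : C :=
  sum_n_m (G := C_AbelianMonoid) g 1 n.

Definition Cis_lim_seq (u : nat -> C) (l : C) : Prop :=
  filterlim u eventually (locally (T := C_UniformSpace) l).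

Definition Cis_series (u : nat -> C) (l : C) : Prop :=
  is_series (K := C_AbsRing) (V := C_NormedModule) u l.

Definition Cderivable (F : C -> C) (z : C) : Prop :=
  ex_derive (K := C_AbsRing) (V := C_NormedModule) F z.

Definition entire (F : C -> C) : Prop := forall z : C, Cderivable F z.

Definition finite_order (F : C -> C) : Prop :=
  exists rho r0 : R, 0 < r0 /\
    forall z : C, r0 <= Cmod z -> Cmod (F z) <= exp (Rpower (Cmod z) rho).

Definition Clim_seq (u : nat -> C) : C :=
  (real (Lim_seq (fun n => Re (u n))), real (Lim_seq (fun n => Im (u n)))).

(* The Euler-Gauss limit of n! n^z / (z (z+1) ... (z+n)); it exists at every
   [z] outside the poles 0, -1, -2, ... and its value at a pole is junk. *)
Definition CGamma (z : C) : C :=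
  Clim_seq (fun n =>
    (INR (fact n) * Rcpow (INR n) z
       / (z * Cprod (fun k => z + INR k) n))%C).

Definition Gamma_pole (z : C) : Prop := exists k : nat, z = RtoC (- INR k).

Definition is_prime (p : nat) : Prop := prime (Z.of_nat p).

Definition at_primes (x : C) (g : nat -> C) (p : nat) : C :=
  if prime_dec (Z.of_nat p) then g p else x.

Definition completed (L : C -> C) (Q : R) (f : nat) (lambda : nat -> R)
    (mu : nat -> C) (s : C) : C :=
  (L s * Rcpow Q s * Cprod (fun j => CGamma (lambda j * s + mu j)) f)%C.

(* Functional equation with gamma factors of degree [d].  It is an identity of
   meromorphic functions, hence it is required away from the possible poles:
   those of [L] (at 1) and of the gamma factors, evaluated at [s] and at the
   reflected point [1 - conj s]. *)
Definition functional_equation (L : C -> C) (d : R) : Prop :=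
  exists (Q : R) (f : nat) (lambda : nat -> R) (mu : nat -> C) (omega : C),
    0 < Q /\
    (forall j, (1 <= j <= f)%nat -> 0 < lambda j /\ 0 <= Re (mu j)) /\
    Cmod omega = 1 /\
    d = 2 * sum_n_m lambda 1 f /\
    forall s : C,
      s <> 0 -> s <> 1 ->
      (forall j, (1 <= j <= f)%nat ->
         ~ Gamma_pole (lambda j * s + mu j)%C /\
         ~ Gamma_pole (lambda j * (1 - Cconj s) + mu j)%C) ->
      completed L Q f lambda mu s
        = (omega * Cconj (completed L Q f lambda mu (1 - Cconj s)))%C.

(* The non-vanishing clause says that the inverses in the Euler product make
   sense in the half-plane of convergence.  [alpha j p] is alpha_j(p). *)
Definition euler_product (L : C -> C) (m : nat) (alpha : nat -> nat -> C) : Prop :=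
  forall s : C, 1 < Re s ->
    (forall p j, is_prime p -> (1 <= j <= m)%nat ->
       (1 - alpha j p * Rcpow (INR p) (- s))%C <> 0) /\
    Cis_lim_seq
      (Cprod (at_primes 1 (fun p =>
         Cprod (fun j => / (1 - alpha j p * Rcpow (INR p) (- s)))%C m)))
      (L s).

(* [L] is the (continued) sum of the Dirichlet series with coefficients
   [a 1, a 2, ...], belongs to SP, has degree [d] and a polynomial Euler
   product of order [m] with parameters [alpha].  [L 1] is irrelevant when [L]
   has a pole at 1, and is left unconstrained. *)
Record SP (a : nat -> C) (L : C -> C) (m : nat) (alpha : nat -> nat -> C)
    (d : R) : Prop := {
  SP_dirichlet : forall s : C, 1 < Re s ->
    Cis_series (fun n => (a (S n) * Rcpow (INR (S n)) (- s))%C) (L s);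
  SP_ramanujan : forall eps : R, 0 < eps ->
    exists M : R, forall n : nat, (1 <= n)%nat ->
      Cmod (a n) <= M * Rpower (INR n) eps;
  SP_continuation : exists (k : nat) (E : C -> C),
    entire E /\ finite_order E /\
    forall s : C, s <> 1 -> E s = ((s - 1) ^ k * L s)%C;
  SP_functional_equation : functional_equation L d;
  SP_order_pos : (1 <= m)%nat;
  SP_euler_product : euler_product L m alpha
}.

(* The sum over p, k >= 1 and 1 <= j <= m of alpha_j(p)^k / (k p^(k s))
   equals [l]; [series_p p] is the inner sum over k and j. *)
Definition log_series (m : nat) (alpha : nat -> nat -> C) (s l : C) : Prop :=
  exists series_p : nat -> C,
    (forall p, is_prime p ->
       Cis_series
         (fun k => Csum (fun j =>
            alpha j p ^ S k
              / (INR (S k) * Rcpow (INR p) (INR (S k) * s)))%C m)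
         (series_p p)) /\
    Cis_series (at_primes 0 series_p) l.

(* [logL] is the branch of log L given by the above series for [Re z > 1] and
   continued holomorphically to [D]. *)
Definition log_branch (L : C -> C) (m : nat) (alpha : nat -> nat -> C)
    (D : C -> Prop) (logL : C -> C) : Prop :=
  (forall z : C, 1 < Re z -> log_series m alpha z (logL z)) /\
  (forall z : C, 1 < Re z \/ D z -> Cderivable logL z /\ Cexp (logL z) = L z).

Definition log_plus (u : R) : R := Rmax 0 (ln u).

Definition EulerMascheroni : R :=
  real (Lim_seq (fun n => sum_n_m (fun k => / INR k) 1 n - ln (INR n))).

Definition K_const (d : R) (m : nat) (l C0 C1 u : R) : R :=
  1 / 4 * d + C1 * d / (2 * ln (ln u))
  + (1 + 2 * C1 / ln (ln u))
    * (l * ln (ln u) / ln u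
       + INR m / ln u
         * (ln (ln (ln u)) + ln (1 / C1) + EulerMascheroni * C1 / ln (ln u))
       + log_plus C0 / ln u).

Definition R1_const (C2 C3 T1 : R) : R :=
  (2 * C2 + 1 / (2 * C3)) * / (1 - 1 / (4 * C3 * ln (ln T1))).

Definition b1_const (d : R) (m : nat) (l C0 C1 C3 T1 T2 : R) : R :=
  1 / INR m * K_const d m l C0 C1 T2
  * (1 + ln (1 + (C3 * ln (ln T1) + 3 / 2) / T1) / ln T1)
  * (1 + ln (1 + 1 / ln T1 * ln (1 + (2 * C3 * ln (ln T1) + 1) / T1))
         / ln (ln T1)).

Definition a1_const (d : R) (m : nat) (l C0 C1 C2 C3 T1 T2 : R) : R :=
  INR m / C2
  * exp ((1 + log_plus (b1_const d m l C0 C1 C3 T1 T2) / ln (ln T1))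
         * R1_const C2 C3 T1).

(* Main.v *)
(* Write tau = log log (c|t|), delta = C2 / tau, and apply Hadamard's three
   circles theorem to log L on circles centred at 1 + delta + C3 tau + it.
   The inner circle, of radius C3 tau, lies in Re z >= 1 + delta, where
   |log L| <= m log zeta(1 + delta) <= m / delta.  On the outer circle, of
   radius C3 tau + 1/2, the Borel-Caratheodory theorem on discs of centre
   1 + eta + i Im z and radius 1/2 + eta, eta = C1 / log log T2, together with
   the growth hypothesis and zeta(1 + eta) <= e^(gamma eta) / eta, gives the
   bound (m / delta) b1 log (c|t|).  The exponent of b1 log (c|t|) in the
   interpolation is at most 2 (1 - sigma) + R1 / tau.

   Goursat's lemma in the coordinate log (z - z0) yields the mean value
   property, hence the maximum principle.  The inequality |alpha_j(p)| <= 1 is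
   read off from a(p^k) = O(p^(eps k)), the Euler factor at p being isolated by
   mean values over the line Re s = 4. *)

(* A modulus is recovered from a real part after multiplication by a conjugate constant, so the mean
   value property is needed for real parts only, that is, for the imaginary part of one contour
   integral. The maximum principle for [f(z) (z - s0)^(- beta)], [beta] real, serves twice: for the
   three circles and, as [beta] tends to 1, for Schwarz's lemma.

   The Euler factors do not vanish in Re s > 1, which only gives [|alpha_j(p)| <= p]. Hence the
   choice of a line far to the right, where the Euler product still converges uniformly. The
   comparison with log zeta uses a single inequality of the Euler product of zeta, supplied by a
   sieve on partial sums.

   The lower bounds on [T1] enter as follows: [exp (exp (2 C2))] gives [delta <= 1/2]; [C3] makes
   [x - C3 log log (c x)] nondecreasing beyond [t0]; [e^(4m/d)] makes the base [b1 log (c|t|)] at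
   least 1, so that a larger exponent gives a larger bound. The radius parameter [eta] depends on
   [T2] and not on [t], so that [K] is a constant: after division by log (c|t|) the lower-order
   terms decrease and may be evaluated at [T2]. *)
Require Import Defs.
From Stdlib Require Import Lra Lia Psatz ClassicalDescription Classical.

Set Bullet Behavior "Strict Subproofs".

(** * Holomorphic functions *)

Section Cousin.
Variable P : R -> R -> R -> R -> Prop.

(** A classical choice of a quarter on which [P] fails. The upper right one is taken untested: if
    [P] held there as on the three others, the subdivision hypothesis of [rect_cousin] would give
    [P] on the whole. *)
Definition quarter (r : (R * R) * (R * R)) : (R * R) * (R * R) :=
  let '((a, b), (c, d)) := r in
  let p := (a + b) / 2 in let q := (c + d) / 2 in
  if excluded_middle_informative (P a p c q) then
    if excluded_middle_informative (P p b c q) then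
      if excluded_middle_informative (P a p q d) then ((p, b), (q, d))
      else ((a, p), (q, d))
    else ((p, b), (c, q))
  else ((a, p), (c, q)).

Fixpoint quarters (r : (R * R) * (R * R)) (n : nat) : (R * R) * (R * R) :=
  match n with O => r | S n' => quarter (quarters r n') end.

Lemma adjacent_limit (u v : nat -> R) (h : R) :
  (forall n, u n <= u (S n)) -> (forall n, v (S n) <= v n) ->
  (forall n, v n - u n = h / 2 ^ n) -> 0 <= h ->
  exists p, forall n, u n <= p <= v n.
Proof.
  intros Hu Hv Hd Hh.
  assert (Huv : forall n, u n <= v n).
  { intro n. assert (0 < 2 ^ n) by (apply pow_lt; lra).
    assert (0 <= h / 2 ^ n) by (apply Rdiv_le_0_compat; lra).
    specialize (Hd n). lra. }
  assert (Hum : forall n k, u n <= u (n + k)%nat).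
  { intros n k. induction k. rewrite Nat.add_0_r; lra.
    rewrite Nat.add_succ_r. specialize (Hu (n + k)%nat). lra. }
  assert (Hvm : forall n k, v (n + k)%nat <= v n).
  { intros n k. induction k. rewrite Nat.add_0_r; lra.
    rewrite Nat.add_succ_r. specialize (Hv (n + k)%nat). lra. }
  assert (Hx : forall n k, u n <= v k).
  { intros n k. destruct (Nat.le_ge_cases n k) as [Hnk | Hnk].
    - replace k with (n + (k - n))%nat by lia.
      specialize (Hum n (k - n)%nat). specialize (Huv (n + (k - n))%nat). lra.
    - specialize (Hvm k (n - k)%nat).
      replace (k + (n - k))%nat with n in Hvm by lia. specialize (Huv n). lra. }
  destruct (completeness (fun x => exists n, x = u n)) as [p [Hp1 Hp2]].
  - exists (v O). intros x [n ->]. apply Hx.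
  - exists (u O). now exists O.
  - exists p. intro n. split.
    + apply Hp1. now exists n.
    + apply Hp2. intros x [k ->]. apply Hx.
Qed.

(** If [P] failed, nested quarters on which it fails would shrink to a point, against the local
    hypothesis there. This stands in for compactness: it gives Goursat's estimate, boundedness, and
    the attainment of a supremum. *)
Lemma rect_cousin (a b c d : R) :
  a <= b -> c <= d ->
  (forall a' b' c' d', a <= a' -> a' <= b' -> b' <= b ->
     c <= c' -> c' <= d' -> d' <= d ->
     let p := (a' + b') / 2 in let q := (c' + d') / 2 in
     P a' p c' q -> P p b' c' q -> P a' p q d' -> P p b' q d' ->
     P a' b' c' d') ->
  (forall p q, a <= p <= b -> c <= q <= d -> exists e, 0 < e /\
     forall a' b' c' d', a <= a' <= p -> p <= b' <= b ->
       c <= c' <= q -> q <= d' <= d -> b' - a' < e -> d' - c' < e ->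
       P a' b' c' d') ->
  P a b c d.
Proof.
  intros Hab Hcd Hq Hloc.
  destruct (excluded_middle_informative (P a b c d)) as [| HnP]; [assumption | exfalso].
  set (s := quarters ((a, b), (c, d))).
  set (u := fun n => fst (fst (s n))). set (v := fun n => snd (fst (s n))).
  set (x := fun n => fst (snd (s n))). set (y := fun n => snd (snd (s n))).
  assert (Hs : forall n, (a <= u n /\ u n <= v n /\ v n <= b) /\
    (c <= x n /\ x n <= y n /\ y n <= d) /\ ~ P (u n) (v n) (x n) (y n) /\
    v n - u n = (b - a) / 2 ^ n /\ y n - x n = (d - c) / 2 ^ n /\
    u n <= u (S n) /\ v (S n) <= v n /\ x n <= x (S n) /\ y (S n) <= y n).
  { assert (Hstep : forall n,
      (a <= u n /\ u n <= v n /\ v n <= b) ->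
      (c <= x n /\ x n <= y n /\ y n <= d) -> ~ P (u n) (v n) (x n) (y n) ->
      (u n <= u (S n) /\ u (S n) <= v (S n) /\ v (S n) <= v n) /\
      (x n <= x (S n) /\ x (S n) <= y (S n) /\ y (S n) <= y n) /\
      ~ P (u (S n)) (v (S n)) (x (S n)) (y (S n)) /\
      v (S n) - u (S n) = (v n - u n) / 2 /\
      y (S n) - x (S n) = (y n - x n) / 2).
    { intros n. unfold u, v, x, y, s.
      change (quarters ((a, b), (c, d)) (S n)) with (quarter (quarters ((a, b), (c, d)) n)).
      destruct (quarters ((a, b), (c, d)) n) as [[a' b'] [c' d']]. simpl.
      intros H1 H2 H3. specialize (Hq a' b' c' d'). simpl in Hq.
      repeat destruct excluded_middle_informative; simpl;
        repeat match goal with |- _ /\ _ => split end; try lra; try assumption.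
      intro H4. apply H3. apply Hq; tauto. }
    assert (Hs : forall n, (a <= u n /\ u n <= v n /\ v n <= b) /\
      (c <= x n /\ x n <= y n /\ y n <= d) /\ ~ P (u n) (v n) (x n) (y n) /\
      v n - u n = (b - a) / 2 ^ n /\ y n - x n = (d - c) / 2 ^ n).
    { induction n as [| n (I1 & I2 & I3 & I4 & I5)].
      - unfold u, v, x, y, s; simpl. repeat split; try lra. assumption.
      - destruct (Hstep n I1 I2 I3) as (J1 & J2 & J3 & J4 & J5).
        assert (0 < 2 ^ n) by (apply pow_lt; lra).
        repeat match goal with |- _ /\ _ => split end; try lra; try assumption.
        + rewrite J4, I4. simpl. field. lra.
        + rewrite J5, I5. simpl. field. lra. }
    intro n. destruct (Hs n) as (I1 & I2 & I3 & I4 & I5).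
    destruct (Hstep n I1 I2 I3) as (J1 & J2 & J3 & J4 & J5). tauto. }
  destruct (adjacent_limit u v (b - a)) as [p Hp]; try (intro n; apply Hs); try lra.
  destruct (adjacent_limit x y (d - c)) as [q Hq']; try (intro n; apply Hs); try lra.
  destruct (Hloc p q) as (e & He & Hle).
  { specialize (Hp O). specialize (Hs O). lra. }
  { specialize (Hq' O). specialize (Hs O). lra. }
  (* Both sides of the n-th rectangle are at most [h / 2 ^ n]. The divisor [h + 1] stays positive
     when the rectangle is a single point. *)
  set (h := (b - a) + (d - c)).
  destruct (pow_lt_1_zero (/ 2)) with (y := e / (h + 1)) as [N HN].
  { rewrite Rabs_pos_eq; lra. }
  { apply Rdiv_lt_0_compat; unfold h; lra. }
  specialize (HN N (Nat.le_refl N)).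
  destruct (Hs N) as (I1 & I2 & I3 & I4 & I5 & _).
  assert (H2 : 0 < / 2 ^ N) by (apply Rinv_0_lt_compat, pow_lt; lra).
  rewrite pow_inv, Rabs_pos_eq in HN by lra.
  assert (Hsm : h / 2 ^ N < e).
  { apply Rle_lt_trans with ((h + 1) * / 2 ^ N); [unfold Rdiv; nra |].
    apply (Rmult_lt_compat_l (h + 1)) in HN; [| unfold h; lra].
    replace ((h + 1) * (e / (h + 1))) with e in HN by (field; unfold h; lra). exact HN. }
  apply I3, Hle; try (specialize (Hp N); lra); try (specialize (Hq' N); lra).
  - rewrite I4. unfold h, Rdiv in *. nra.
  - rewrite I5. unfold h, Rdiv in *. nra.
Qed.
End Cousin.

(** * Complex differentiability and the exponential *)

Definition cdiff (F : C -> C) (z D : C) : Prop :=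
  forall eps, 0 < eps -> exists del, 0 < del /\ forall w, Cmod (w - z) < del ->
    Cmod (F w - F z - D * (w - z))%C <= eps * Cmod (w - z).

Lemma Cderivable_cdiff (F : C -> C) (z : C) : Cderivable F z -> exists D, cdiff F z D.
Proof.
  intros [D [_ H]]. exists D. intros eps Heps.
  destruct (H z (fun P HP => HP) (mkposreal eps Heps)) as [del Hdel].
  exists del. split. apply cond_pos.
  intros w Hw. specialize (Hdel w).
  specialize (Hdel Hw).
  replace (F w - F z - D * (w - z))%C with (F w + - F z + - ((w + - z) * D))%C by ring.
  exact Hdel.
Qed.

Lemma cdiff_cont (F : C -> C) (z D : C) : cdiff F z D ->
  forall eps, 0 < eps -> exists del, 0 < del /\ forall w, Cmod (w - z) < del ->
    Cmod (F w - F z) < eps.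
Proof.
  intros H eps Heps. destruct (H 1 Rlt_0_1) as (d & Hd & H1).
  pose proof (Cmod_ge_0 D) as HD.
  exists (Rmin d (eps / (2 + Cmod D))).
  assert (0 < eps / (2 + Cmod D)) by (apply Rdiv_lt_0_compat; lra).
  split. now apply Rmin_pos.
  intros w Hw. specialize (H1 w (Rlt_le_trans _ _ _ Hw (Rmin_l _ _))).
  pose proof (Rlt_le_trans _ _ _ Hw (Rmin_r _ _)) as Hw2.
  replace (F w - F z)%C with ((F w - F z - D * (w - z)) + D * (w - z))%C by ring.
  eapply Rle_lt_trans; [apply Cmod_triangle |]. rewrite Cmod_mult.
  pose proof (Cmod_ge_0 (w - z)).
  assert (Cmod (w - z) * (2 + Cmod D) < eps).
  { apply (Rmult_lt_compat_r (2 + Cmod D)) in Hw2; [| lra].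
    replace (eps / (2 + Cmod D) * (2 + Cmod D)) with eps in Hw2 by (field; lra). exact Hw2. }
  nra.
Qed.

Lemma cdiff_const (k z : C) : cdiff (fun _ => k) z 0.
Proof.
  intros eps Heps. exists 1. split; [lra |]. intros w _.
  replace (k - k - 0 * (w - z))%C with (RtoC 0) by ring. rewrite Cmod_0.
  pose proof (Cmod_ge_0 (w - z)). nra.
Qed.

Lemma cdiff_affine (k m z : C) : cdiff (fun w => k + m * w)%C z m.
Proof.
  intros eps Heps. exists 1. split; [lra |]. intros w _.
  replace (k + m * w - (k + m * z) - m * (w - z))%C with (RtoC 0) by ring. rewrite Cmod_0.
  pose proof (Cmod_ge_0 (w - z)). nra.
Qed.

Lemma cdiff_plus (F G : C -> C) (z D E : C) :
  cdiff F z D -> cdiff G z E -> cdiff (fun w => F w + G w)%C z (D + E)%C.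
Proof.
  intros HF HG eps Heps.
  destruct (HF (eps / 2)) as (d1 & Hd1 & H1); [lra |].
  destruct (HG (eps / 2)) as (d2 & Hd2 & H2); [lra |].
  exists (Rmin d1 d2). split. now apply Rmin_pos. intros w Hw.
  specialize (H1 w (Rlt_le_trans _ _ _ Hw (Rmin_l _ _))).
  specialize (H2 w (Rlt_le_trans _ _ _ Hw (Rmin_r _ _))).
  replace (F w + G w - (F z + G z) - (D + E) * (w - z))%C
    with ((F w - F z - D * (w - z)) + (G w - G z - E * (w - z)))%C by ring.
  eapply Rle_trans; [apply Cmod_triangle |]. lra.
Qed.

Lemma cdiff_comp (F G : C -> C) (z D E : C) :
  cdiff G z E -> cdiff F (G z) D -> cdiff (fun w => F (G w)) z (D * E)%C.
Proof.
  intros HG HF eps Heps.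
  pose proof (Cmod_ge_0 D) as HD. pose proof (Cmod_ge_0 E) as HE.
  set (e1 := eps / (2 * (1 + Cmod E))).
  set (e2 := Rmin 1 (eps / (2 * (1 + Cmod D)))).
  assert (He1 : 0 < e1) by (apply Rdiv_lt_0_compat; lra).
  assert (He2 : 0 < e2).
  { apply Rmin_pos; [lra |]. apply Rdiv_lt_0_compat; lra. }
  destruct (HF e1 He1) as (d1 & Hd1 & H1).
  destruct (HG e2 He2) as (d2 & Hd2 & H2).
  destruct (cdiff_cont _ _ _ HG d1 Hd1) as (d3 & Hd3 & H3).
  exists (Rmin d2 d3). split. now apply Rmin_pos. intros w Hw.
  specialize (H2 w (Rlt_le_trans _ _ _ Hw (Rmin_l _ _))).
  specialize (H3 w (Rlt_le_trans _ _ _ Hw (Rmin_r _ _))).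
  specialize (H1 (G w) H3).
  replace (F (G w) - F (G z) - D * E * (w - z))%C
    with ((F (G w) - F (G z) - D * (G w - G z)) + D * (G w - G z - E * (w - z)))%C by ring.
  eapply Rle_trans; [apply Cmod_triangle |]. rewrite Cmod_mult.
  pose proof (Cmod_ge_0 (w - z)) as Hwz.
  assert (HGw : Cmod (G w - G z) <= (1 + Cmod E) * Cmod (w - z)).
  { replace (G w - G z)%C with ((G w - G z - E * (w - z)) + E * (w - z))%C by ring.
    eapply Rle_trans; [apply Cmod_triangle |]. rewrite Cmod_mult.
    assert (e2 <= 1) by apply Rmin_l. nra. }
  assert (Ha : e1 * Cmod (G w - G z) <= eps / 2 * Cmod (w - z)).
  { apply Rle_trans with (e1 * ((1 + Cmod E) * Cmod (w - z))).
    - apply Rmult_le_compat_l; lra.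
    - apply Req_le. unfold e1. field. lra. }
  assert (Hb : Cmod D * Cmod (G w - G z - E * (w - z))%C <= eps / 2 * Cmod (w - z)).
  { apply Rle_trans with ((1 + Cmod D) * (eps / (2 * (1 + Cmod D)) * Cmod (w - z))).
    - apply Rmult_le_compat; try lra. apply Cmod_ge_0.
      eapply Rle_trans; [exact H2 |]. apply Rmult_le_compat_r; [exact Hwz |]. apply Rmin_r.
    - apply Req_le. field. lra. }
  lra.
Qed.

Lemma cdiff_sqr (z : C) : cdiff (fun w => w * w)%C z (2 * z)%C.
Proof.
  intros eps Heps. exists eps. split; [exact Heps |]. intros w Hw.
  replace (w * w - z * z - 2 * z * (w - z))%C with ((w - z) * (w - z))%C by ring.
  rewrite Cmod_mult. apply Rmult_le_compat_r; [apply Cmod_ge_0 | lra].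
Qed.

Lemma cdiff_ext (F G : C -> C) (z D : C) :
  (forall w, F w = G w) -> cdiff F z D -> cdiff G z D.
Proof.
  intros He H eps Heps. destruct (H eps Heps) as (d & Hd & H1).
  exists d. split; [exact Hd |]. intros w Hw. rewrite <- !He. now apply H1.
Qed.

Lemma cdiff_scal (k : C) (F : C -> C) (z D : C) :
  cdiff F z D -> cdiff (fun w => k * F w)%C z (k * D)%C.
Proof.
  intros H. apply (cdiff_ext (fun w => 0 + k * F w)%C); [intro; ring |].
  now apply (cdiff_comp (fun w => 0 + k * w)%C F), cdiff_affine.
Qed.

(* Polarisation reduces the product rule to the square. *)
Lemma cdiff_mult (F G : C -> C) (z D E : C) :
  cdiff F z D -> cdiff G z E -> cdiff (fun w => F w * G w)%C z (D * G z + F z * E)%C.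
Proof.
  intros HF HG.
  pose proof (cdiff_scal (-(1)) _ _ _ HG) as HGn.
  pose proof (cdiff_comp _ _ _ _ _ (cdiff_plus _ _ _ _ _ HF HG) (cdiff_sqr _)) as H1.
  pose proof (cdiff_comp _ _ _ _ _ (cdiff_plus _ _ _ _ _ HF HGn) (cdiff_sqr _)) as H2.
  pose proof (cdiff_plus _ _ _ _ _ (cdiff_scal (/ 4) _ _ _ H1) (cdiff_scal (- / 4) _ _ _ H2)) as H.
  cbv beta in H.
  assert (H4 : RtoC 4 <> 0) by (intro E4; apply RtoC_inj in E4; lra).
  match type of H with cdiff _ _ ?X => replace (D * G z + F z * E)%C with X by (field; exact H4) end.
  eapply cdiff_ext; [| exact H]. intro w. cbv beta. field.
Qed.

Lemma cdiff_inv (z : C) : z <> 0 -> cdiff (fun w => / w)%C z (- / (z * z))%C.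
Proof.
  intros Hz eps Heps. apply Cmod_gt_0 in Hz as Hz'. set (r := Cmod z) in *.
  (* The error is exactly [(w - z)^2 / (w z^2)]. When [|w| >= r / 2], it is at most [eps |w - z|] as
     soon as [|w - z| <= eps r^3 / 2]. *)
  set (e := eps * (r * r * r) / 2).
  assert (He : 0 < e) by (unfold e; apply Rdiv_lt_0_compat; [| lra]; repeat apply Rmult_lt_0_compat; lra).
  exists (Rmin (r / 2) e). split. apply Rmin_pos; lra.
  intros w Hw. pose proof (Rlt_le_trans _ _ _ Hw (Rmin_l _ _)) as Hw1.
  pose proof (Rlt_le_trans _ _ _ Hw (Rmin_r _ _)) as Hw2.
  assert (Hwr : r / 2 <= Cmod w).
  { pose proof (Cmod_triangle w (z - w)) as T. replace (w + (z - w))%C with z in T by ring.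
    replace (z - w)%C with (- (w - z))%C in T by ring. rewrite Cmod_opp in T. fold r in T. lra. }
  assert (Hw0 : w <> 0) by (apply Cmod_gt_0; lra).
  replace (/ w - / z - - / (z * z) * (w - z))%C with ((w - z) * (w - z) / (w * (z * z)))%C
    by (field; split; assumption).
  assert (Hne : (w * (z * z))%C <> 0) by (repeat apply Cmult_neq_0; assumption).
  rewrite Cmod_div by exact Hne. rewrite !Cmod_mult. fold r.
  pose proof (Cmod_ge_0 (w - z)).
  apply Rle_div_l; [apply Rmult_lt_0_compat; nra |].
  rewrite (Rmult_comm eps), Rmult_assoc.
  apply Rmult_le_compat_l; [lra |].
  assert (0 < eps * (r * r)) by (repeat apply Rmult_lt_0_compat; lra).
  apply Rlt_le, Rlt_le_trans with e; [lra |]. unfold e.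
  replace (eps * (r * r * r) / 2) with (eps * (r * r) * (r / 2)) by field.
  replace (eps * (Cmod w * (r * r))) with (eps * (r * r) * Cmod w) by ring.
  apply Rmult_le_compat_l; lra.
Qed.

Lemma Cmod_le_parts (x y : R) : Cmod (x, y) <= Rabs x + Rabs y.
Proof.
  unfold Cmod; simpl. pose proof (Rabs_pos x); pose proof (Rabs_pos y).
  rewrite <- (sqrt_Rsqr (Rabs x + Rabs y)) by lra. apply sqrt_le_1_alt.
  pose proof (Rsqr_abs x) as Hx. pose proof (Rsqr_abs y) as Hy. unfold Rsqr in *. nra.
Qed.

Lemma im_le_Cmod (z : C) : Rabs (Im z) <= Cmod z.
Proof.
  pose proof (re_le_Cmod (z * Ci)%C) as H. rewrite re_mult_Ci, Rabs_Ropp, Cmod_mult in H.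
  replace (Cmod Ci) with 1 in H; [lra |]. unfold Cmod, Ci; simpl.
  rewrite <- sqrt_1 at 1. f_equal. ring.
Qed.

Lemma Cexp_plus (z w : C) : Cexp (z + w)%C = (Cexp z * Cexp w)%C.
Proof.
  destruct z as [x y], w as [u v]. unfold Cexp, Cmult, Cplus; simpl.
  rewrite exp_plus, cos_plus, sin_plus. apply injective_projections; simpl; ring.
Qed.

Lemma Cmod_Cexp (z : C) : Cmod (Cexp z) = exp (Re z).
Proof.
  unfold Cexp, Cmod; simpl fst; simpl snd. pose proof (sin2_cos2 (Im z)) as H. unfold Rsqr in H.
  replace ((exp (Re z) * cos (Im z)) ^ 2 + (exp (Re z) * sin (Im z)) ^ 2)
    with (Rsqr (exp (Re z))) by (unfold Rsqr; nra).
  apply sqrt_Rsqr, Rlt_le, exp_pos.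
Qed.

Lemma Cexp_nz (z : C) : Cexp z <> 0.
Proof. apply Cmod_gt_0. rewrite Cmod_Cexp. apply exp_pos. Qed.

Lemma Cexp_0 : Cexp 0 = 1.
Proof. unfold Cexp; simpl. rewrite exp_0, cos_0, sin_0. apply injective_projections; simpl; ring. Qed.

Lemma is_derive_small (f : R -> R) (l : R) : is_derive f 0 l ->
  forall eps, 0 < eps -> exists d, 0 < d /\ forall x, Rabs x < d ->
    Rabs (f x - f 0 - l * x) <= eps * Rabs x.
Proof.
  intros H eps Heps. apply is_derive_Reals in H.
  destruct (H eps Heps) as (d & Hd). exists d. split; [apply cond_pos |].
  intros x Hx. destruct (Req_dec x 0) as [-> | Hx0].
  - rewrite Rabs_R0. replace (f 0 - f 0 - l * 0) with 0 by ring. rewrite Rabs_R0. lra.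
  - specialize (Hd x Hx0 Hx). rewrite Rplus_0_l in Hd.
    replace (f x - f 0 - l * x) with (((f x - f 0) / x - l) * x) by (field; assumption).
    rewrite Rabs_mult. apply Rmult_le_compat_r; [apply Rabs_pos | lra].
Qed.

(** The derivative at 0 is assembled from those of [exp], [cos] and [sin]; the addition law carries
    it to every point. *)
Lemma cdiff_Cexp (z : C) : cdiff Cexp z (Cexp z).
Proof.
  assert (H0 : cdiff Cexp 0 1).
  { intros eps Heps.
    destruct (is_derive_small exp 1) with (eps := Rmin 1 (eps / 8)) as (d1 & Hd1 & H1).
    { pose proof (is_derive_exp 0) as D; rewrite exp_0 in D; exact D. }
    { apply Rmin_pos; lra. }
    destruct (is_derive_small cos 0) with (eps := eps / 8) as (d2 & Hd2 & H2).
    { pose proof (is_derive_cos 0) as D; rewrite sin_0, Ropp_0 in D; exact D. }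
    { lra. }
    destruct (is_derive_small sin 1) with (eps := eps / 8) as (d3 & Hd3 & H3).
    { pose proof (is_derive_sin 0) as D; rewrite cos_0 in D; exact D. }
    { lra. }
    exists (Rmin (Rmin d1 (eps / 8)) (Rmin d2 (Rmin d3 (1 / 2)))). split.
    { repeat apply Rmin_pos; lra. }
    intros w Hw. replace (w - 0)%C with w in * by ring.
    assert (Hm : Cmod w < d1 /\ Cmod w < eps / 8 /\ Cmod w < d2 /\ Cmod w < d3 /\ Cmod w < 1 / 2).
    { revert Hw. unfold Rmin. repeat destruct Rle_dec; lra. }
    destruct w as [x y].
    pose proof (re_le_Cmod (x, y)) as Hx. pose proof (im_le_Cmod (x, y)) as Hy. simpl in Hx, Hy.
    specialize (H1 x ltac:(lra)). specialize (H2 y ltac:(lra)). specialize (H3 y ltac:(lra)).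
    rewrite exp_0 in H1. rewrite cos_0 in H2. rewrite sin_0 in H3.
    set (r := Cmod (x, y)) in *. clearbody r.
    rewrite Cexp_0. unfold Cexp; simpl.
    replace (((exp x * cos y)%R, (exp x * sin y)%R) - 1 - 1 * (x, y))%C
      with (exp x * cos y - 1 - x, exp x * sin y - y)
      by (unfold Cminus, Cplus, Copp, Cmult, RtoC; simpl; f_equal; ring).
    eapply Rle_trans; [apply Cmod_le_parts |].
    assert (He1 : Rabs (exp x - 1 - 1 * x) <= Rabs x).
    { eapply Rle_trans; [exact H1 |]. pose proof (Rabs_pos x). pose proof (Rmin_l 1 (eps / 8)). nra. }
    assert (He8 : Rabs (exp x - 1 - 1 * x) <= eps / 8 * Rabs x).
    { eapply Rle_trans; [exact H1 |]. apply Rmult_le_compat_r; [apply Rabs_pos | apply Rmin_r]. }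
    assert (Hex : Rabs (exp x - 1) <= 2 * Rabs x).
    { replace (exp x - 1) with ((exp x - 1 - 1 * x) + x) by ring.
      eapply Rle_trans; [apply Rabs_triang | lra]. }
    assert (Hex2 : 0 < exp x <= 2).
    { split; [apply exp_pos |]. apply Rabs_le_between in Hex. pose proof (Rabs_pos x). lra. }
    (* With [eps / 8] throughout, the real part costs three eighths of [eps] and the imaginary part
       four. *)
    assert (A1 : Rabs (exp x * cos y - 1 - x) <= eps / 8 * r + 2 * (eps / 8 * r)).
    { replace (exp x * cos y - 1 - x) with ((exp x - 1 - 1 * x) + exp x * (cos y - 1 - 0 * y)) by ring.
      eapply Rle_trans; [apply Rabs_triang |]. apply Rplus_le_compat.
      - eapply Rle_trans; [exact He8 |]. apply Rmult_le_compat_l; lra.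
      - rewrite Rabs_mult. apply Rmult_le_compat; try apply Rabs_pos.
        + rewrite Rabs_pos_eq; lra.
        + eapply Rle_trans; [exact H2 |]. apply Rmult_le_compat_l; lra. }
    assert (A2 : Rabs (exp x * sin y - y) <= 2 * (eps / 8 * r) + 2 * (eps / 8) * r).
    { replace (exp x * sin y - y) with (exp x * (sin y - 0 - 1 * y) + (exp x - 1) * y) by ring.
      eapply Rle_trans; [apply Rabs_triang |]. apply Rplus_le_compat.
      - rewrite Rabs_mult. apply Rmult_le_compat; try apply Rabs_pos.
        + rewrite Rabs_pos_eq; lra.
        + eapply Rle_trans; [exact H3 |]. apply Rmult_le_compat_l; lra.
      - rewrite Rabs_mult. apply Rmult_le_compat; try apply Rabs_pos; lra. }
    pose proof (Rabs_pos x). assert (0 <= eps * r) by nra. lra. }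
  intros eps Heps. pose proof (exp_pos (Re z)) as Hp.
  destruct (H0 (eps / exp (Re z))) as (d & Hd & H).
  { now apply Rdiv_lt_0_compat. }
  exists d. split; [exact Hd |]. intros w Hw.
  specialize (H (w - z)%C). replace (w - z - 0)%C with (w - z)%C in H by ring.
  specialize (H Hw).
  replace (Cexp w - Cexp z - Cexp z * (w - z))%C
    with (Cexp z * (Cexp (w - z) - Cexp 0 - 1 * (w - z)))%C.
  2: { replace (Cexp w) with (Cexp z * Cexp (w - z))%C; [rewrite Cexp_0; ring |].
       rewrite <- Cexp_plus. f_equal. ring. }
  rewrite Cmod_mult, Cmod_Cexp.
  apply (Rmult_le_compat_l (exp (Re z))) in H; [| lra].
  replace (exp (Re z) * (eps / exp (Re z) * Cmod (w - z))) with (eps * Cmod (w - z)) in H by (field; lra).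
  exact H.
Qed.

Definition holo_at (F : C -> C) (z : C) : Prop := exists D, cdiff F z D.

Lemma holo_cont (F : C -> C) (z : C) : holo_at F z -> forall eps, 0 < eps ->
  exists del, 0 < del /\ forall w, Cmod (w - z) < del -> Cmod (F w - F z) < eps.
Proof. intros [D HD]. exact (cdiff_cont F z D HD). Qed.

Lemma holo_re_cont (F : C -> C) (u : R -> C) (x : R) :
  holo_at F (u x) -> (forall y, Cmod (u y - u x) = Rabs (y - x)) ->
  continuous (fun y => Re (F (u y))) x.
Proof.
  intros [D HD] Hu. apply filterlim_locally. intros eps.
  destruct (cdiff_cont _ _ _ HD eps (cond_pos eps)) as (d & Hd & H).
  exists (mkposreal d Hd). intros y Hy.
  eapply Rle_lt_trans; [| apply (H (u y))].
  - change (Rabs (Re (F (u y)) - Re (F (u x))) <= Cmod (F (u y) - F (u x))).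
    eapply Rle_trans; [| apply re_le_Cmod]. right. f_equal.
  - rewrite Hu. exact Hy.
Qed.

Lemma holo_im_cont (F : C -> C) (u : R -> C) (x : R) :
  holo_at F (u x) -> (forall y, Cmod (u y - u x) = Rabs (y - x)) ->
  continuous (fun y => Im (F (u y))) x.
Proof.
  intros [D HD] Hu. apply filterlim_locally. intros eps.
  destruct (cdiff_cont _ _ _ HD eps (cond_pos eps)) as (d & Hd & H).
  exists (mkposreal d Hd). intros y Hy.
  eapply Rle_lt_trans; [| apply (H (u y))].
  - change (Rabs (Im (F (u y)) - Im (F (u x))) <= Cmod (F (u y) - F (u x))).
    eapply Rle_trans; [| apply im_le_Cmod]. right. f_equal.
  - rewrite Hu. exact Hy.
Qed.

Lemma Cmod_horizontal (x x' y : R) : Cmod ((x', y) - (x, y)) = Rabs (x' - x).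
Proof.
  replace ((x', y) - (x, y))%C with (RtoC (x' - x)).
  apply Cmod_R. unfold RtoC, Cminus, Cplus, Copp; simpl. f_equal; ring.
Qed.

Lemma Cmod_vertical (x y y' : R) : Cmod ((x, y') - (x, y)) = Rabs (y' - y).
Proof.
  replace ((x, y') - (x, y))%C with (RtoC (y' - y) * Ci)%C.
  - rewrite Cmod_mult, Cmod_R. replace (Cmod Ci) with 1; [ring |].
    unfold Cmod, Ci; simpl. rewrite <- sqrt_1 at 1. f_equal. ring.
  - unfold RtoC, Ci, Cminus, Cplus, Copp, Cmult; simpl. f_equal; ring.
Qed.

(** * Goursat's lemma and the mean value property *)

Lemma RInt_diff_near_const (f g : R -> R) (a b k M : R) :
  a <= b -> ex_RInt f a b -> ex_RInt g a b ->
  (forall t, a <= t <= b -> Rabs (f t - g t - k) <= M) ->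
  Rabs (RInt f a b - RInt g a b - k * (b - a)) <= (b - a) * M.
Proof.
  intros Hab Hf Hg H.
  assert (Hfg : ex_RInt (fun t => f t - g t) a b) by now apply (ex_RInt_minus f g).
  assert (Hk : ex_RInt (fun _ : R => k) a b) by apply ex_RInt_const.
  replace (RInt f a b - RInt g a b - k * (b - a)) with (RInt (fun t => f t - g t - k) a b).
  - apply abs_RInt_le_const; [exact Hab | now apply (ex_RInt_minus (fun t => f t - g t)) | exact H].
  - rewrite (RInt_minus (fun t => f t - g t) (fun _ => k)) by assumption.
    rewrite (RInt_minus f g) by assumption. rewrite RInt_const.
    unfold minus, plus, opp, scal; simpl; unfold mult; simpl. ring.
Qed.

(* Imaginary part of the integral of [G dz] over the boundary of [a,b] x [c,d]. *)
Definition bdry_im (G : C -> C) (a b c d : R) : R :=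
  RInt (fun x => Im (G (x, c))) a b - RInt (fun x => Im (G (x, d))) a b
  + (RInt (fun y => Re (G (b, y))) c d - RInt (fun y => Re (G (a, y))) c d).

Section Goursat.
Variables (G : C -> C) (a b c d : R).
Hypothesis HG : forall x y, a <= x <= b -> c <= y <= d -> holo_at G (x, y).

Lemma ex_RInt_im_horizontal (a' b' y : R) :
  a <= a' -> a' <= b' -> b' <= b -> c <= y <= d -> ex_RInt (fun x => Im (G (x, y))) a' b'.
Proof.
  intros. apply (ex_RInt_continuous (V := R_CompleteNormedModule)). intros x Hx.
  rewrite Rmin_left, Rmax_right in Hx by assumption.
  apply (holo_im_cont G (fun x => (x, y))). apply HG; lra. intro; apply Cmod_horizontal.
Qed.

Lemma ex_RInt_re_vertical (c' d' x : R) :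
  c <= c' -> c' <= d' -> d' <= d -> a <= x <= b -> ex_RInt (fun y => Re (G (x, y))) c' d'.
Proof.
  intros. apply (ex_RInt_continuous (V := R_CompleteNormedModule)). intros y Hy.
  rewrite Rmin_left, Rmax_right in Hy by assumption.
  apply (holo_re_cont G (fun y => (x, y))). apply HG; lra. intro; apply Cmod_vertical.
Qed.

(** The bound is divided by 4 on each quarter, so it is inherited from the quarters. On a small
    rectangle of sides [h], [k] opposite sides are compared: up to the error, the two pairs
    contribute [- Re D h k] and [Re D h k], which cancel. *)
Lemma bdry_im_small (eps : R) : a <= b -> c <= d -> 0 < eps ->
  Rabs (bdry_im G a b c d) <= eps * ((b - a) + (d - c)) ^ 2.
Proof.
  intros Hab Hcd Heps.
  apply (rect_cousin (fun a b c d => Rabs (bdry_im G a b c d) <= eps * ((b - a) + (d - c)) ^ 2));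
    [assumption | assumption | |].
  - intros a' b' c' d' H1 H2 H3 H4 H5 H6. cbv zeta.
    set (p := (a' + b') / 2). set (q := (c' + d') / 2). intros Q1 Q2 Q3 Q4.
    assert (Hp : a' <= p <= b') by (unfold p; lra). assert (Hq : c' <= q <= d') by (unfold q; lra).
    assert (E : bdry_im G a' b' c' d' = bdry_im G a' p c' q + bdry_im G p b' c' q
      + bdry_im G a' p q d' + bdry_im G p b' q d').
    { unfold bdry_im.
      rewrite <- (RInt_Chasles (fun x => Im (G (x, c'))) a' p b') by (apply ex_RInt_im_horizontal; lra).
      rewrite <- (RInt_Chasles (fun x => Im (G (x, d'))) a' p b') by (apply ex_RInt_im_horizontal; lra).
      rewrite <- (RInt_Chasles (fun y => Re (G (b', y))) c' q d') by (apply ex_RInt_re_vertical; lra).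
      rewrite <- (RInt_Chasles (fun y => Re (G (a', y))) c' q d') by (apply ex_RInt_re_vertical; lra).
      unfold plus; simpl. ring. }
    rewrite E.
    assert (Hs : forall h k, eps * ((h / 2) + (k / 2)) ^ 2 = eps * (h + k) ^ 2 / 4) by (intros; field).
    assert (P1 : p - a' = (b' - a') / 2) by (unfold p; field).
    assert (P2 : b' - p = (b' - a') / 2) by (unfold p; field).
    assert (P3 : q - c' = (d' - c') / 2) by (unfold q; field).
    assert (P4 : d' - q = (d' - c') / 2) by (unfold q; field).
    rewrite P1, P3, Hs in Q1. rewrite P2, P3, Hs in Q2. rewrite P1, P4, Hs in Q3.
    rewrite P2, P4, Hs in Q4.
    apply Rabs_le_between in Q1. apply Rabs_le_between in Q2. apply Rabs_le_between in Q3.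
    apply Rabs_le_between in Q4. apply Rabs_le. lra.
  - intros p q Hp Hq. destruct (HG p q Hp Hq) as [D HD].
    destruct (HD (eps / 2)) as (del & Hdel & H); [lra |].
    exists (del / 2). split; [lra |].
    intros a' b' c' d' H1 H2 H3 H4 H5 H6.
    set (h := b' - a') in *. set (k := d' - c') in *.
    assert (Herr : forall x y, a' <= x <= b' -> c' <= y <= d' ->
      Rabs (Re (G (x, y)) - Re (G (p, q)) - (Re D * (x - p) - Im D * (y - q))) <= eps / 2 * (h + k) /\
      Rabs (Im (G (x, y)) - Im (G (p, q)) - (Re D * (y - q) + Im D * (x - p))) <= eps / 2 * (h + k)).
    { intros x y Hx Hy.
      assert (Hm : Cmod ((x, y) - (p, q)) <= h + k).
      { eapply Rle_trans; [apply Cmod_le_parts |]. apply Rplus_le_compat; apply Rabs_le; unfold h, k; simpl; lra. }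
      specialize (H (x, y) ltac:(lra)).
      assert (He : Cmod (G (x, y) - G (p, q) - D * ((x, y) - (p, q))) <= eps / 2 * (h + k)).
      { eapply Rle_trans; [exact H |]. apply Rmult_le_compat_l; lra. }
      split.
      - eapply Rle_trans; [| exact He]. eapply Rle_trans; [| apply re_le_Cmod]. right. f_equal.
      - eapply Rle_trans; [| exact He]. eapply Rle_trans; [| apply im_le_Cmod]. right. f_equal. }
    assert (I1 := RInt_diff_near_const (fun x => Im (G (x, c'))) (fun x => Im (G (x, d'))) a' b'
      (- Re D * k) (eps * (h + k)) ltac:(lra) ltac:(apply ex_RInt_im_horizontal; lra)
      ltac:(apply ex_RInt_im_horizontal; lra)).
    assert (I2 := RInt_diff_near_const (fun y => Re (G (b', y))) (fun y => Re (G (a', y))) c' d'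
      (Re D * h) (eps * (h + k)) ltac:(lra) ltac:(apply ex_RInt_re_vertical; lra)
      ltac:(apply ex_RInt_re_vertical; lra)).
    fold h in I1. fold k in I2. unfold bdry_im.
    assert (J1 : forall t, a' <= t <= b' ->
      Rabs (Im (G (t, c')) - Im (G (t, d')) - - Re D * k) <= eps * (h + k)).
    { intros t Ht. destruct (Herr t c' ltac:(lra) ltac:(lra)) as [_ E1].
      destruct (Herr t d' ltac:(lra) ltac:(lra)) as [_ E2].
      apply Rabs_le_between in E1. apply Rabs_le_between in E2. apply Rabs_le. unfold k in *. lra. }
    assert (J2 : forall t, c' <= t <= d' ->
      Rabs (Re (G (b', t)) - Re (G (a', t)) - Re D * h) <= eps * (h + k)).
    { intros t Ht. destruct (Herr b' t ltac:(lra) ltac:(lra)) as [E1 _].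
      destruct (Herr a' t ltac:(lra) ltac:(lra)) as [E2 _].
      apply Rabs_le_between in E1. apply Rabs_le_between in E2. apply Rabs_le. unfold h in *. lra. }
    specialize (I1 J1). specialize (I2 J2).
    apply Rabs_le_between in I1. apply Rabs_le_between in I2. apply Rabs_le.
    replace (eps * (h + k) ^ 2) with (h * (eps * (h + k)) + k * (eps * (h + k))) by ring.
    lra.
Qed.

Lemma goursat : a <= b -> c <= d -> bdry_im G a b c d = 0.
Proof.
  intros Hab Hcd. set (s := ((b - a) + (d - c)) ^ 2).
  assert (Hs : 0 <= s) by apply pow2_ge_0.
  destruct (Req_dec (bdry_im G a b c d) 0) as [| Hne]; [assumption | exfalso].
  apply Rabs_pos_lt in Hne.
  pose proof (bdry_im_small (Rabs (bdry_im G a b c d) / (2 * (s + 1))) Hab Hcd) as H.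
  fold s in H. set (v := Rabs (bdry_im G a b c d)) in *.
  assert (Hv : 0 < v / (2 * (s + 1))) by (apply Rdiv_lt_0_compat; lra).
  specialize (H Hv).
  assert (v / (2 * (s + 1)) * (s + 1) = v / 2) by (field; lra). nra.
Qed.
End Goursat.

(* In the coordinate [w] with [z = z0 + zeta e^w] circles become vertical
   segments, and the horizontal sides of a rectangle of height 2 pi cancel. *)
Lemma mean_value (F : C -> C) (z0 zeta : C) :
  (forall z, Cmod (z - z0) <= Cmod zeta -> holo_at F z) ->
  RInt (fun y => Re (F (z0 + zeta * Cexp (0, y))%C)) 0 (2 * PI) = 2 * PI * Re (F z0).
Proof.
  intros HF. set (G := fun w => F (z0 + zeta * Cexp w)%C).
  pose proof PI_RGT_0 as Hpi.
  assert (Hdist : forall x y, Cmod (z0 + zeta * Cexp (x, y) - z0)%C = Cmod zeta * exp x).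
  { intros x y. replace (z0 + zeta * Cexp (x, y) - z0)%C with (zeta * Cexp (x, y))%C by ring.
    now rewrite Cmod_mult, Cmod_Cexp. }
  pose proof (Cmod_ge_0 zeta) as Hz0.
  assert (HG : forall x y, x <= 0 -> holo_at G (x, y)).
  { intros x y Hx. destruct (HF (z0 + zeta * Cexp (x, y))%C) as [D HD].
    - rewrite Hdist. assert (exp x <= 1) by (rewrite <- exp_0; destruct (Req_dec x 0) as [-> |]; [lra | apply Rlt_le, exp_increasing; lra]).
      nra.
    - exists (D * (zeta * Cexp (x, y)))%C.
      apply (cdiff_comp F (fun w => z0 + zeta * Cexp w)%C); [| exact HD].
      apply (cdiff_comp (fun w => z0 + zeta * w)%C Cexp (x, y) zeta (Cexp (x, y))).
      apply cdiff_Cexp. apply cdiff_affine. }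
  (* [J x] belongs to the circle of radius [|zeta| e^x] and does not depend on [x]. As [x] tends to
     minus infinity the circle shrinks to [z0], which determines the value. *)
  set (J := fun x => RInt (fun y => Re (G (x, y))) 0 (2 * PI)).
  assert (HJ : forall x, x <= 0 -> J x = J 0).
  { intros x Hx. pose proof (goursat G x 0 0 (2 * PI)) as Hg.
    specialize (Hg ltac:(intros; apply HG; lra) Hx ltac:(lra)). unfold bdry_im in Hg.
    assert (E : forall s, Cexp (s, 2 * PI) = Cexp (s, 0)).
    { intro s. unfold Cexp; simpl. now rewrite cos_2PI, sin_2PI, cos_0, sin_0. }
    rewrite (RInt_ext (fun s => Im (G (s, 2 * PI))) (fun s => Im (G (s, 0)))) in Hg.
    - unfold J. lra.
    - intros s _. unfold G. now rewrite E. }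
  change (J 0 = 2 * PI * Re (F z0)).
  destruct (Req_dec (J 0) (2 * PI * Re (F z0))) as [| Hne]; [assumption | exfalso].
  assert (Hpos : 0 < Rabs (J 0 - 2 * PI * Re (F z0))) by (apply Rabs_pos_lt; lra).
  set (v := Rabs (J 0 - 2 * PI * Re (F z0))) in *.
  destruct (holo_cont F z0) with (eps := v / (4 * PI)) as (del & Hdel & Hc).
  { apply HF. replace (z0 - z0)%C with (RtoC 0) by ring. rewrite Cmod_0. exact Hz0. }
  { apply Rdiv_lt_0_compat; lra. }
  (* The summand 1 covers the case [zeta = 0] and makes the radius strictly smaller than [del]. *)
  set (x := Rmin 0 (ln (del / (Cmod zeta + 1)))).
  assert (Hx : x <= 0) by apply Rmin_l.
  assert (Hxd : Cmod zeta * exp x < del).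
  { assert (0 < del / (Cmod zeta + 1)) by (apply Rdiv_lt_0_compat; lra).
    assert (exp x <= del / (Cmod zeta + 1)).
    { rewrite <- (exp_ln (del / (Cmod zeta + 1))) by assumption.
      destruct (Rle_lt_or_eq_dec x (ln (del / (Cmod zeta + 1))) ltac:(apply Rmin_r)) as [Hl | ->];
        [apply Rlt_le, exp_increasing; exact Hl | lra]. }
    assert (del / (Cmod zeta + 1) * (Cmod zeta + 1) = del) by (field; lra).
    pose proof (exp_pos x). nra. }
  assert (Hi : ex_RInt (fun y => Re (G (x, y))) 0 (2 * PI)).
  { apply (ex_RInt_re_vertical G x 0 0 (2 * PI)); try lra. intros; apply HG; lra. }
  pose proof (RInt_diff_near_const (fun y => Re (G (x, y))) (fun _ => 0) 0 (2 * PI) (Re (F z0))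
    (v / (4 * PI)) ltac:(lra) Hi ltac:(apply ex_RInt_const)) as Hn.
  rewrite RInt_const in Hn. unfold scal in Hn; simpl in Hn; unfold mult in Hn; simpl in Hn.
  fold (J x) in Hn. rewrite (HJ x Hx) in Hn.
  assert (Hb : Rabs (J 0 - (2 * PI - 0) * 0 - Re (F z0) * (2 * PI - 0)) <= (2 * PI - 0) * (v / (4 * PI))).
  { apply Hn. intros t _. apply Rlt_le.
    eapply Rle_lt_trans; [| apply (Hc (z0 + zeta * Cexp (x, t))%C); rewrite Hdist; exact Hxd].
    eapply Rle_trans; [| apply re_le_Cmod]. right. f_equal. unfold G, Re, Im; simpl. ring. }
  replace (J 0 - (2 * PI - 0) * 0 - Re (F z0) * (2 * PI - 0)) with (J 0 - 2 * PI * Re (F z0)) in Hb by ring.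
  fold v in Hb. replace ((2 * PI - 0) * (v / (4 * PI))) with (v / 2) in Hb by (field; lra). lra.
Qed.

(** * The maximum principle and the three circles *)

Lemma holo_comp (F G : C -> C) (z : C) :
  holo_at G z -> holo_at F (G z) -> holo_at (fun w => F (G w)) z.
Proof. intros [E HE] [D HD]. exists (D * E)%C. now apply cdiff_comp. Qed.

Lemma holo_mult (F G : C -> C) (z : C) :
  holo_at F z -> holo_at G z -> holo_at (fun w => F w * G w)%C z.
Proof. intros [D HD] [E HE]. eexists. apply cdiff_mult; eassumption. Qed.

Lemma holo_Cexp (z : C) : holo_at Cexp z.
Proof. eexists. apply cdiff_Cexp. Qed.

Lemma holo_affine (k m z : C) : holo_at (fun w => k + m * w)%C z.
Proof. eexists. apply cdiff_affine. Qed.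

(** By continuity at the left end, the integrand stays below [(K + f 0) / 2] on a short initial
    interval; this gain makes the inequality strict. *)
Lemma RInt_lt_const (f : R -> R) (len K : R) :
  0 < len -> (forall x, 0 <= x <= len -> continuous f x) ->
  (forall x, 0 <= x <= len -> f x <= K) -> f 0 < K -> RInt f 0 len < len * K.
Proof.
  intros Hl Hc HK H0.
  assert (Hi : forall a b, 0 <= a -> a <= b -> b <= len -> ex_RInt f a b).
  { intros a b Ha Hab Hb. apply (ex_RInt_continuous (V := R_CompleteNormedModule)).
    intros x Hx. rewrite Rmin_left, Rmax_right in Hx by assumption. apply Hc; lra. }
  pose proof (Hc 0 ltac:(lra)) as Hc0.
  set (e := (K - f 0) / 2). assert (He : 0 < e) by (unfold e; lra).
  pose proof (proj1 (filterlim_locally f (f 0)) Hc0 (mkposreal e He)) as [d Hd].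
  set (k := Rmin len (d / 2)).
  assert (Hk : 0 < k) by (apply Rmin_pos; [exact Hl |]; pose proof (cond_pos d); lra).
  assert (Hkl : k <= len) by apply Rmin_l.
  assert (Hkd : k < d) by (pose proof (Rmin_r len (d / 2)); pose proof (cond_pos d); unfold k; lra).
  rewrite <- (RInt_Chasles f 0 k len) by (apply Hi; lra).
  assert (I1 : RInt f 0 k <= k * (K - e)).
  { apply Rle_trans with (RInt (fun _ => K - e) 0 k).
    - apply RInt_le; [lra | apply Hi; lra | apply ex_RInt_const |].
      intros x Hx. specialize (Hd x).
      assert (Hb : ball (M := R_UniformSpace) 0 d x).
      { change (Rabs (x - 0) < d). rewrite Rabs_pos_eq; lra. }
      specialize (Hd Hb). change (Rabs (f x - f 0) < e) in Hd.
      apply Rabs_lt_between in Hd. unfold e in *. lra.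
    - rewrite RInt_const. unfold scal; simpl; unfold mult; simpl. lra. }
  assert (I2 : RInt f k len <= (len - k) * K).
  { apply Rle_trans with (RInt (fun _ => K) k len).
    - apply RInt_le; [lra | apply Hi; lra | apply ex_RInt_const |]. intros x Hx. apply HK; lra.
    - rewrite RInt_const. unfold scal; simpl; unfold mult; simpl. lra. }
  unfold plus; simpl. nra.
Qed.

(** The bound on the angle confines the search for a maximum in [annulus_max] to a compact
    rectangle. *)
Lemma polar (z : C) : z <> 0 ->
  exists th, - PI <= th <= PI /\ z = Cexp (ln (Cmod z), th).
Proof.
  intro Hz. apply Cmod_gt_0 in Hz as Hr. set (r := Cmod z) in *.
  pose proof (re_le_Cmod z) as Hre. fold r in Hre. apply Rabs_le_between in Hre.
  assert (Hc : -1 <= Re z / r <= 1).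
  { split; [apply Rle_div_r | apply Rle_div_l]; lra. }
  pose proof (acos_bound (Re z / r)) as Hb. pose proof (cos_acos _ Hc) as Hcos.
  assert (Hsq : Im z * Im z = r * r - Re z * Re z).
  { unfold r. pose proof (Cmod2_alt z) as E. simpl in E. unfold Re, Im in *. nra. }
  assert (Hsin : r * sin (acos (Re z / r)) = Rabs (Im z)).
  { rewrite sin_acos by exact Hc.
    rewrite <- (sqrt_Rsqr r) at 1 by lra. rewrite <- sqrt_mult_alt by apply Rle_0_sqr.
    rewrite <- sqrt_Rsqr_abs. f_equal. unfold Rsqr.
    transitivity (r * r - Re z * Re z); [field; lra |]. rewrite Hsq. reflexivity. }
  exists (if Rle_dec 0 (Im z) then acos (Re z / r) else - acos (Re z / r)).
  split; [destruct Rle_dec; lra |].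
  unfold Cexp. simpl. rewrite exp_ln by exact Hr.
  destruct Rle_dec as [Hi | Hi].
  - rewrite Hcos, Hsin, Rabs_pos_eq by exact Hi.
    destruct z as [zx zy]; simpl in *. f_equal. field; lra.
  - rewrite cos_neg, sin_neg, Hcos.
    replace (r * - sin (acos (Re z / r))) with (- (r * sin (acos (Re z / r)))) by ring.
    rewrite Hsin, Rabs_left by lra.
    destruct z as [zx zy]; simpl in *. f_equal; [field; lra | ring].
Qed.

Lemma exp_le_mono (x y : R) : x <= y -> exp x <= exp y.
Proof. intros Hxy. destruct (Req_dec x y) as [-> | Hn]; [lra | apply Rlt_le, exp_increasing; lra]. Qed.

(* The maximum principle for the multivalued [f(z) (z - s0)^(- beta)], read in
   the coordinate [w = ln (z - s0)]: at a maximum in the open strip, the mean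
   value property on the largest circle inside the strip is violated near the
   point where that circle touches the boundary. *)
Lemma annulus_max (f : C -> C) (s0 : C) (r1 r3 beta M : R) :
  0 < r1 -> r1 <= r3 -> 0 <= M ->
  (forall z, r1 <= Cmod (z - s0) <= r3 -> holo_at f z) ->
  (forall z, Cmod (z - s0) = r1 \/ Cmod (z - s0) = r3 ->
     Cmod (f z) <= M * exp (beta * ln (Cmod (z - s0)))) ->
  forall z, r1 <= Cmod (z - s0) <= r3 ->
    Cmod (f z) <= M * exp (beta * ln (Cmod (z - s0))).
Proof.
  intros Hr1 Hr13 HM Hf Hb z1 Hz1.
  set (G := fun w => (f (s0 + Cexp w) * Cexp (- beta * w))%C).
  set (x1 := ln r1). set (x3 := ln r3).
  assert (Hx13 : x1 <= x3) by (apply ln_le; assumption).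
  pose proof PI_RGT_0 as Hpi.
  assert (Hdist : forall x y, Cmod (s0 + Cexp (x, y) - s0) = exp x).
  { intros. replace (s0 + Cexp (x, y) - s0)%C with (Cexp (x, y)) by ring. apply Cmod_Cexp. }
  assert (Hann : forall x, x1 <= x <= x3 -> r1 <= exp x <= r3).
  { intros x Hx. rewrite <- (exp_ln r1), <- (exp_ln r3) by lra. split; apply exp_le_mono; tauto. }
  assert (HG : forall x y, x1 <= x <= x3 -> holo_at G (x, y)).
  { intros x y Hx. apply holo_mult.
    - apply (holo_comp f (fun w => s0 + Cexp w)%C).
      + destruct (holo_comp (fun u => s0 + 1 * u)%C Cexp (x, y)) as [D HD].
        apply holo_Cexp. apply holo_affine. exists D.
        eapply cdiff_ext; [| exact HD]. intro w. cbv beta. ring.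
      + apply Hf. rewrite Hdist. now apply Hann.
    - apply (holo_comp Cexp (fun w => - beta * w)%C); [| apply holo_Cexp].
      destruct (holo_affine 0 (- beta)%C (x, y)) as [D HD]. exists D.
      eapply cdiff_ext; [| exact HD]. intro w. cbv beta. ring. }
  assert (HN : forall x y, Cmod (G (x, y)) = Cmod (f (s0 + Cexp (x, y))%C) * exp (- (beta * x))).
  { intros. unfold G. rewrite Cmod_mult, Cmod_Cexp. f_equal. f_equal. simpl. ring. }
  (* [G] need not be periodic in [y], but its modulus is: the modulus of [Cexp (- beta * w)] depends
     on [x] only. *)
  assert (Hred : forall x y, x1 <= x <= x3 -> exists th, - PI <= th <= PI /\ Cmod (G (x, y)) = Cmod (G (x, th))).
  { intros x y Hx. destruct (polar (Cexp (x, y)) (Cexp_nz _)) as (th & Hth & E).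
    rewrite Cmod_Cexp in E. simpl in E. rewrite ln_exp in E.
    exists th. split; [exact Hth |]. rewrite !HN, E. reflexivity. }
  assert (Hside : forall x y, x = x1 \/ x = x3 -> Cmod (G (x, y)) <= M).
  { intros x y Hx. rewrite HN.
    assert (Ex : exp x = r1 \/ exp x = r3).
    { destruct Hx as [-> | ->]; [left | right]; apply exp_ln; lra. }
    specialize (Hb (s0 + Cexp (x, y))%C). rewrite Hdist, ln_exp in Hb. specialize (Hb Ex).
    apply Rle_trans with (M * exp (beta * x) * exp (- (beta * x))).
    - apply Rmult_le_compat_r; [apply Rlt_le, exp_pos | exact Hb].
    - rewrite Rmult_assoc, <- exp_plus. replace (beta * x + - (beta * x)) with 0 by ring.
      rewrite exp_0. lra. }
  assert (Hgoal : forall x y, x1 <= x <= x3 -> Cmod (G (x, y)) <= M).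
  2: { assert (Hz0 : (z1 - s0)%C <> 0) by (apply Cmod_gt_0; lra).
       destruct (polar _ Hz0) as (th & _ & E).
       specialize (Hgoal (ln (Cmod (z1 - s0))) th).
       rewrite HN, <- E in Hgoal. replace (s0 + (z1 - s0))%C with z1 in Hgoal by ring.
       set (b := beta * ln (Cmod (z1 - s0))) in *.
       apply Rle_trans with (Cmod (f z1) * exp (- b) * exp b).
       - rewrite Rmult_assoc, <- exp_plus. replace (- b + b) with 0 by ring. rewrite exp_0. lra.
       - apply Rmult_le_compat_r; [apply Rlt_le, exp_pos |]. apply Hgoal.
         split; apply ln_le; lra. }
  assert (Hbd : exists B, forall x y, x1 <= x <= x3 -> - PI <= y <= PI -> Cmod (G (x, y)) <= B).
  { apply (rect_cousin (fun a b c d => exists B, forall x y, a <= x <= b -> c <= y <= d -> Cmod (G (x, y)) <= B));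
      [assumption | lra | |].
    - intros a b c d _ _ _ _ _ _ p q [B1 H1] [B2 H2] [B3 H3] [B4 H4].
      exists (Rmax (Rmax B1 B2) (Rmax B3 B4)). intros x y Hx Hy.
      pose proof (Rmax_l (Rmax B1 B2) (Rmax B3 B4)). pose proof (Rmax_r (Rmax B1 B2) (Rmax B3 B4)).
      pose proof (Rmax_l B1 B2). pose proof (Rmax_r B1 B2).
      pose proof (Rmax_l B3 B4). pose proof (Rmax_r B3 B4).
      destruct (Rle_dec x p), (Rle_dec y q).
      + specialize (H1 x y ltac:(lra) ltac:(lra)). lra.
      + specialize (H3 x y ltac:(lra) ltac:(lra)). lra.
      + specialize (H2 x y ltac:(lra) ltac:(lra)). lra.
      + specialize (H4 x y ltac:(lra) ltac:(lra)). lra.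
    - intros p q Hp Hq. destruct (holo_cont G (p, q) (HG p q Hp) 1 Rlt_0_1) as (d & Hd & H).
      exists (d / 2). split; [lra |]. intros a b c e H1 H2 H3 H4 H5 H6.
      exists (Cmod (G (p, q)) + 1). intros x y Hx Hy.
      specialize (H (x, y)). assert (Hxy : Cmod ((x, y) - (p, q)) < d).
      { eapply Rle_lt_trans; [apply Cmod_le_parts |]. simpl.
        assert (Rabs (x + - p) < d / 2) by (apply Rabs_lt_between; lra).
        assert (Rabs (y + - q) < d / 2) by (apply Rabs_lt_between; lra). lra. }
      specialize (H Hxy). pose proof (Cmod_triangle (G (x, y) - G (p, q)) (G (p, q))) as T.
      replace (G (x, y) - G (p, q) + G (p, q))%C with (G (x, y)) in T by ring. lra. }
  destruct Hbd as [B HB].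
  destruct (completeness (fun v => exists x y, x1 <= x <= x3 /\ - PI <= y <= PI /\ v = Cmod (G (x, y)))) as [S [HS1 HS2]].
  { exists B. intros v (x & y & Hx & Hy & ->). now apply HB. }
  { exists (Cmod (G (x1, 0))), x1, 0. repeat split; lra. }
  assert (HSub : forall x y, x1 <= x <= x3 -> Cmod (G (x, y)) <= S).
  { intros x y Hx. destruct (Hred x y Hx) as (th & Hth & ->). apply HS1. now exists x, th. }
  destruct (Rle_dec S M) as [HSM | HSM].
  { intros x y Hx. specialize (HSub x y Hx). lra. }
  exfalso. apply Rnot_le_lt in HSM.
  (* Otherwise every point has a neighbourhood where [|G|] stays a fixed amount below [S]; bisection
     makes the amount uniform, against the definition of [S]. *)
  assert (Hatt : exists p q, x1 <= p <= x3 /\ Cmod (G (p, q)) = S).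
  { apply NNPP. intro Hno.
    assert (Hlt : exists e, 0 < e /\ forall x y, x1 <= x <= x3 -> - PI <= y <= PI -> Cmod (G (x, y)) <= S - e).
    { apply (rect_cousin (fun a b c d => exists e, 0 < e /\ forall x y, a <= x <= b -> c <= y <= d -> Cmod (G (x, y)) <= S - e));
      [assumption | lra | |].
      - intros a b c d _ _ _ _ _ _ p q (B1 & P1 & H1) (B2 & P2 & H2) (B3 & P3 & H3) (B4 & P4 & H4).
        exists (Rmin (Rmin B1 B2) (Rmin B3 B4)). split; [repeat apply Rmin_pos; assumption |].
        intros x y Hx Hy.
        pose proof (Rmin_l (Rmin B1 B2) (Rmin B3 B4)). pose proof (Rmin_r (Rmin B1 B2) (Rmin B3 B4)).
        pose proof (Rmin_l B1 B2). pose proof (Rmin_r B1 B2).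
        pose proof (Rmin_l B3 B4). pose proof (Rmin_r B3 B4).
        destruct (Rle_dec x p), (Rle_dec y q).
        + specialize (H1 x y ltac:(lra) ltac:(lra)). lra.
        + specialize (H3 x y ltac:(lra) ltac:(lra)). lra.
        + specialize (H2 x y ltac:(lra) ltac:(lra)). lra.
        + specialize (H4 x y ltac:(lra) ltac:(lra)). lra.
      - intros p q Hp Hq. assert (Hpq : Cmod (G (p, q)) < S).
        { destruct (HSub p q Hp) as [|Heq]; [assumption | exfalso; apply Hno; now exists p, q]. }
        destruct (holo_cont G (p, q) (HG p q Hp) ((S - Cmod (G (p, q))) / 2)) as (d & Hd & H); [lra |].
        exists (d / 2). split; [lra |]. intros a b c e H1 H2 H3 H4 H5 H6.
        exists ((S - Cmod (G (p, q))) / 2). split; [lra |]. intros x y Hx Hy.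
        specialize (H (x, y)). assert (Hxy : Cmod ((x, y) - (p, q)) < d).
        { eapply Rle_lt_trans; [apply Cmod_le_parts |]. simpl.
          assert (Rabs (x + - p) < d / 2) by (apply Rabs_lt_between; lra).
          assert (Rabs (y + - q) < d / 2) by (apply Rabs_lt_between; lra). lra. }
        specialize (H Hxy). pose proof (Cmod_triangle (G (x, y) - G (p, q)) (G (p, q))) as T.
        replace (G (x, y) - G (p, q) + G (p, q))%C with (G (x, y)) in T by ring. lra. }
    destruct Hlt as (e & He & Hle). specialize (HS2 (S - e)).
    assert (S <= S - e); [apply HS2 | lra]. intros v (x & y & Hx & Hy & ->). now apply Hle. }
  destruct Hatt as (p & q & Hp & Hpq).
  assert (Hp1 : x1 < p < x3).
  { split; apply Rnot_le_lt; intro Hle.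
    - pose proof (Hside p q ltac:(left; lra)). lra.
    - pose proof (Hside p q ltac:(right; lra)). lra. }
  (* The radius carries a sign, so that angle 0, where [RInt_lt_const] asks for the strict
     inequality, is the point of contact with the boundary. *)
  assert (Hzeta : exists rho, (p + rho = x1 \/ p + rho = x3) /\ x1 <= p - Rabs rho /\ p + Rabs rho <= x3).
  { destruct (Rle_dec (p - x1) (x3 - p)).
    - exists (x1 - p). rewrite Rabs_left by lra. lra.
    - exists (x3 - p). rewrite Rabs_pos_eq by lra. lra. }
  destruct Hzeta as (rho & Hrho & Hrho1 & Hrho3).
  (* The conjugate factor turns the modulus into a real part: [Re F] is [S * S] at the maximum and
     at most [S |G|] everywhere. *)
  set (F := fun w => (Cconj (G (p, q)) * G w)%C).
  assert (HF : forall x y, x1 <= x <= x3 -> holo_at F (x, y)).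
  { intros x y Hx. apply (holo_mult (fun _ => Cconj (G (p, q)))); [| now apply HG].
    exists 0. apply cdiff_const. }
  assert (Hcirc : forall z, Cmod (z - (p, q)) <= Cmod rho -> x1 <= Re z <= x3).
  { intros [x y] Hz. rewrite Cmod_R in Hz. pose proof (re_le_Cmod ((x, y) - (p, q))) as Hr.
    simpl in Hr. apply Rabs_le_between in Hr. simpl. lra. }
  assert (Hdisc : forall z, Cmod (z - (p, q)) <= Cmod rho -> holo_at F z).
  { intros z Hz. specialize (Hcirc z Hz). destruct z as [x y]. now apply HF. }
  pose proof (mean_value F (p, q) rho Hdisc) as Hmv.
  assert (HFpq : Re (F (p, q)) = S * S).
  { unfold F. rewrite <- Hpq. pose proof (Cmod2_alt (G (p, q))) as E. simpl in E.
    unfold Cconj, Cmult, Re, Im in *; simpl in *. nra. }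
  rewrite HFpq in Hmv.
  assert (HFle : forall w, Re (F w) <= S * Cmod (G w)).
  { intro w. eapply Rle_trans; [apply Rle_abs |]. eapply Rle_trans; [apply re_le_Cmod |].
    unfold F. rewrite Cmod_mult, Cmod_conj, Hpq. lra. }
  assert (Honc : forall y, Cmod ((p, q) + rho * Cexp (0, y) - (p, q))%C <= Cmod rho).
  { intro y. replace ((p, q) + rho * Cexp (0, y) - (p, q))%C with (rho * Cexp (0, y))%C by ring.
    rewrite Cmod_mult, Cmod_Cexp. simpl. rewrite exp_0. lra. }
  assert (Hlt : RInt (fun y => Re (F ((p, q) + rho * Cexp (0, y))%C)) 0 (2 * PI) < 2 * PI * (S * S)).
  { apply RInt_lt_const; [lra | | |].
    - intros y _. apply (holo_re_cont (fun w => F ((p, q) + rho * Cexp w)%C) (fun y => (0, y))).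
      + apply (holo_comp F (fun w => (p, q) + rho * Cexp w)%C).
        * apply (holo_comp (fun u => (p, q) + rho * u)%C Cexp); [apply holo_Cexp | apply holo_affine].
        * apply Hdisc, Honc.
      + intro y'. apply Cmod_vertical.
    - intros y _. eapply Rle_trans; [apply HFle |]. apply Rmult_le_compat_l; [lra |].
      specialize (Hcirc _ (Honc y)). destruct ((p, q) + rho * Cexp (0, y))%C as [u v]. now apply HSub.
    - eapply Rle_lt_trans; [apply HFle |]. change (0, 0) with (RtoC 0). rewrite Cexp_0.
      replace ((p, q) + rho * 1)%C with ((p + rho)%R, q).
      + apply Rmult_lt_compat_l; [lra |]. apply Rle_lt_trans with M; [now apply Hside | exact HSM].
      + unfold Cplus, Cmult, RtoC; simpl. f_equal; ring. }
  lra.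
Qed.

(** This is [annulus_max] with the exponent [b] and the constant for which [M r^b] equals [M1] at
    [r1] and [M3] at [r3]. *)
Lemma three_circles (f : C -> C) (s0 : C) (r1 r3 M1 M3 : R) :
  0 < r1 -> r1 < r3 -> 0 < M1 -> 0 < M3 ->
  (forall z, r1 <= Cmod (z - s0) <= r3 -> holo_at f z) ->
  (forall z, Cmod (z - s0) = r1 -> Cmod (f z) <= M1) ->
  (forall z, Cmod (z - s0) = r3 -> Cmod (f z) <= M3) ->
  forall z, r1 <= Cmod (z - s0) <= r3 ->
    Cmod (f z) <= M1 * Rpower (M3 / M1) (ln (Cmod (z - s0) / r1) / ln (r3 / r1)).
Proof.
  intros Hr1 Hr3 HM1 HM3 Hf H1 H3 z Hz.
  assert (Hl : 0 < ln r3 - ln r1) by (pose proof (ln_increasing r1 r3 Hr1 Hr3); lra).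
  set (b := (ln M3 - ln M1) / (ln r3 - ln r1)).
  assert (E : forall x, M1 * exp (- b * ln r1) * exp (b * ln x) = M1 * exp (b * (ln x - ln r1))).
  { intro x. rewrite Rmult_assoc, <- exp_plus. do 2 f_equal. ring. }
  pose proof (annulus_max f s0 r1 r3 b (M1 * exp (- b * ln r1)) Hr1 ltac:(lra)) as Ha.
  eapply Rle_trans; [apply Ha; try assumption |].
  - apply Rmult_le_pos; [lra | apply Rlt_le, exp_pos].
  - intros w [Hw | Hw]; rewrite E, Hw.
    + replace (b * (ln r1 - ln r1)) with 0 by ring. rewrite exp_0. specialize (H1 w Hw). lra.
    + replace (b * (ln r3 - ln r1)) with (ln M3 - ln M1) by (unfold b; field; lra).
      replace (M1 * exp (ln M3 - ln M1)) with M3; [now apply H3 |].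
      unfold Rminus. rewrite exp_plus, exp_Ropp, !exp_ln by assumption. field; lra.
  - rewrite E. unfold Rpower. rewrite !ln_div by lra. right. do 2 f_equal. unfold b. field. lra.
Qed.

(** * Schwarz's lemma and the Borel-Caratheodory theorem *)

Lemma schwarz (g : C -> C) (s0 : C) (R0 : R) : 0 < R0 ->
  (forall z, Cmod (z - s0) <= R0 -> holo_at g z) -> g s0 = 0 ->
  (forall z, Cmod (z - s0) = R0 -> Cmod (g z) <= 1) ->
  forall z, Cmod (z - s0) <= R0 -> Cmod (g z) <= Cmod (z - s0) / R0.
Proof.
  intros HR Hg Hg0 Hb z Hz.
  destruct (Req_dec (Cmod (z - s0)) 0) as [E0 | Hz0].
  { assert (z = s0) as ->.
    { apply Cmod_eq_0 in E0. replace z with ((z - s0) + s0)%C by ring. rewrite E0. ring. }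
    rewrite Hg0, E0, Cmod_0. unfold Rdiv. lra. }
  pose proof (Cmod_ge_0 (z - s0)) as Hz1. set (r := Cmod (z - s0)) in *.
  assert (Hr : 0 < r) by lra.
  destruct (Hg s0) as [D HD].
  { replace (s0 - s0)%C with (RtoC 0) by ring. rewrite Cmod_0. lra. }
  destruct (HD 1 Rlt_0_1) as (d & Hd & Hlin). set (K := Cmod D + 1).
  assert (HK : 0 < K) by (pose proof (Cmod_ge_0 D); unfold K; lra).
  (* Instead of dividing by [z - s0], the maximum principle is applied with every exponent
     [beta < 1]; the claim is the limit as [beta] tends to 1. *)
  assert (Hbeta : forall beta, beta < 1 -> Cmod (g z) <= exp (beta * (ln r - ln R0))).
  { intros beta Hbeta.
    (* Near [s0] one has [|g w| <= K |w - s0|]. The last entry of the minimum ensures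
       [K r1 <= (r1 / R0)^beta], which is possible because [beta < 1]. *)
    set (r1 := Rmin r (Rmin (d / 2) (exp ((- beta * ln R0 - ln K) / (1 - beta))))).
    assert (Hr1 : 0 < r1) by (repeat apply Rmin_pos; [lra | lra | apply exp_pos]).
    assert (Hr1r : r1 <= r) by apply Rmin_l.
    assert (Hr1d : r1 <= d / 2) by (eapply Rle_trans; [apply Rmin_r | apply Rmin_l]).
    assert (Hr1e : r1 <= exp ((- beta * ln R0 - ln K) / (1 - beta)))
      by (eapply Rle_trans; [apply Rmin_r | apply Rmin_r]).
    assert (Hln : (1 - beta) * ln r1 <= - beta * ln R0 - ln K).
    { apply ln_le in Hr1e; [| exact Hr1]. rewrite ln_exp in Hr1e.
      apply (Rmult_le_compat_l (1 - beta)) in Hr1e; [| lra].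
      replace ((1 - beta) * ((- beta * ln R0 - ln K) / (1 - beta))) with (- beta * ln R0 - ln K) in Hr1e
        by (field; lra). exact Hr1e. }
    assert (E : forall x, exp (- beta * ln R0) * exp (beta * ln x) = exp (beta * (ln x - ln R0))).
    { intro x. rewrite <- exp_plus. f_equal. ring. }
    rewrite <- E. apply (annulus_max g s0 r1 R0 beta); try lra.
    - apply Rlt_le, exp_pos.
    - intros w Hw. apply Hg. lra.
    - intros w [Hw | Hw]; rewrite E, Hw.
      + specialize (Hlin w ltac:(lra)). rewrite Hg0, Hw in Hlin.
        replace (g w - 0 - D * (w - s0))%C with (g w - D * (w - s0))%C in Hlin by ring.
        pose proof (Cmod_triangle (g w - D * (w - s0)) (D * (w - s0))) as T.
        replace (g w - D * (w - s0) + D * (w - s0))%C with (g w) in T by ring.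
        rewrite Cmod_mult, Hw in T.
        apply Rle_trans with (K * r1); [unfold K; lra |].
        rewrite <- (exp_ln (K * r1)) by (apply Rmult_lt_0_compat; lra).
        apply exp_le_mono. rewrite ln_mult by lra. lra.
      + replace (beta * (ln R0 - ln R0)) with 0 by ring. rewrite exp_0. now apply Hb.
    - fold r. lra. }
  destruct (Rle_dec (Cmod (g z)) (r / R0)) as [| Hn]; [assumption | exfalso].
  apply Rnot_le_lt in Hn.
  assert (Hq : 0 < r / R0) by (apply Rdiv_lt_0_compat; lra).
  set (l := ln r - ln R0) in *.
  assert (Hl : l <= 0) by (pose proof (ln_le r R0 Hr Hz); unfold l; lra).
  assert (Hgl : l < ln (Cmod (g z))).
  { unfold l. rewrite <- ln_div by assumption. now apply ln_increasing. }
  set (e := (ln (Cmod (g z)) - l) / (2 * (1 - l))).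
  assert (He : 0 < e) by (apply Rdiv_lt_0_compat; lra).
  specialize (Hbeta (1 - e) ltac:(lra)).
  apply ln_le in Hbeta; [| lra]. rewrite ln_exp in Hbeta.
  assert (e * (1 - l) = (ln (Cmod (g z)) - l) / 2) by (unfold e; field; lra). nra.
Qed.

(* Schwarz's lemma applied to h / (2B - h), h = f - f(s0), Re h <= B. *)
Lemma borel_caratheodory (f : C -> C) (s0 : C) (R0 A : R) : 0 < R0 -> 0 <= A ->
  (forall z, Cmod (z - s0) <= R0 -> holo_at f z) ->
  (forall z, Cmod (z - s0) <= R0 -> Re (f z) <= A) ->
  forall z, Cmod (z - s0) < R0 ->
    Cmod (f z) <= 2 * R0 / (R0 - Cmod (z - s0)) * (A + Cmod (f s0)).
Proof.
  intros HR HA Hf HRe z Hz. set (r := Cmod (z - s0)) in *.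
  assert (Hr : 0 <= r) by apply Cmod_ge_0.
  set (h := fun w => (f w - f s0)%C).
  assert (Hh : forall w, Cmod (w - s0) <= R0 -> holo_at h w).
  { intros w Hw. destruct (Hf w Hw) as [D HD]. eexists.
    apply (cdiff_plus f (fun _ => - f s0)%C w D 0 HD). apply cdiff_const. }
  (* The margin [kap] keeps [B] positive even when [A] and [f s0] vanish, so that [2 B - h] has no
     zero. A limit removes it afterwards. *)
  assert (Hkey : forall kap, 0 < kap -> Cmod (h z) <= 2 * (A + Cmod (f s0) + kap) * r / (R0 - r)).
  { intros kap Hkap. set (B := A + Cmod (f s0) + kap).
    pose proof (Cmod_ge_0 (f s0)) as Hf0.
    assert (HB : 0 < B) by (unfold B; lra).
    assert (HhB : forall w, Cmod (w - s0) <= R0 -> Re (h w) <= B).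
    { intros w Hw. specialize (HRe w Hw). pose proof (re_le_Cmod (f s0)) as Hr0.
      apply Rabs_le_between in Hr0. unfold h, B. unfold Cminus. rewrite re_plus, re_opp. lra. }
    assert (Hne : forall w, Re (h w) <= B -> (2 * B - h w)%C <> 0).
    { intros w Hw E. apply (f_equal Re) in E. unfold Re, Cminus, Cplus, Cmult, Copp, RtoC in *; simpl in *. lra. }
    set (g := fun w => (h w * / (2 * B - h w))%C).
    (* A point of real part at most [B] is no farther from 0 than from [2 B]. *)
    assert (Hle : forall w, Re (h w) <= B -> Cmod (h w) <= Cmod (2 * B - h w)%C).
    { intros w Hw. unfold Cmod. apply sqrt_le_1_alt. destruct (h w) as [u v].
      unfold Re, Cminus, Cplus, Cmult, Copp, RtoC in *; simpl in *. nra. }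
    assert (Hg1 : forall w, Cmod (w - s0) <= R0 -> Cmod (g w) = Cmod (h w) / Cmod (2 * B - h w)%C).
    { intros w Hw. apply Cmod_div, Hne, HhB, Hw. }
    assert (Hs : Cmod (g z) <= r / R0).
    { apply (schwarz g s0 R0 HR).
      - intros w Hw. apply holo_mult; [now apply Hh |].
        apply (holo_comp Cinv (fun w => 2 * B - h w)%C).
        + destruct (holo_comp (fun u => 2 * B + (-(1)) * u)%C h w (Hh w Hw)) as [D HD].
          apply holo_affine. exists D. eapply cdiff_ext; [| exact HD]. intro u. cbv beta. ring.
        + eexists. apply cdiff_inv, Hne, HhB, Hw.
      - unfold g, h. ring.
      - intros w Hw. rewrite Hg1 by lra.
        apply Rle_div_l; [apply Cmod_gt_0, Hne, HhB; lra |]. rewrite Rmult_1_l. apply Hle, HhB. lra.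
      - fold r. lra. }
    rewrite Hg1 in Hs by (fold r; lra).
    assert (Hd : 0 < Cmod (2 * B - h z)%C) by (apply Cmod_gt_0, Hne, HhB; fold r; lra).
    apply (proj1 (Rle_div_l _ _ _ Hd)) in Hs.
    assert (HT : Cmod (2 * B - h z)%C <= 2 * B + Cmod (h z)).
    { unfold Cminus. eapply Rle_trans; [apply Cmod_triangle |].
      rewrite Cmod_opp, Cmod_mult, !Cmod_R, !Rabs_pos_eq by lra. lra. }
    assert (Hq : 0 <= r / R0) by (apply Rdiv_le_0_compat; lra).
    assert (H1 : Cmod (h z) <= r / R0 * (2 * B + Cmod (h z))).
    { eapply Rle_trans; [exact Hs |]. now apply Rmult_le_compat_l. }
    apply Rle_div_r; [lra |].
    apply (Rmult_le_compat_r R0) in H1; [| lra].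
    replace (r / R0 * (2 * B + Cmod (h z)) * R0) with (r * (2 * B + Cmod (h z))) in H1 by (field; lra).
    lra. }
  assert (Hlim : Cmod (h z) <= 2 * (A + Cmod (f s0)) * r / (R0 - r)).
  { destruct (Rle_dec (Cmod (h z)) (2 * (A + Cmod (f s0)) * r / (R0 - r))) as [| Hn]; [assumption | exfalso].
    apply Rnot_le_lt in Hn. set (v := 2 * (A + Cmod (f s0)) * r / (R0 - r)) in *.
    set (q := 2 * r / (R0 - r)). assert (Hq : 0 <= q) by (apply Rdiv_le_0_compat; lra).
    specialize (Hkey ((Cmod (h z) - v) / (2 * (q + 1)))).
    assert (Hp : 0 < (Cmod (h z) - v) / (2 * (q + 1))) by (apply Rdiv_lt_0_compat; lra).
    specialize (Hkey Hp). set (k := (Cmod (h z) - v) / (2 * (q + 1))) in *.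
    assert (Hk : k * (q + 1) = (Cmod (h z) - v) / 2) by (unfold k; field; lra).
    replace (2 * (A + Cmod (f s0) + k) * r / (R0 - r)) with (v + k * q) in Hkey
      by (unfold v, q; field; lra). nra. }
  pose proof (Cmod_triangle (h z) (f s0)) as T. unfold h at 1 in T.
  replace (f z - f s0 + f s0)%C with (f z) in T by ring.
  pose proof (Cmod_ge_0 (f s0)) as Hf0.
  eapply Rle_trans; [exact T |].
  apply Rle_trans with (2 * (A + Cmod (f s0)) * r / (R0 - r) + Cmod (f s0)); [lra |].
  apply Rminus_le_0.
  replace (2 * R0 / (R0 - r) * (A + Cmod (f s0)) - (2 * (A + Cmod (f s0)) * r / (R0 - r) + Cmod (f s0)))
    with (2 * A + Cmod (f s0)) by (field; lra). lra.
Qed.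

(** The discs used for [log L] touch the line Re z = 1/2, where no holomorphic continuation is
    assumed. The closed version is applied with radius [R0 - e], and [e] tends to 0 once the
    denominator is cleared. *)
Lemma borel_caratheodory_open (f : C -> C) (s0 : C) (R0 A : R) : 0 <= A ->
  (forall z, Cmod (z - s0) < R0 -> holo_at f z) ->
  (forall z, Cmod (z - s0) < R0 -> Re (f z) <= A) ->
  forall z, Cmod (z - s0) < R0 ->
    Cmod (f z) <= 2 * R0 / (R0 - Cmod (z - s0)) * (A + Cmod (f s0)).
Proof.
  intros HA Hf HRe z Hz. pose proof (Cmod_ge_0 (z - s0)) as Hr. set (r := Cmod (z - s0)) in *.
  pose proof (Cmod_ge_0 (f s0)). pose proof (Cmod_ge_0 (f z)) as Hfz.
  assert (Hmul : Cmod (f z) * (R0 - r) <= 2 * R0 * (A + Cmod (f s0))).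
  { apply Rle_plus_epsilon. intros eps Heps.
    set (e := Rmin ((R0 - r) / 2) (eps / (Cmod (f z) + 1))).
    assert (He : 0 < e) by (apply Rmin_pos; [lra | apply Rdiv_lt_0_compat; lra]).
    assert (He1 : e <= (R0 - r) / 2) by apply Rmin_l.
    assert (He2 : e * (Cmod (f z) + 1) <= eps).
    { replace eps with (eps / (Cmod (f z) + 1) * (Cmod (f z) + 1)) by (field; lra).
      apply Rmult_le_compat_r; [lra | apply Rmin_r]. }
    pose proof (borel_caratheodory f s0 (R0 - e) A ltac:(lra) HA
      ltac:(intros; apply Hf; lra) ltac:(intros; apply HRe; lra) z ltac:(fold r; lra)) as Hb.
    fold r in Hb.
    apply (Rmult_le_compat_r (R0 - e - r)) in Hb; [| lra].
    replace (2 * (R0 - e) / (R0 - e - r) * (A + Cmod (f s0)) * (R0 - e - r))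
      with (2 * (R0 - e) * (A + Cmod (f s0))) in Hb by (field; lra). nra. }
  replace (2 * R0 / (R0 - r) * (A + Cmod (f s0))) with (2 * R0 * (A + Cmod (f s0)) / (R0 - r)) by (field; lra).
  apply Rle_div_r; [lra | exact Hmul].
Qed.

(** * The zeta function on the real axis *)

Lemma sum_n_m_split (g : nat -> R) (n k : nat) : (1 <= n <= k)%nat ->
  sum_n_m g 1 k = sum_n_m g 1 n + sum_n_m g (S n) k.
Proof. intros H. rewrite (sum_n_m_Chasles g 1 n k) by lia. reflexivity. Qed.

Lemma sum_n_m_nonneg (g : nat -> R) (n k : nat) :
  (forall i, (n <= i <= k)%nat -> 0 <= g i) -> 0 <= sum_n_m g n k.
Proof.
  intros H. destruct (Nat.le_gt_cases n k) as [Hnk | Hnk].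
  - induction Hnk as [| k Hnk IH].
    + rewrite sum_n_n. apply H. lia.
    + rewrite sum_n_Sm by lia. apply Rplus_le_le_0_compat; [apply IH; intros; apply H; lia | apply H; lia].
  - rewrite sum_n_m_zero by assumption. apply Rle_refl.
Qed.

Lemma sum_n_m_le_upper (g : nat -> R) (n k : nat) : (forall i, 0 <= g i) -> (n <= k)%nat ->
  sum_n_m g 1 n <= sum_n_m g 1 k.
Proof.
  intros Hg Hnk. destruct n as [| n].
  - rewrite (sum_n_m_zero g 1 0) by lia. now apply sum_n_m_nonneg.
  - rewrite (sum_n_m_split g (S n) k) by lia.
    pose proof (sum_n_m_nonneg g (S (S n)) k ltac:(auto)). lra.
Qed.

Lemma sum_n_m_null (g : nat -> R) (n k : nat) :
  (forall i, (n <= i <= k)%nat -> g i = 0) -> sum_n_m g n k = 0.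
Proof.
  intros H. destruct (Nat.le_gt_cases n k) as [Hnk | Hnk].
  - induction Hnk as [| k Hnk IH].
    + rewrite sum_n_n. apply H. lia.
    + rewrite sum_n_Sm by lia. rewrite IH by (intros; apply H; lia). rewrite H by lia. apply Rplus_0_l.
  - now apply (@sum_n_m_zero R_AbelianMonoid).
Qed.

Definition ifP (Q : Prop) (x : R) : R := if excluded_middle_informative Q then x else 0.

Lemma ifP_true (Q : Prop) (x : R) : Q -> ifP Q x = x.
Proof. intro; unfold ifP; destruct excluded_middle_informative; tauto. Qed.

Lemma ifP_false (Q : Prop) (x : R) : ~ Q -> ifP Q x = 0.
Proof. intro; unfold ifP; destruct excluded_middle_informative; tauto. Qed.

Lemma ifP_nonneg (Q : Prop) (x : R) : 0 <= x -> 0 <= ifP Q x.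
Proof. intro; unfold ifP; destruct excluded_middle_informative; lra. Qed.

Lemma sum_multiples (g : nat -> R) (p Y : nat) : (1 <= p)%nat ->
  sum_n_m (fun n => ifP (Nat.divide p n) (g n)) 1 (p * Y) = sum_n_m (fun j => g (p * j)%nat) 1 Y.
Proof.
  intro Hp. induction Y as [| Y IH].
  - rewrite Nat.mul_0_r. rewrite !(@sum_n_m_zero R_AbelianMonoid) by lia. reflexivity.
  - rewrite (sum_n_Sm _ 1 Y) by lia. rewrite <- IH.
    assert (E : sum_n_m (fun n => ifP (Nat.divide p n) (g n)) (S (p * Y)) (p * S Y) = g (p * S Y)%nat).
    { destruct p as [| p]; [lia |].
      replace (S p * S Y)%nat with (S (S p * Y + p)) by lia.
      rewrite sum_n_Sm by lia. rewrite sum_n_m_null.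
      - rewrite ifP_true; [apply Rplus_0_l |]. exists (S Y). lia.
      - intros i Hi. apply ifP_false. intros [q Hq]. subst i.
        assert (Y < q)%nat by nia. nia. }
    destruct Y as [| Y].
    + rewrite Nat.mul_0_r in *. rewrite (@sum_n_m_zero R_AbelianMonoid _ 1 0) by lia.
      rewrite E. symmetry. apply Rplus_0_l.
    + rewrite (sum_n_m_split _ (p * S Y)) by nia. rewrite E. reflexivity.
Qed.

Section Sieve.
Variables (w : nat -> R) (W : R).
Hypothesis w_mult : forall i j, (1 <= i)%nat -> (1 <= j)%nat -> w (i * j)%nat = w i * w j.
Hypothesis w_pos : forall i, 0 <= w i.
Hypothesis w_one : w 1%nat = 1.
Hypothesis w_lt : forall p, is_prime p -> w p < 1.
Hypothesis w_sum : forall X, sum_n_m w 1 X <= W.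

Definition rough (N n : nat) : Prop :=
  forall p, is_prime p -> (p <= N)%nat -> ~ Nat.divide p n.

Definition rough_sum (N X : nat) : R := sum_n_m (fun n => ifP (rough N n) (w n)) 1 X.

Lemma is_prime_ge2 (p : nat) : is_prime p -> (2 <= p)%nat.
Proof. intros H. apply prime_ge_2 in H. lia. Qed.

Lemma is_prime_divide (p i j : nat) : is_prime p -> Nat.divide p (i * j) ->
  Nat.divide p i \/ Nat.divide p j.
Proof.
  intros Hp H.
  assert (Hz : (Z.of_nat p | Z.of_nat i * Z.of_nat j)%Z).
  { destruct H as [q Hq]. exists (Z.of_nat q). lia. }
  assert (Hback : forall k, (Z.of_nat p | Z.of_nat k)%Z -> Nat.divide p k).
  { intros k [q Hq]. pose proof (is_prime_ge2 p Hp).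
    exists (Z.to_nat q). destruct (Z.neg_nonneg_cases q) as [Hn | Hn]; nia. }
  apply prime_mult in Hz; [| exact Hp]. destruct Hz; [left | right]; now apply Hback.
Qed.

Lemma is_prime_divide_prime (p q : nat) : is_prime p -> is_prime q -> Nat.divide p q -> p = q.
Proof.
  intros Hp Hq [k Hk].
  assert (Hz : (Z.of_nat p | Z.of_nat q)%Z) by (exists (Z.of_nat k); lia).
  apply prime_div_prime in Hz; [lia | exact Hp | exact Hq].
Qed.

(** Truncation at a multiple of [p] makes the identity exact: the multiples of [p] up to [p * Y] are
    the [p * j] with [j <= Y], and the primes up to [p'] divide [p * j] only if they divide [j]. *)
Lemma rough_sum_step (p' Y : nat) : let p := S p' in is_prime p ->
  rough_sum p (p * Y) = rough_sum p' (p * Y) - w p * rough_sum p' Y.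
Proof.
  intros p Hp. pose proof (is_prime_ge2 p Hp) as Hp2.
  assert (E : rough_sum p' (p * Y) = plus (rough_sum p (p * Y))
    (sum_n_m (fun n => ifP (Nat.divide p n) (ifP (rough p' n) (w n))) 1 (p * Y))).
  { unfold rough_sum. rewrite <- sum_n_m_plus. apply sum_n_m_ext. intro n. unfold plus; simpl.
    destruct (excluded_middle_informative (rough p' n)) as [Hr | Hr].
    - rewrite !(ifP_true (rough p' n)) by assumption.
      destruct (excluded_middle_informative (Nat.divide p n)) as [Hd | Hd].
      + rewrite (ifP_true _ _ Hd). rewrite ifP_false; [lra |]. intro H. apply (H p Hp (Nat.le_refl _) Hd).
      + rewrite (ifP_false _ _ Hd). rewrite ifP_true; [lra |].
        intros q Hq Hqp. destruct (Nat.eq_dec q p) as [-> | Hne]; [exact Hd |]. apply Hr; [exact Hq |]. unfold p in *; lia.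
    - rewrite !(ifP_false (rough p' n)) by assumption.
      rewrite (ifP_false (rough p n)).
      + unfold ifP; destruct excluded_middle_informative; lra.
      + intro H. apply Hr. intros q Hq Hqp. apply H; [exact Hq | unfold p; lia]. }
  rewrite sum_multiples in E by lia.
  rewrite (sum_n_m_ext_loc _ (fun j => mult (w p) (ifP (rough p' j) (w j)))) in E.
  - rewrite sum_n_m_mult_l in E.
    change (rough_sum p' (p * Y)%nat = rough_sum p (p * Y)%nat + w p * rough_sum p' Y) in E. lra.
  - intros j Hj. change (ifP (rough p' (p * j)) (w (p * j)%nat) = w p * ifP (rough p' j) (w j)).
    assert (Hiff : rough p' (p * j) <-> rough p' j).
    { split; intros H q Hq Hqp Hd.
      - apply (H q Hq Hqp). now apply Nat.divide_mul_r.
      - apply is_prime_divide in Hd; [| exact Hq]. destruct Hd as [Hd | Hd]; [| now apply (H q)].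
        apply is_prime_divide_prime in Hd; [unfold p in *; lia | exact Hq | exact Hp]. }
    destruct (excluded_middle_informative (rough p' j)) as [Hr | Hr].
    + rewrite !ifP_true by tauto. apply w_mult; lia.
    + rewrite !ifP_false by tauto. lra.
Qed.

Definition prime_log_sum (N : nat) : R :=
  sum_n (fun p => if prime_dec (Z.of_nat p) then - ln (1 - w p) else 0) N.

Lemma rough_sum_lub (N : nat) : exists s, is_lub (fun x => exists X, x = rough_sum N X) s /\
  s <= W * exp (- prime_log_sum N).
Proof.
  assert (Hinc : forall N n k, (n <= k)%nat -> rough_sum N n <= rough_sum N k).
  { intros. apply sum_n_m_le_upper; [| assumption]. intro i; apply ifP_nonneg, w_pos. }
  induction N as [| N (s & [Hs1 Hs2] & Hs)].
  - destruct (completeness (fun x => exists X, x = rough_sum 0 X)) as [s Hs].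
    + exists W. intros x [X ->]. apply Rle_trans with (sum_n_m w 1 X); [| apply w_sum].
      apply sum_n_m_le. intro k. unfold ifP. destruct excluded_middle_informative; [apply Rle_refl | apply w_pos].
    + exists (rough_sum 0 0). now exists O.
    + exists s. split; [exact Hs |]. unfold prime_log_sum. rewrite sum_O. simpl Z.of_nat.
      destruct prime_dec as [H0 | _]; [apply prime_ge_2 in H0; lia |].
      rewrite Ropp_0, exp_0, Rmult_1_r. apply Hs. intros x [X ->].
      apply Rle_trans with (sum_n_m w 1 X); [| apply w_sum].
      apply sum_n_m_le. intro k. unfold ifP. destruct excluded_middle_informative; [apply Rle_refl | apply w_pos].
  - assert (Hle : forall X, rough_sum (S N) X <= rough_sum N X).
    { intro X. apply sum_n_m_le. intro n.
      destruct (excluded_middle_informative (rough N n)) as [Hr | Hr].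
      - rewrite (ifP_true (rough N n)) by assumption. unfold ifP. destruct excluded_middle_informative; [apply Rle_refl | apply w_pos].
      - rewrite !ifP_false; [apply Rle_refl | assumption |]. intro H; apply Hr. intros q Hq Hqn. apply H; [exact Hq | lia]. }
    destruct (completeness (fun x => exists X, x = rough_sum (S N) X)) as [s' Hs'].
    + exists s. intros x [X ->]. eapply Rle_trans; [apply Hle |]. apply Hs1. now exists X.
    + exists (rough_sum (S N) 0). now exists O.
    + exists s'. split; [exact Hs' |].
      assert (E : prime_log_sum (S N) = prime_log_sum N
        + (if prime_dec (Z.of_nat (S N)) then - ln (1 - w (S N)) else 0))
        by (unfold prime_log_sum; rewrite sum_Sn; reflexivity).
      rewrite E.
      destruct (prime_dec (Z.of_nat (S N))) as [Hp | Hp].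
      * pose proof (w_lt (S N) Hp) as Hw1. pose proof (w_pos (S N)) as Hw0.
        replace (- (prime_log_sum N + - ln (1 - w (S N)))) with (- prime_log_sum N + ln (1 - w (S N))) by ring.
        rewrite exp_plus, exp_ln by lra. rewrite <- Rmult_assoc.
        apply Rle_trans with (s * (1 - w (S N))); [| apply Rmult_le_compat_r; lra].
        apply Hs'. intros x [X ->].
        apply Rle_plus_epsilon. intros eps Heps.
        assert (HY : exists Y, s - eps < rough_sum N Y).
        { apply NNPP. intro Hn. assert (s <= s - eps); [| lra]. apply Hs2. intros y [Y ->].
          apply Rnot_lt_le. intro. apply Hn. now exists Y. }
        destruct HY as [Y HY].
        (* This cut-off is a multiple of the prime, is at least [X], and lets the subtracted sum run
           past [Y], so that it exceeds [s - eps]. *)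
        apply Rle_trans with (rough_sum (S N) (S N * (X + Y))); [apply Hinc; nia |].
        rewrite rough_sum_step by assumption.
        pose proof (Hs1 (rough_sum N (S N * (X + Y))) ltac:(eexists; reflexivity)).
        pose proof (Hinc N Y (X + Y)%nat ltac:(lia)).
        assert (w (S N) * (s - eps) <= w (S N) * rough_sum N (X + Y)) by (apply Rmult_le_compat_l; lra).
        nra.
      * rewrite Rplus_0_r.
        eapply Rle_trans; [| exact Hs]. apply Hs'. intros x [X ->].
        eapply Rle_trans; [apply Hle |]. apply Hs1. now exists X.
Qed.

(** The integer 1 survives every sieve, so [1 <= W * exp (- prime_log_sum N)]. *)
Lemma prime_log_sum_le (N : nat) : prime_log_sum N <= ln W.
Proof.
  destruct (rough_sum_lub N) as (s & [Hs _] & HsW).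
  assert (H1 : 1 <= s).
  { apply Hs. exists 1%nat. unfold rough_sum. rewrite sum_n_n, ifP_true; [now rewrite w_one |].
    intros p Hp _ Hd. apply Nat.divide_1_r in Hd. apply is_prime_ge2 in Hp. lia. }
  pose proof (exp_pos (- prime_log_sum N)) as He.
  assert (HW : 0 < W).
  { pose proof (w_sum 1) as H. rewrite sum_n_n in H. lra. }
  rewrite <- (ln_exp (prime_log_sum N)). apply ln_le; [apply exp_pos |].
  rewrite exp_Ropp in HsW. pose proof (exp_pos (prime_log_sum N)) as He2.
  assert (1 <= W / exp (prime_log_sum N)) by (unfold Rdiv; lra).
  apply Rle_div_r in H; [lra | exact He2].
Qed.
End Sieve.

(** * Monotonicity, convexity and integral comparison *)

Lemma derive_nonpos_decr (g dg : R -> R) (a b : R) : a <= b ->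
  (forall x, a <= x <= b -> is_derive g x (dg x)) ->
  (forall x, a <= x <= b -> dg x <= 0) -> g b <= g a.
Proof.
  intros Hab Hd Hn.
  destruct (MVT_gen g a b dg) as (c & Hc & E).
  - intros x Hx. rewrite Rmin_left, Rmax_right in Hx by assumption. apply Hd. lra.
  - intros x Hx. rewrite Rmin_left, Rmax_right in Hx by assumption.
    apply continuity_pt_filterlim, (ex_derive_continuous (V := R_NormedModule) g). eexists. apply Hd. lra.
  - rewrite Rmin_left, Rmax_right in Hc by assumption. specialize (Hn c Hc). nra.
Qed.

Lemma Derive_eq (f : R -> R) (x l : R) : is_derive f x l -> Derive (fun y : R => f y) x = l.
Proof. exact (is_derive_unique f x l). Qed.

(** The error is differentiated in the right endpoint; the sign of its derivative is the convexity
    inequality [f x - f a <= (x - a) * f1 x]. *)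
Lemma trapezoid_convex (F f f1 f2 : R -> R) (a b : R) : a <= b ->
  (forall x, a <= x <= b -> is_derive F x (f x)) ->
  (forall x, a <= x <= b -> is_derive f x (f1 x)) ->
  (forall x, a <= x <= b -> is_derive f1 x (f2 x)) ->
  (forall x, a <= x <= b -> 0 <= f2 x) ->
  F b - F a <= (b - a) * ((f a + f b) / 2).
Proof.
  intros Hab HF Hf Hf1 Hf2.
  assert (Hk : forall x, a <= x <= b -> f x - f a - (x - a) * f1 x <= 0).
  { intros x Hx.
    pose proof (derive_nonpos_decr (fun x => f x - f a - (x - a) * f1 x) (fun x => - ((x - a) * f2 x)) a x) as H.
    assert (f x - f a - (x - a) * f1 x <= f a - f a - (a - a) * f1 a); [apply H; try lra |].
    - intros y Hy. auto_derive.
      + repeat split. eexists; apply Hf; lra. eexists; apply Hf1; lra.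
      + rewrite (Derive_eq f _ _ (Hf y ltac:(lra))).
        rewrite (Derive_eq f1 _ _ (Hf1 y ltac:(lra))). ring.
    - intros y Hy. specialize (Hf2 y ltac:(lra)). nra.
    - lra. }
  pose proof (derive_nonpos_decr (fun x => F x - F a - (x - a) * ((f a + f x) / 2))
    (fun x => (f x - f a - (x - a) * f1 x) / 2) a b Hab) as H.
  assert (F b - F a - (b - a) * ((f a + f b) / 2) <= F a - F a - (a - a) * ((f a + f a) / 2)); [apply H |].
  - intros y Hy. auto_derive.
    + repeat split. eexists; apply HF; lra. eexists; apply Hf; lra.
    + rewrite (Derive_eq f _ _ (Hf y ltac:(lra))).
      rewrite (Derive_eq F _ _ (HF y ltac:(lra))). field.
  - intros x Hx. specialize (Hk x Hx). lra.
  - lra.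
Qed.

Lemma ln_le_sub1 (x : R) : 0 < x -> ln x <= x - 1.
Proof. intro Hx. pose proof (exp_ineq1_le (ln x)) as H. rewrite exp_ln in H by exact Hx. lra. Qed.

Lemma INR_S_pos (n : nat) : 0 < INR (S n).
Proof. apply lt_0_INR. lia. Qed.

(** Comparison with the integral of [x^(-1-eta)]: the induction carries its value
    [(1 - N^(-eta)) / eta] between 1 and [N], and the step is an instance of [exp u >= 1 + u]. *)
Lemma zeta_partial_le (eta : R) (N : nat) : 0 < eta ->
  sum_n_m (fun n => Rpower (INR n) (- (1 + eta))) 1 N <= 1 + 1 / eta.
Proof.
  intros He.
  assert (H : forall N, sum_n_m (fun n => Rpower (INR n) (- (1 + eta))) 1 (S N)
    <= 1 + (1 - Rpower (INR (S N)) (- eta)) / eta).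
  { intros M. induction M as [| M IH].
    - rewrite sum_n_n. simpl INR. unfold Rpower. rewrite ln_1, !Rmult_0_r, exp_0. lra.
    - rewrite sum_n_Sm by lia. unfold plus; simpl plus.
      set (x := INR (S M)) in *. replace (INR (S (S M))) with (x + 1) by (rewrite (S_INR (S M)); reflexivity).
      assert (Hx : 0 < x) by apply INR_S_pos.
      apply Rle_trans with (1 + (1 - Rpower x (- eta)) / eta + Rpower (x + 1) (- (1 + eta))); [apply Rplus_le_compat_r, IH |].
      assert (E : Rpower (x + 1) (- (1 + eta)) = Rpower (x + 1) (- eta) / (x + 1)).
      { replace (- (1 + eta)) with (- eta + - (1)) by ring. rewrite Rpower_plus, (Rpower_Ropp _ 1), Rpower_1 by lra. reflexivity. }
      assert (E2 : Rpower x (- eta) >= Rpower (x + 1) (- eta) * (1 + eta / (x + 1))).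
      { assert (Hl : / (x + 1) <= ln (x + 1) - ln x).
        { pose proof (ln_le_sub1 (x / (x + 1)) ltac:(apply Rdiv_lt_0_compat; lra)) as Hl.
          rewrite ln_div in Hl by lra. replace (x / (x + 1) - 1) with (- / (x + 1)) in Hl by (field; lra). lra. }
        unfold Rpower.
        replace (- eta * ln x) with (- eta * ln (x + 1) + eta * (ln (x + 1) - ln x)) by ring.
        rewrite exp_plus. apply Rle_ge, Rmult_le_compat_l; [apply Rlt_le, exp_pos |].
        eapply Rle_trans; [| apply exp_ineq1_le]. unfold Rdiv. nra. }
      rewrite E. apply Rminus_le_0.
      replace (1 + (1 - Rpower (x + 1) (- eta)) / eta - (1 + (1 - Rpower x (- eta)) / eta + Rpower (x + 1) (- eta) / (x + 1)))
        with ((Rpower x (- eta) - Rpower (x + 1) (- eta) * (1 + eta / (x + 1))) / eta) by (field; lra).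
      apply Rdiv_le_0_compat; lra. }
  destruct N as [| N].
  - rewrite (@sum_n_m_zero R_AbelianMonoid) by lia. unfold zero; simpl.
    assert (0 < 1 / eta) by (apply Rdiv_lt_0_compat; lra). lra.
  - eapply Rle_trans; [apply H |]. pose proof (exp_pos (- eta * ln (INR (S N)))) as Hp.
    apply Rplus_le_compat_l. apply Rmult_le_compat_r; [apply Rlt_le, Rinv_0_lt_compat, He |].
    unfold Rpower. lra.
Qed.

(** * Euler's constant and numerical bounds *)

Definition harm (n : nat) : R := sum_n_m (fun k => / INR k) 1 n.

Lemma harm_S (n : nat) : harm (S n) = harm n + / INR (S n).
Proof. unfold harm. rewrite sum_n_Sm by lia. reflexivity. Qed.

Lemma ln_trapezoid (x : R) : 0 < x -> ln (x + 1) - ln x <= (/ x + / (x + 1)) / 2.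
Proof.
  intro Hx.
  pose proof (trapezoid_convex ln (fun x => / x) (fun x => - / x ^ 2) (fun x => 2 / x ^ 3) x (x + 1)) as H.
  replace ((/ x + / (x + 1)) / 2) with ((x + 1 - x) * ((/ x + / (x + 1)) / 2)) by (field; lra).
  apply H; [lra | | | |]; intros y Hy.
  - apply is_derive_ln. lra.
  - auto_derive; [lra | field; lra].
  - auto_derive; [nra | field; lra].
  - apply Rdiv_le_0_compat; [lra |]. apply pow_lt. lra.
Qed.

(** With the trapezoidal correction [1 / (2 n)] the sequence increases, while [harm n - ln n]
    decreases. Indices are shifted by one because monotonicity starts at 1. *)
Lemma EulerMascheroni_lower (n : nat) : (1 <= n)%nat ->
  harm n - ln (INR n) - / (2 * INR n) <= EulerMascheroni.
Proof.
  intro Hn. set (u := fun n => harm n - ln (INR n)).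
  assert (Hdec : forall k, u (S (S k)) <= u (S k)).
  { intro k. unfold u. rewrite (harm_S (S k)). rewrite (S_INR (S k)).
    pose proof (INR_S_pos k) as Hk. set (x := INR (S k)) in *.
    pose proof (ln_le_sub1 (x / (x + 1)) ltac:(apply Rdiv_lt_0_compat; lra)) as Hl.
    rewrite ln_div in Hl by lra. replace (x / (x + 1) - 1) with (- / (x + 1)) in Hl by (field; lra). lra. }
  assert (Hinc : forall k, u (S k) - / (2 * INR (S k)) <= u (S (S k)) - / (2 * INR (S (S k)))).
  { intro k. unfold u. rewrite (harm_S (S k)). rewrite (S_INR (S k)).
    pose proof (INR_S_pos k) as Hk. set (x := INR (S k)) in *.
    pose proof (ln_trapezoid x Hk) as Hl. rewrite !Rinv_mult. lra. }
  assert (Hinc2 : forall k j, u (S k) - / (2 * INR (S k)) <= u (S (k + j)) - / (2 * INR (S (k + j)))).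
  { intros k j. induction j as [| j IH]. rewrite Nat.add_0_r; lra.
    rewrite Nat.add_succ_r. specialize (Hinc (k + j)%nat). lra. }
  assert (Hpos : forall k, 0 < / (2 * INR (S k))) by (intro k; pose proof (INR_S_pos k); apply Rinv_0_lt_compat; lra).
  destruct n as [| n]; [lia |].
  assert (Hlb : forall k, u (S n) - / (2 * INR (S n)) <= u (S k)).
  { assert (Hdec2 : forall k j, u (S (k + j)) <= u (S k)).
    { intros k j. induction j as [| j IH]. rewrite Nat.add_0_r; lra.
      rewrite Nat.add_succ_r. specialize (Hdec (k + j)%nat). lra. }
    intro k. destruct (Nat.le_ge_cases n k) as [Hk | Hk].
    - specialize (Hinc2 n (k - n)%nat). replace (n + (k - n))%nat with k in Hinc2 by lia.
      specialize (Hpos k). lra.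
    - specialize (Hdec2 k (n - k)%nat). replace (k + (n - k))%nat with n in Hdec2 by lia.
      specialize (Hpos n). lra. }
  destruct (ex_finite_lim_seq_decr (fun k => u (S k)) (u (S n) - / (2 * INR (S n)))) as [l Hl].
  { intro k. apply Hdec. }
  { exact Hlb. }
  assert (E : EulerMascheroni = l).
  { apply is_lim_seq_incr_1 in Hl. apply is_lim_seq_unique in Hl.
    change (real (Lim_seq u) = l). now rewrite Hl. }
  rewrite E. apply (is_lim_seq_le (fun _ => u (S n) - / (2 * INR (S n))) (fun k => u (S k)) (u (S n) - / (2 * INR (S n))) l Hlb).
  - apply is_lim_seq_const.
  - exact Hl.
Qed.

(* Two terms of the series of [artanh]. *)
Lemma ln_ratio_bounds (y : R) : 0 <= y <= 1 / 2 ->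
  2 * y + 2 * y ^ 3 / 3 <= ln (1 + y) - ln (1 - y) <= 2 * y + 2 * y ^ 3 / (3 * (1 - y ^ 2)).
Proof.
  intro Hy. split.
  - pose proof (derive_nonpos_decr (fun y => 2 * y + 2 * y ^ 3 / 3 - (ln (1 + y) - ln (1 - y)))
      (fun y => - (2 * y ^ 4 / (1 - y ^ 2))) 0 y) as H.
    assert (2 * y + 2 * y ^ 3 / 3 - (ln (1 + y) - ln (1 - y))
      <= 2 * 0 + 2 * 0 ^ 3 / 3 - (ln (1 + 0) - ln (1 - 0))); [apply H; [lra | |] |].
    + intros x Hx. auto_derive; [lra |]. field. nra.
    + intros x Hx. assert (0 <= 2 * x ^ 4 / (1 - x ^ 2)); [| lra]. apply Rdiv_le_0_compat; [| nra].
      pose proof (pow_le x 4 ltac:(lra)). lra.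
    + rewrite Rplus_0_r, Rminus_0_r, ln_1 in H0. simpl in H0. lra.
  - pose proof (derive_nonpos_decr (fun y => (ln (1 + y) - ln (1 - y)) - (2 * y + 2 * y ^ 3 / (3 * (1 - y ^ 2))))
      (fun y => - (4 * y ^ 4 / (3 * (1 - y ^ 2) ^ 2))) 0 y) as H.
    assert ((ln (1 + y) - ln (1 - y)) - (2 * y + 2 * y ^ 3 / (3 * (1 - y ^ 2)))
      <= (ln (1 + 0) - ln (1 - 0)) - (2 * 0 + 2 * 0 ^ 3 / (3 * (1 - 0 ^ 2)))); [apply H; [lra | |] |].
    + intros x Hx. auto_derive; [repeat split; try lra; nra |]. field. nra.
    + intros x Hx. assert (0 <= 4 * x ^ 4 / (3 * (1 - x ^ 2) ^ 2)); [| lra]. apply Rdiv_le_0_compat.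
      pose proof (pow_le x 4 ltac:(lra)). lra. assert (0 < 1 - x ^ 2) by nra. apply Rmult_lt_0_compat; [lra |]. now apply pow_lt.
    + rewrite Rplus_0_r, Rminus_0_r, ln_1 in H0.
      replace (2 * 0 + 2 * 0 ^ 3 / (3 * (1 - 0 ^ 2))) with 0 in H0 by field. lra.
Qed.

(** The values 1/7, 1/5, 1/9 of [y] give the logarithms of 4/3, 3/2, 5/4. Then ln 2 is the sum of
    the first two, ln 3 = ln 2 + ln (3/2), and ln 5 = 2 ln 2 + ln (5/4). *)
Lemma ln_bounds_235 :
  6929 / 10000 <= ln 2 <= 6933 / 10000 /\
  10983 / 10000 <= ln 3 <= 10989 / 10000 /\
  16090 / 10000 <= ln 5 <= 16097 / 10000.
Proof.
  pose proof (ln_ratio_bounds (1 / 7) ltac:(lra)) as H1.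
  pose proof (ln_ratio_bounds (1 / 5) ltac:(lra)) as H2.
  pose proof (ln_ratio_bounds (1 / 9) ltac:(lra)) as H3.
  rewrite <- !ln_div in H1, H2, H3 by lra.
  replace ((1 + 1 / 7) / (1 - 1 / 7)) with (2 * 2 / 3) in H1 by field.
  replace ((1 + 1 / 5) / (1 - 1 / 5)) with (3 / 2) in H2 by field.
  replace ((1 + 1 / 9) / (1 - 1 / 9)) with (5 / (2 * 2)) in H3 by field.
  rewrite ln_div, ln_mult in H1, H3 by lra. rewrite ln_div in H2 by lra.
  simpl in H1, H2, H3. repeat split; lra.
Qed.

Lemma exp_lower2 (y : R) : 0 <= y -> 1 + y + y ^ 2 / 2 <= exp y.
Proof.
  intro Hy. pose proof (derive_nonpos_decr (fun y => 1 + y + y ^ 2 / 2 - exp y) (fun y => 1 + y - exp y) 0 y Hy) as H.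
  assert (1 + y + y ^ 2 / 2 - exp y <= 1 + 0 + 0 ^ 2 / 2 - exp 0); [apply H |].
  - intros x _. auto_derive; [exact I | field].
  - intros x _. pose proof (exp_ineq1_le x). lra.
  - rewrite exp_0 in H0. simpl in H0. lra.
Qed.

(** First of three alternating Taylor bounds; each follows by integrating the bound of one degree
    less. *)
Lemma exp_neg_upper2 (y : R) : 0 <= y -> exp (- y) <= 1 - y + y ^ 2 / 2.
Proof.
  intro Hy. pose proof (derive_nonpos_decr (fun y => exp (- y) - (1 - y + y ^ 2 / 2)) (fun y => - exp (- y) - (- 1 + y)) 0 y Hy) as H.
  assert (exp (- y) - (1 - y + y ^ 2 / 2) <= exp (- 0) - (1 - 0 + 0 ^ 2 / 2)); [apply H |].
  - intros x _. auto_derive; [exact I | field].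
  - intros x _. pose proof (exp_ineq1_le (- x)). lra.
  - rewrite Ropp_0, exp_0 in H0. simpl in H0. lra.
Qed.

Lemma exp_neg_lower3 (y : R) : 0 <= y -> 1 - y + y ^ 2 / 2 - y ^ 3 / 6 <= exp (- y).
Proof.
  intro Hy. pose proof (derive_nonpos_decr (fun y => (1 - y + y ^ 2 / 2 - y ^ 3 / 6) - exp (- y)) (fun y => exp (- y) - (1 - y + y ^ 2 / 2)) 0 y Hy) as H.
  assert ((1 - y + y ^ 2 / 2 - y ^ 3 / 6) - exp (- y) <= (1 - 0 + 0 ^ 2 / 2 - 0 ^ 3 / 6) - exp (- 0)); [apply H |].
  - intros x _. auto_derive; [exact I | field].
  - intros x Hx. pose proof (exp_neg_upper2 x ltac:(lra)). lra.
  - rewrite Ropp_0, exp_0 in H0. simpl in H0. lra.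
Qed.

Lemma exp_neg_upper4 (y : R) : 0 <= y -> exp (- y) <= 1 - y + y ^ 2 / 2 - y ^ 3 / 6 + y ^ 4 / 24.
Proof.
  intro Hy. pose proof (derive_nonpos_decr (fun y => exp (- y) - (1 - y + y ^ 2 / 2 - y ^ 3 / 6 + y ^ 4 / 24))
     (fun y => (1 - y + y ^ 2 / 2 - y ^ 3 / 6) - exp (- y)) 0 y Hy) as H.
  assert (exp (- y) - (1 - y + y ^ 2 / 2 - y ^ 3 / 6 + y ^ 4 / 24) <= exp (- 0) - (1 - 0 + 0 ^ 2 / 2 - 0 ^ 3 / 6 + 0 ^ 4 / 24)); [apply H |].
  - intros x _. auto_derive; [exact I | field].
  - intros x Hx. pose proof (exp_neg_lower3 x ltac:(lra)). lra.
  - rewrite Ropp_0, exp_0 in H0. simpl in H0. lra.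
Qed.

(** * The bound zeta(1 + eta) <= e^(gamma eta) / eta *)

Definition zeta_partial (eta : R) (N : nat) : R :=
  sum_n_m (fun n => Rpower (INR n) (- (1 + eta))) 1 N.

Lemma zeta_partial_S (eta : R) (N : nat) :
  zeta_partial eta (S N) = zeta_partial eta N + Rpower (INR (S N)) (- (1 + eta)).
Proof. unfold zeta_partial. rewrite sum_n_Sm by lia. reflexivity. Qed.

(* Difference of the trapezoidal approximations of [zeta (1 + eta) - 1 / eta] and of [gamma]. *)
Definition zeta_gamma_gap (eta : R) (N : nat) : R :=
  (zeta_partial eta N + Rpower (INR N) (- eta) / eta - Rpower (INR N) (- (1 + eta)) / 2)
  - (harm N - ln (INR N) - / (2 * INR N)) - 1 / eta.

Lemma is_derive_Rpower (k x : R) : 0 < x ->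
  is_derive (fun y => Rpower y k) x (k * Rpower x (k - 1)).
Proof.
  intro Hx. unfold Rpower. auto_derive; [exact Hx |].
  replace ((k - 1) * ln x) with (k * ln x + - ln x) by ring. rewrite exp_plus, exp_Ropp, exp_ln by exact Hx. ring.
Qed.

(* On [5, +oo) the function [1 / x - x^(-1 - eta)] is convex. *)
Lemma zeta_gamma_gap_decr (eta : R) (N : nat) : 0 < eta -> (5 <= N)%nat ->
  zeta_gamma_gap eta (S N) <= zeta_gamma_gap eta N.
Proof.
  intros He HN. unfold zeta_gamma_gap. rewrite zeta_partial_S, harm_S, S_INR.
  assert (Hx : 5 <= INR N) by (replace 5 with (INR 5) by (simpl; ring); now apply le_INR).
  set (x := INR N) in *.
  pose proof (trapezoid_convex (fun y => ln y + Rpower y (- eta) / eta) (fun y => / y - Rpower y (- eta - 1))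
    (fun y => - / y ^ 2 + (1 + eta) * Rpower y (- eta - 1 - 1))
    (fun y => 2 / y ^ 3 - (1 + eta) * (2 + eta) * Rpower y (- eta - 1 - 1 - 1)) x (x + 1) ltac:(lra)) as H.
  cbv beta in H. replace (- (1 + eta)) with (- eta - 1) by ring. rewrite !Rinv_mult.
  enough (ln (x + 1) + Rpower (x + 1) (- eta) / eta - (ln x + Rpower x (- eta) / eta) <=
    (x + 1 - x) * ((/ x - Rpower x (- eta - 1) + (/ (x + 1) - Rpower (x + 1) (- eta - 1))) / 2)) by lra.
  apply H; intros y Hy.
  - replace (/ y - Rpower y (- eta - 1)) with (/ y + (- eta * Rpower y (- eta - 1)) / eta) by (field; lra).
    apply (is_derive_plus (V := R_NormedModule) ln (fun y => Rpower y (- eta) / eta)).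
    + apply is_derive_ln; lra.
    + apply (is_derive_ext (fun y => / eta * Rpower y (- eta))); [intro u; apply Rmult_comm |].
      replace (- eta * Rpower y (- eta - 1) / eta) with (/ eta * (- eta * Rpower y (- eta - 1))) by (unfold Rdiv; ring).
      apply is_derive_scal, is_derive_Rpower. lra.
  - replace (- / y ^ 2 + (1 + eta) * Rpower y (- eta - 1 - 1)) with (- / y ^ 2 - (- eta - 1) * Rpower y (- eta - 1 - 1)) by ring.
    apply (is_derive_minus (V := R_NormedModule) Rinv (fun y => Rpower y (- eta - 1))).
    + auto_derive; [lra | field; lra].
    + apply is_derive_Rpower. lra.
  - replace (2 / y ^ 3 - (1 + eta) * (2 + eta) * Rpower y (- eta - 1 - 1 - 1))
      with (2 / y ^ 3 + (1 + eta) * ((- eta - 1 - 1) * Rpower y (- eta - 1 - 1 - 1))) by ring.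
    apply (is_derive_plus (V := R_NormedModule) (fun y => - / y ^ 2) (fun y => (1 + eta) * Rpower y (- eta - 1 - 1))).
    + auto_derive; [nra | field; lra].
    + apply is_derive_scal, is_derive_Rpower. lra.
  - assert (E : Rpower y (- eta - 1 - 1 - 1) = Rpower y (- eta) / y ^ 3).
    { replace (- eta - 1 - 1 - 1) with (- eta + - (INR 3)) by (simpl; ring).
      rewrite Rpower_plus, (Rpower_Ropp _ (INR 3)), Rpower_pow by lra. reflexivity. }
    rewrite E. assert (Hy3 : 0 < y ^ 3) by (apply pow_lt; lra).
    replace (2 / y ^ 3 - (1 + eta) * (2 + eta) * (Rpower y (- eta) / y ^ 3))
      with ((2 - (1 + eta) * (2 + eta) * Rpower y (- eta)) / y ^ 3) by (field; lra).
    apply Rdiv_le_0_compat; [| exact Hy3].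
    rewrite Rpower_Ropp. destruct ln_bounds_235 as (_ & _ & H5 & _).
    assert (Hly : 16 / 10 <= ln y) by (pose proof (ln_le 5 y ltac:(lra) ltac:(lra)); lra).
    (* To first order in [eta] this asks for [ln y >= 3 / 2], and 5 is the first integer that
       satisfies it. The quadratic lower bound of [exp] covers the term in [eta^2]. *)
    assert (Hp : (1 + eta) * (2 + eta) <= 2 * Rpower y eta).
    { unfold Rpower. pose proof (exp_lower2 (eta * ln y) ltac:(nra)) as Hex.
      assert (eta * (16 / 10) <= eta * ln y) by (apply Rmult_le_compat_l; lra). nra. }
    assert (Hp0 : 0 < Rpower y eta) by apply exp_pos.
    apply (Rmult_le_compat_r (/ Rpower y eta)) in Hp; [| apply Rlt_le, Rinv_0_lt_compat, Hp0].
    rewrite (Rmult_assoc 2), Rinv_r in Hp by lra. lra.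
Qed.

(** Taylor expansion in [eta]: the constant terms cancel, the linear coefficient is at most 0.0758,
    the quadratic one is negative, and the last term of [5^(-eta) / eta] adds at most 0.07 [eta]
    since [eta <= 1/2]. The stated 0.1547 leaves room and stays below half the square of Euler's
    constant. *)
Lemma zeta_gamma_gap_5 (eta : R) : 0 < eta <= 1 / 2 ->
  zeta_gamma_gap eta 5 <= eta * (1547 / 10000).
Proof.
  intro He. destruct ln_bounds_235 as (Ha & Hb & Hc).
  assert (E : forall n, Rpower (INR (S n)) (- (1 + eta)) = exp (- (eta * ln (INR (S n)))) / INR (S n)).
  { intro n. pose proof (INR_S_pos n). replace (- (1 + eta)) with (- eta + - (1)) by ring.
    rewrite Rpower_plus, (Rpower_Ropp _ 1), Rpower_1 by assumption. unfold Rpower, Rdiv. do 2 f_equal. ring. }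
  unfold zeta_gamma_gap. rewrite !zeta_partial_S, !harm_S.
  unfold zeta_partial, harm. rewrite (sum_n_m_null _ 1 0) by lia. rewrite (sum_n_m_null (fun k => / INR k) 1 0) by lia.
  rewrite !E.
  replace (Rpower (INR 5) (- eta)) with (exp (- (eta * ln (INR 5)))) by (unfold Rpower; f_equal; ring).
  replace (INR 1) with 1 by (simpl; ring). replace (INR 2) with 2 by (simpl; ring).
  replace (INR 3) with 3 by (simpl; ring). replace (INR 4) with 4 by (simpl; ring).
  replace (INR 5) with 5 by (simpl; ring).
  rewrite ln_1, Rmult_0_r, Ropp_0, exp_0.
  replace (ln 4) with (2 * ln 2) by (replace 4 with (2 * 2) by ring; rewrite ln_mult by lra; ring).
  set (a := ln 2) in *. set (b := ln 3) in *. set (e := ln 5) in *.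
  pose proof (exp_neg_upper2 (eta * a) ltac:(nra)) as U2.
  pose proof (exp_neg_upper2 (eta * b) ltac:(nra)) as U3.
  pose proof (exp_neg_upper2 (eta * (2 * a)) ltac:(nra)) as U4.
  pose proof (exp_neg_upper2 (eta * e) ltac:(nra)) as U5.
  pose proof (exp_neg_upper4 (eta * e) ltac:(nra)) as V5.
  set (p2 := exp (- (eta * a))) in *. set (p3 := exp (- (eta * b))) in *.
  set (p4 := exp (- (eta * (2 * a)))) in *. set (p5 := exp (- (eta * e))) in *.
  assert (V : p5 / eta <= 1 / eta - e + eta * e ^ 2 / 2 - eta ^ 2 * e ^ 3 / 6 + eta ^ 3 * e ^ 4 / 24).
  { apply Rle_div_l; [lra |].
    replace ((1 / eta - e + eta * e ^ 2 / 2 - eta ^ 2 * e ^ 3 / 6 + eta ^ 3 * e ^ 4 / 24) * eta)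
      with (1 - eta * e + (eta * e) ^ 2 / 2 - (eta * e) ^ 3 / 6 + (eta * e) ^ 4 / 24) by (field; lra). exact V5. }
  assert (Q1 : e ^ 2 <= 25912 / 10000) by nra.
  assert (Q2 : 41655 / 10000 <= e ^ 3) by (clear - Hc; assert (2.5888 <= e ^ 2) by nra; nra).
  assert (Q3 : e ^ 4 <= 67145 / 10000) by (replace (e ^ 4) with (e ^ 2 * e ^ 2) by ring; nra).
  assert (Q4 : a ^ 2 <= 48067 / 100000) by nra.
  assert (Q5 : b ^ 2 <= 120759 / 100000) by nra.
  assert (T : eta ^ 3 * e ^ 4 / 24 <= eta * (1 / 4) * (67145 / 10000) / 24).
  { assert (H1 : eta ^ 3 <= eta * (1 / 4)) by (clear - He; nra).
    assert (H2 : 0 <= eta ^ 3) by (apply pow_le; lra).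
    assert (H4 : 0 <= e ^ 4) by (apply pow_le; lra). clear - H1 H2 H4 Q3 He.
    apply Rmult_le_compat_r; [lra |]. apply Rmult_le_compat; lra. }
  set (e2 := e ^ 2) in *. set (e3 := e ^ 3) in *. set (a2 := a ^ 2) in *. set (b2 := b ^ 2) in *.
  replace ((eta * a) ^ 2) with (eta ^ 2 * a2) in U2 by (unfold a2; ring).
  replace ((eta * b) ^ 2) with (eta ^ 2 * b2) in U3 by (unfold b2; ring).
  replace ((eta * (2 * a)) ^ 2) with (4 * (eta ^ 2 * a2)) in U4 by (unfold a2; ring).
  replace ((eta * e) ^ 2) with (eta ^ 2 * e2) in U5 by (unfold e2; ring).
  assert (Z1 : eta ^ 2 * (- (e3 / 6) + 3 / 4 * a2 + b2 / 6 + e2 / 20) <= 0).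
  { assert (0 <= eta ^ 2) by (apply pow_le; lra). nra. }
  assert (Z2 : eta * (e2 / 2 - a - b / 3 - e / 10) <= eta * (758 / 10000)) by (apply Rmult_le_compat_l; lra).
  lra.
Qed.

(** The gap estimate gives [1 / eta + gamma + 0.1547 eta]. As 0.1547 is less than [gamma^2 / 2],
    this is covered by the expansion of [exp (gamma * eta)] to second order. The bound 0.5567 for
    gamma, from two harmonic terms, is just sufficient. *)
Lemma zeta_partial_le_exp (eta : R) (N : nat) : 0 < eta <= 1 / 2 ->
  zeta_partial eta N <= exp (EulerMascheroni * eta) / eta.
Proof.
  intro He.
  assert (Hg : 5567 / 10000 <= EulerMascheroni).
  { pose proof (EulerMascheroni_lower 2 ltac:(lia)) as H. rewrite !harm_S in H.
    unfold harm in H. rewrite (sum_n_m_null _ 1 0) in H by lia. simpl in H.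
    replace (1 + 1) with 2 in H by ring. destruct ln_bounds_235 as (Ha & _). lra. }
  set (M := (N + 5)%nat).
  assert (HNM : zeta_partial eta N <= zeta_partial eta M).
  { apply sum_n_m_le_upper; [intro; apply Rlt_le, exp_pos | unfold M; lia]. }
  assert (Hgap : zeta_gamma_gap eta M <= zeta_gamma_gap eta 5).
  { unfold M. clear - He. induction N as [| N IH]; [apply Rle_refl |]. simpl.
    eapply Rle_trans; [| exact IH]. apply zeta_gamma_gap_decr; [lra | lia]. }
  pose proof (zeta_gamma_gap_5 eta He) as H5.
  pose proof (EulerMascheroni_lower M ltac:(unfold M; lia)) as HB.
  assert (Hx : 1 <= INR M) by (replace 1 with (INR 1) by reflexivity; apply le_INR; unfold M; lia).
  assert (Hpow : Rpower (INR M) (- (1 + eta)) / 2 <= Rpower (INR M) (- eta) / eta).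
  { replace (- (1 + eta)) with (- eta + - (1)) by ring.
    rewrite Rpower_plus, (Rpower_Ropp _ 1), Rpower_1 by lra.
    assert (Hp : 0 < Rpower (INR M) (- eta)) by apply exp_pos.
    assert (/ INR M <= 1) by (rewrite <- Rinv_1; apply Rinv_le_contravar; lra).
    assert (2 <= / eta) by (apply Rle_trans with (/ (1 / 2)); [lra | apply Rinv_le_contravar; lra]).
    unfold Rdiv. rewrite Rmult_assoc. apply Rmult_le_compat_l; [lra |].
    assert (0 < / INR M) by (apply Rinv_0_lt_compat; lra). lra. }
  assert (Hle : zeta_partial eta N <= 1 / eta + EulerMascheroni + eta * (1547 / 10000)).
  { unfold zeta_gamma_gap in Hgap at 1. lra. }
  eapply Rle_trans; [exact Hle |]. apply Rle_div_r; [lra |].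
  eapply Rle_trans; [| apply exp_lower2; nra].
  replace ((1 / eta + EulerMascheroni + eta * (1547 / 10000)) * eta)
    with (1 + EulerMascheroni * eta + eta ^ 2 * (1547 / 10000)) by (field; lra).
  assert (3099 / 10000 <= EulerMascheroni ^ 2) by nra.
  assert (0 <= eta ^ 2) by (apply pow_le; lra). rewrite Rpow_mult_distr. nra.
Qed.

(** * The logarithm to the right of 1 *)

Lemma Cis_lim_seq_eps (u : nat -> C) (l : C) : Cis_lim_seq u l ->
  forall eps, 0 < eps -> exists N, forall n, (N <= n)%nat -> Cmod (u n - l) < eps.
Proof.
  intros H eps Heps.
  pose proof (proj1 (filterlim_locally_ball_norm (K := C_AbsRing) (U := C_NormedModule) u l) H
    (mkposreal eps Heps)) as [N HN].
  exists N. intros n Hn. exact (HN n Hn).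
Qed.

Lemma Cis_lim_seq_bound (u : nat -> C) (l : C) (B : R) : Cis_lim_seq u l ->
  (forall n, Cmod (u n) <= B) -> Cmod l <= B.
Proof.
  intros H HB. apply Rle_plus_epsilon. intros eps Heps.
  destruct (Cis_lim_seq_eps u l H eps Heps) as [N HN]. specialize (HN N (Nat.le_refl N)).
  pose proof (Cmod_triangle (l - u N) (u N)) as T.
  replace (l - u N + u N)%C with l in T by ring.
  replace (l - u N)%C with (- (u N - l))%C in T by ring. rewrite Cmod_opp in T.
  specialize (HB N). lra.
Qed.

Lemma Cis_series_bound (u : nat -> C) (l : C) (v : nat -> R) (B : R) : Cis_series u l ->
  (forall n, Cmod (u n) <= v n) -> (forall n, sum_n v n <= B) -> Cmod l <= B.
Proof.
  intros H Hu HB. apply (Cis_lim_seq_bound (sum_n (G := C_AbelianMonoid) u)); [exact H |].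
  intro n. apply Rle_trans with (sum_n v n); [| apply HB].
  eapply Rle_trans; [apply (norm_sum_n_m (K := C_AbsRing) (V := C_NormedModule)) |].
  apply sum_n_m_le. exact Hu.
Qed.

Lemma Csum_bound (g : nat -> C) (m : nat) (B : R) :
  (forall j, (1 <= j <= m)%nat -> Cmod (g j) <= B) -> Cmod (Csum g m) <= INR m * B.
Proof.
  intro H. unfold Csum. induction m as [| m IH].
  - rewrite (@sum_n_m_zero C_AbelianMonoid) by lia. change (Cmod (RtoC 0) <= 0 * B). rewrite Cmod_0. lra.
  - rewrite sum_n_Sm by lia. rewrite S_INR.
    change (Cmod (sum_n_m (G := C_AbelianMonoid) g 1 m + g (S m))%C <= (INR m + 1) * B).
    eapply Rle_trans; [apply Cmod_triangle |].
    specialize (IH ltac:(intros; apply H; lia)). specialize (H (S m) ltac:(lia)). lra.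
Qed.

Lemma Cmod_Rcpow (x : R) (z : C) : Cmod (Rcpow x z) = Rpower x (Re z).
Proof.
  unfold Rcpow, Rpower. rewrite Cmod_Cexp. f_equal. destruct z; unfold Re, RtoC; simpl. ring.
Qed.

Lemma geom_sum (x : R) (K : nat) : sum_n (fun k => x ^ k) K * (1 - x) = 1 - x ^ S K.
Proof.
  induction K as [| K IH].
  - rewrite sum_O. simpl. ring.
  - rewrite sum_Sn. change (plus (sum_n (fun k => x ^ k) K) (x ^ S K)) with (sum_n (fun k => x ^ k) K + x ^ S K).
    rewrite Rmult_plus_distr_r, IH. simpl. ring.
Qed.

(** Differentiation in [x] reduces this to the geometric sum. *)
Lemma log_partial_le (x : R) (K : nat) : 0 <= x < 1 ->
  sum_n (fun k => x ^ S k / INR (S k)) K <= - ln (1 - x).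
Proof.
  intro Hx.
  pose proof (derive_nonpos_decr (fun y => sum_n (fun k => y ^ S k / INR (S k)) K + ln (1 - y))
    (fun y => sum_n (fun k => y ^ k) K + - / (1 - y)) 0 x ltac:(lra)) as H.
  assert (H0 : sum_n (fun k => x ^ S k / INR (S k)) K + ln (1 - x)
    <= sum_n (fun k => 0 ^ S k / INR (S k)) K + ln (1 - 0)); [apply H |].
  - intros y Hy. apply (is_derive_plus (V := R_NormedModule) (fun y => sum_n (fun k => y ^ S k / INR (S k)) K) (fun y => ln (1 - y))).
    + apply (is_derive_sum_n (V := R_NormedModule) (fun k y => y ^ S k / INR (S k))).
      intros k _. pose proof (INR_S_pos k). auto_derive; [exact I |]. simpl pred. field. change (INR (S k) <> 0). lra.
    + auto_derive; [lra |]. field. lra.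
  - intros y Hy. pose proof (geom_sum y K) as E.
    assert (0 <= y ^ S K) by (apply pow_le; lra).
    assert (sum_n (fun k => y ^ k) K <= / (1 - y)); [| lra].
    apply (Rmult_le_reg_r (1 - y)); [lra |]. rewrite E, Rinv_l by lra. lra.
  - rewrite Rminus_0_r, ln_1 in H0.
    assert (E0 : sum_n (fun k => 0 ^ S k / INR (S k)) K = 0).
    { apply (sum_n_m_null _ 0 K). intros i _. simpl. unfold Rdiv. ring. }
    lra.
Qed.

Lemma Rpower_INR_lt1 (p : nat) (s : R) : is_prime p -> 0 < s -> Rpower (INR p) (- s) < 1.
Proof.
  intros Hp Hs. apply is_prime_ge2 in Hp. unfold Rpower. rewrite <- exp_0. apply exp_increasing.
  assert (0 < ln (INR p)); [| nra]. rewrite <- ln_1. apply ln_increasing; [lra |].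
  replace 1 with (INR 1) by reflexivity. apply lt_INR. lia.
Qed.

(** Since [|alpha_j(p)| <= 1], the double series is majorised by [m] copies of the one for log zeta
    at [Re s], which the sieve bounds by [ln W] as soon as [W] bounds the partial sums of zeta. *)
Lemma log_series_bound (m : nat) (alpha : nat -> nat -> C) (s l : C) (W : R) :
  (forall p j, is_prime p -> (1 <= j <= m)%nat -> Cmod (alpha j p) <= 1) ->
  1 < Re s -> (forall X, zeta_partial (Re s - 1) X <= W) ->
  log_series m alpha s l -> Cmod l <= INR m * ln W.
Proof.
  intros Ha Hs HW (ser & Hser & Hl).
  set (w := fun n => Rpower (INR n) (- Re s)).
  apply (Cis_series_bound _ _ (fun p => INR m * (if prime_dec (Z.of_nat p) then - ln (1 - w p) else 0)) _ Hl).
  - intro p. unfold at_primes. destruct (prime_dec (Z.of_nat p)) as [Hp | Hp].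
    2: { rewrite Cmod_0. lra. }
    pose proof (is_prime_ge2 p Hp) as Hp2.
    assert (Hw : 0 <= w p < 1) by (split; [apply Rlt_le, exp_pos | apply Rpower_INR_lt1; [exact Hp | lra]]).
    apply (Cis_series_bound _ _ (fun k => INR m * (w p ^ S k / INR (S k))) _ (Hser p Hp)).
    + intro k. apply Csum_bound. intros j Hj.
      pose proof (INR_S_pos k) as Hk.
      assert (Hne : Rcpow (INR p) (INR (S k) * s) <> 0) by apply Cexp_nz.
      assert (Hne2 : RtoC (INR (S k)) <> 0) by (intro E; apply RtoC_inj in E; lra).
      rewrite Cmod_div by (apply Cmult_neq_0; assumption).
      rewrite Cmod_mult, Cmod_R, Rabs_pos_eq, Cmod_Rcpow, Cmod_pow by lra.
      assert (Hx : Cmod (alpha j p) ^ S k <= 1).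
      { rewrite <- (pow1 (S k)). apply pow_incr. split; [apply Cmod_ge_0 | now apply Ha]. }
      assert (E : w p ^ S k = / Rpower (INR p) (Re (INR (S k) * s)%C)).
      { unfold w. rewrite <- Rpower_pow by apply exp_pos. rewrite Rpower_mult.
        rewrite <- Rpower_Ropp. f_equal. rewrite re_scal_l. ring. }
      rewrite E. unfold Rdiv. rewrite Rinv_mult, <- Rmult_assoc.
      assert (0 < / Rpower (INR p) (Re (INR (S k) * s)%C)) by (apply Rinv_0_lt_compat, exp_pos).
      assert (0 < / INR (S k)) by now apply Rinv_0_lt_compat.
      rewrite (Rmult_comm (/ Rpower _ _)). apply Rmult_le_compat_r; [lra |]. nra.
    + intro n. rewrite (sum_n_mult_l (INR m) (fun k => w p ^ S k / INR (S k))).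
      apply Rmult_le_compat_l; [apply pos_INR |]. now apply log_partial_le.
  - intro n. rewrite (sum_n_mult_l (INR m) (fun p => if prime_dec (Z.of_nat p) then - ln (1 - w p) else 0)).
    apply Rmult_le_compat_l; [apply pos_INR |].
    apply (prime_log_sum_le w W).
    + intros i j Hi Hj. unfold w. rewrite mult_INR. symmetry. apply Rpower_mult_distr; apply lt_0_INR; lia.
    + intro i. apply Rlt_le, exp_pos.
    + unfold w. simpl INR. unfold Rpower. rewrite ln_1, Rmult_0_r. apply exp_0.
    + intros p Hp. apply Rpower_INR_lt1; [exact Hp | lra].
    + intro X. specialize (HW X). unfold zeta_partial in HW. replace (1 + (Re s - 1)) with (Re s) in HW by ring. exact HW.
Qed.

(** * The bound |alpha_j(p)| <= 1 *)

Fixpoint Csum_lt (g : nat -> C) (n : nat) : C :=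
  match n with O => 0 | S n' => (Csum_lt g n' + g n')%C end.

Lemma Csum_lt_ext (g h : nat -> C) (n : nat) : (forall j, g j = h j) -> Csum_lt g n = Csum_lt h n.
Proof. intro H. induction n as [| n IH]; simpl; [reflexivity | now rewrite IH, H]. Qed.

Lemma Csum_lt_plus (g h : nat -> C) (n : nat) :
  Csum_lt (fun j => g j + h j)%C n = (Csum_lt g n + Csum_lt h n)%C.
Proof. induction n as [| n IH]; simpl; [ring | rewrite IH; ring]. Qed.

Lemma Csum_lt_scal (k : C) (g : nat -> C) (n : nat) :
  Csum_lt (fun j => k * g j)%C n = (k * Csum_lt g n)%C.
Proof. induction n as [| n IH]; simpl; [ring | rewrite IH; ring]. Qed.

Lemma Csum_lt_bound (g : nat -> C) (n : nat) (B : R) :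
  (forall j, Cmod (g j) <= B) -> Cmod (Csum_lt g n) <= INR n * B.
Proof.
  intro H. induction n as [| n IH].
  - simpl. rewrite Cmod_0. lra.
  - rewrite S_INR. simpl Csum_lt. eapply Rle_trans; [apply Cmod_triangle |]. specialize (H n). lra.
Qed.

Lemma Csum_lt_geom (w : C) (n : nat) : (Csum_lt (fun j => w ^ j) n * (1 - w))%C = (1 - w ^ n)%C.
Proof.
  induction n as [| n IH]; [simpl; ring |].
  simpl Csum_lt. rewrite Cmult_plus_distr_r, IH, Cpow_S. ring.
Qed.

(* [v] is the mean value, over the line [Re s = 4], of [f(s) e^(x s)].  The
   means are taken along arithmetic progressions of step [h], and [h -> 0] is
   only used to avoid resonances. *)
Definition mean_value_at (f : C -> C) (x : R) (v : C) : Prop :=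
  forall eps, 0 < eps -> exists h0, 0 < h0 /\ forall h, 0 < h < h0 ->
    exists N0, forall N, (N0 <= N)%nat ->
      Cmod (Csum_lt (fun j => f (4, INR j * h)%R * Cexp (x * (4, INR j * h)%R)) (S N)
            / INR (S N) - v)%C <= eps.

Lemma RtoC_INR_S_nz (n : nat) : RtoC (INR (S n)) <> 0.
Proof. intro E. apply RtoC_inj in E. pose proof (INR_S_pos n). lra. Qed.

Lemma mean_ext (f g : C -> C) (x x' : R) (v : C) :
  (forall y, (f (4, y) * Cexp (x * (4, y)))%C = (g (4, y) * Cexp (x' * (4, y)))%C) ->
  mean_value_at f x v -> mean_value_at g x' v.
Proof.
  intros He H eps Heps. destruct (H eps Heps) as (h0 & Hh0 & H1).
  exists h0. split; [exact Hh0 |]. intros h Hh. destruct (H1 h Hh) as [N0 H2].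
  exists N0. intros N HN. specialize (H2 N HN).
  rewrite (Csum_lt_ext _ (fun j => f (4, INR j * h)%R * Cexp (x * (4, INR j * h)%R))%C); [exact H2 |].
  intro j. symmetry. apply He.
Qed.

Lemma mean_plus (f g : C -> C) (x : R) (v w : C) :
  mean_value_at f x v -> mean_value_at g x w -> mean_value_at (fun s => f s + g s)%C x (v + w)%C.
Proof.
  intros Hf Hg eps Heps.
  destruct (Hf (eps / 2)) as (h1 & Hh1 & H1); [lra |].
  destruct (Hg (eps / 2)) as (h2 & Hh2 & H2); [lra |].
  exists (Rmin h1 h2). split; [now apply Rmin_pos |]. intros h Hh.
  pose proof (Rmin_l h1 h2). pose proof (Rmin_r h1 h2).
  destruct (H1 h ltac:(lra)) as [N1 K1]. destruct (H2 h ltac:(lra)) as [N2 K2].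
  exists (Nat.max N1 N2). intros N HN. specialize (K1 N ltac:(lia)). specialize (K2 N ltac:(lia)).
  rewrite (Csum_lt_ext _ (fun j => f (4, INR j * h)%R * Cexp (x * (4, INR j * h)%R)
     + g (4, INR j * h)%R * Cexp (x * (4, INR j * h)%R))%C) by (intro; ring).
  rewrite Csum_lt_plus.
  match goal with |- Cmod ((?A + ?B) / ?n - _)%C <= _ =>
    replace ((A + B) / n - (v + w))%C with ((A / n - v) + (B / n - w))%C by (unfold Cdiv; ring) end.
  eapply Rle_trans; [apply Cmod_triangle |]. lra.
Qed.

Lemma mean_scal (k : C) (f : C -> C) (x : R) (v : C) :
  mean_value_at f x v -> mean_value_at (fun s => k * f s)%C x (k * v)%C.
Proof.
  intros Hf eps Heps. pose proof (Cmod_ge_0 k) as Hk.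
  destruct (Hf (eps / (Cmod k + 1))) as (h1 & Hh1 & H1); [apply Rdiv_lt_0_compat; lra |].
  exists h1. split; [exact Hh1 |]. intros h Hh. destruct (H1 h Hh) as [N0 H2].
  exists N0. intros N HN. specialize (H2 N HN).
  rewrite (Csum_lt_ext _ (fun j => k * (f (4, INR j * h)%R * Cexp (x * (4, INR j * h)%R)))%C) by (intro; ring).
  rewrite Csum_lt_scal.
  match goal with |- Cmod (k * ?A / ?n - _)%C <= _ =>
    replace (k * A / n - k * v)%C with (k * (A / n - v))%C by (unfold Cdiv; ring) end.
  rewrite Cmod_mult.
  apply Rle_trans with ((Cmod k + 1) * (eps / (Cmod k + 1))).
  - apply Rmult_le_compat; try lra. apply Cmod_ge_0.
  - right. field. lra.
Qed.

(** On the line the weight [e^(x s)] has constant modulus [e^(4 x)], so a uniform error in [f]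
    changes every average by a controlled amount. All approximants share the value [v], which spares
    a limit of values. *)
Lemma mean_unif (f : C -> C) (x : R) (v : C) :
  (forall eps, 0 < eps -> exists g, mean_value_at g x v /\
     forall y, Cmod (f (4, y) - g (4, y)) <= eps) -> mean_value_at f x v.
Proof.
  intros H eps Heps. set (E := exp (x * 4)). assert (HE : 0 < E) by apply exp_pos.
  destruct (H (eps / (2 * E))) as (g & Hg & Hfg); [apply Rdiv_lt_0_compat; lra |].
  destruct (Hg (eps / 2)) as (h1 & Hh1 & H1); [lra |].
  exists h1. split; [exact Hh1 |]. intros h Hh. destruct (H1 h Hh) as [N0 H2].
  exists N0. intros N HN. specialize (H2 N HN).
  rewrite (Csum_lt_ext _ (fun j => g (4, INR j * h)%R * Cexp (x * (4, INR j * h)%R)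
    + (f (4, INR j * h)%R - g (4, INR j * h)%R) * Cexp (x * (4, INR j * h)%R))%C) by (intro; ring).
  rewrite Csum_lt_plus.
  match goal with |- Cmod ((?A + ?B) / ?n - _)%C <= _ =>
    replace ((A + B) / n - v)%C with ((A / n - v) + B / n)%C by (unfold Cdiv; ring);
    assert (HB : Cmod (B / n)%C <= eps / 2) end.
  - rewrite Cmod_div by apply RtoC_INR_S_nz. pose proof (INR_S_pos N) as HN0.
    rewrite Cmod_R, Rabs_pos_eq by lra. apply Rle_div_l; [exact HN0 |].
    rewrite Rmult_comm. apply Csum_lt_bound. intro j. rewrite Cmod_mult, Cmod_Cexp.
    replace (Re (x * (4, INR j * h)%R)%C) with (x * 4) by (simpl; ring). fold E.
    apply Rle_trans with (eps / (2 * E) * E); [apply Rmult_le_compat_r; [lra | apply Hfg] |].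
    right. field. lra.
  - eapply Rle_trans; [apply Cmod_triangle |]. lra.
Qed.

Lemma mean_unique (f : C -> C) (x : R) (v w : C) :
  mean_value_at f x v -> mean_value_at f x w -> v = w.
Proof.
  intros Hv Hw. destruct (Ceq_dec v w) as [| Hne]; [assumption | exfalso].
  assert (Hp : 0 < Cmod (v - w)) by (apply Cmod_gt_0, Cminus_eq_contra, Hne).
  destruct (Hv (Cmod (v - w) / 3)) as (h1 & Hh1 & H1); [lra |].
  destruct (Hw (Cmod (v - w) / 3)) as (h2 & Hh2 & H2); [lra |].
  pose proof (Rmin_l h1 h2). pose proof (Rmin_r h1 h2). pose proof (Rmin_pos h1 h2 Hh1 Hh2).
  destruct (H1 (Rmin h1 h2 / 2) ltac:(lra)) as [N1 K1]. destruct (H2 (Rmin h1 h2 / 2) ltac:(lra)) as [N2 K2].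
  specialize (K1 (Nat.max N1 N2) ltac:(lia)). specialize (K2 (Nat.max N1 N2) ltac:(lia)).
  match type of K1 with Cmod (?A - v)%C <= _ => set (z := A) in * end.
  pose proof (Cmod_triangle (- (z - v)) (z - w)) as T. rewrite Cmod_opp in T.
  replace (- (z - v) + (z - w))%C with (v - w)%C in T by ring. lra.
Qed.

Lemma Cexp_INR (z : C) (n : nat) : Cexp (INR n * z)%C = (Cexp z ^ n)%C.
Proof.
  induction n as [| n IH].
  - simpl INR. replace (0 * z)%C with (RtoC 0) by ring. apply Cexp_0.
  - rewrite S_INR, RtoC_plus, Cpow_S, <- IH, <- Cexp_plus. f_equal. ring.
Qed.

Lemma mean_exp_resonant (k : C) (x : R) : mean_value_at (fun s => k * Cexp (- x * s))%C x k.
Proof.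
  intros eps Heps. exists 1. split; [lra |]. intros h Hh. exists O. intros N _.
  rewrite (Csum_lt_ext _ (fun j => k * 1 ^ j)%C).
  2: { intro j. rewrite Cpow_1_l, <- Cmult_assoc, <- Cexp_plus.
       replace (- x * (4, INR j * h)%R + x * (4, INR j * h)%R)%C with (RtoC 0) by ring.
       rewrite Cexp_0. ring. }
  rewrite Csum_lt_scal.
  assert (E : forall n, Csum_lt (fun j => 1 ^ j)%C n = RtoC (INR n)).
  { induction n as [| n IH]; [reflexivity |]. simpl Csum_lt. rewrite IH, Cpow_1_l, S_INR, RtoC_plus. reflexivity. }
  rewrite E. replace (k * INR (S N) / INR (S N) - k)%C with (RtoC 0).
  - rewrite Cmod_0. lra.
  - field. apply RtoC_INR_S_nz.
Qed.

Lemma Cexp_i_ne_1 (th : R) : 0 < Rabs th < 1 -> Cexp (0, th) <> 1.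
Proof.
  intros H E. apply (f_equal Im) in E. unfold Cexp in E. simpl in E. rewrite exp_0 in E.
  assert (Hs : sin th = 0) by lra. pose proof PI2_1.
  destruct (Rle_dec 0 th) as [Hp | Hn].
  - rewrite Rabs_pos_eq in H by assumption. pose proof (sin_gt_0 th ltac:(lra) ltac:(lra)). lra.
  - rewrite Rabs_left in H by lra. pose proof (sin_gt_0 (- th) ltac:(lra) ltac:(lra)).
    rewrite sin_neg in H1. lra.
Qed.

(** The average is a geometric sum of ratio [w = e^(i d h)] divided by its length. For [h < 1 / |d|]
    the ratio differs from 1, so the sums stay bounded and the average tends to 0. *)
Lemma mean_exp_nonresonant (k : C) (lam x : R) : lam <> x ->
  mean_value_at (fun s => k * Cexp (- lam * s))%C x 0.
Proof.
  intros Hne eps Heps. set (d := x - lam). assert (Hd : 0 < Rabs d) by (apply Rabs_pos_lt; unfold d; lra).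
  exists (/ Rabs d). split; [now apply Rinv_0_lt_compat |]. intros h Hh.
  set (w := Cexp (0, d * h)).
  assert (Hw : w <> 1).
  { apply Cexp_i_ne_1. rewrite Rabs_mult, (Rabs_pos_eq h) by lra. split; [nra |].
    destruct Hh as [_ Hh]. apply (Rmult_lt_compat_l (Rabs d)) in Hh; [| exact Hd].
    rewrite Rinv_r in Hh by lra. exact Hh. }
  assert (Hw1 : 0 < Cmod (1 - w)) by (apply Cmod_gt_0, Cminus_eq_contra; auto).
  set (k' := (k * Cexp (d * 4))%C).
  set (B := Cmod k' * (2 / Cmod (1 - w))).
  assert (HB : 0 <= B) by (apply Rmult_le_pos; [apply Cmod_ge_0 | apply Rdiv_le_0_compat; lra]).
  destruct (INR_unbounded (B / eps)) as [N0 HN0]. exists N0. intros N HN.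
  rewrite (Csum_lt_ext _ (fun j => k' * w ^ j)%C).
  2: { intro j. unfold k', w. rewrite <- Cexp_INR, <- !Cmult_assoc, <- !Cexp_plus. do 2 f_equal.
       unfold d, Cplus, Cmult, Copp, RtoC; simpl. f_equal; ring. }
  rewrite Csum_lt_scal.
  assert (E : Csum_lt (fun j => w ^ j)%C (S N) = ((1 - w ^ S N) / (1 - w))%C).
  { rewrite <- Csum_lt_geom. field. intro E. apply Hw. symmetry. now apply Ceq_minus. }
  assert (Hmw : Cmod w = 1) by (unfold w; rewrite Cmod_Cexp; simpl; apply exp_0).
  pose proof (INR_S_pos N) as HSN.
  assert (E0 : forall z : C, (z - 0)%C = z) by (intro; ring). rewrite E0.
  rewrite Cmod_div by apply RtoC_INR_S_nz. rewrite Cmod_R, (Rabs_pos_eq (INR (S N))) by lra.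
  apply Rle_div_l; [exact HSN |]. rewrite Cmod_mult.
  apply Rle_trans with B.
  - apply Rmult_le_compat_l; [apply Cmod_ge_0 |]. change (Csum_lt (Cpow w) (S N)) with (Csum_lt (fun j => w ^ j)%C (S N)). rewrite E, Cmod_div by (apply Cmod_gt_0, Hw1).
    apply Rmult_le_compat_r; [apply Rlt_le, Rinv_0_lt_compat, Hw1 |].
    unfold Cminus. eapply Rle_trans; [apply Cmod_triangle |].
    rewrite Cmod_opp, Cmod_pow, Hmw, pow1, Cmod_1. lra.
  - assert (INR N0 <= INR (S N)) by (apply le_INR; lia).
    apply Rlt_le in HN0. apply Rle_div_l in HN0; [| exact Heps]. nra.
Qed.

Lemma Rcpow_neg_line (x : R) (s : C) : Rcpow x (- s) = Cexp (- ln x * s).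
Proof. unfold Rcpow. f_equal. ring. Qed.

Lemma mean_dirichlet_term (k : C) (n : nat) (x : R) :
  mean_value_at (fun s => k * Rcpow (INR n) (- s))%C x
    (if Req_dec_T x (ln (INR n)) then k else 0).
Proof.
  destruct Req_dec_T as [-> | Hne].
  - apply (mean_ext (fun s => k * Cexp (- ln (INR n) * s))%C _ (ln (INR n))).
    + intro y. now rewrite Rcpow_neg_line.
    + apply mean_exp_resonant.
  - apply (mean_ext (fun s => k * Cexp (- ln (INR n) * s))%C _ x).
    + intro y. now rewrite Rcpow_neg_line.
    + apply mean_exp_nonresonant. auto.
Qed.

Lemma mean_const (k : C) (x : R) : mean_value_at (fun _ => k) x (if Req_dec_T x 0 then k else 0).
Proof.
  pose proof (mean_dirichlet_term k 1 x) as H. simpl INR in H. rewrite ln_1 in H.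
  eapply mean_ext; [| exact H]. intro y. cbv beta. rewrite Rcpow_neg_line, ln_1.
  replace (- 0 * (4, y))%C with (RtoC 0) by ring. rewrite Cexp_0. ring.
Qed.

(** The frequencies [n] avoid 1 and all multiples of [q], hence all powers of [q]. The condition on
    divisibility, unlike the mere absence of powers of [q], is stable under products because [q] is
    prime. The last constructor avoids functional extensionality. *)
Inductive dirichlet_poly (q : nat) : (C -> C) -> Prop :=
| dp_zero : dirichlet_poly q (fun _ => 0)
| dp_term n k : (2 <= n)%nat -> ~ Nat.divide q n ->
    dirichlet_poly q (fun s => k * Rcpow (INR n) (- s))%C
| dp_plus f g : dirichlet_poly q f -> dirichlet_poly q g -> dirichlet_poly q (fun s => f s + g s)%C
| dp_ext f g : (forall s, f s = g s) -> dirichlet_poly q f -> dirichlet_poly q g.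

Lemma Rcpow_mult_base (x y : R) (s : C) : 0 < x -> 0 < y ->
  Rcpow (x * y) s = (Rcpow x s * Rcpow y s)%C.
Proof.
  intros Hx Hy. unfold Rcpow. rewrite ln_mult, RtoC_plus, <- Cexp_plus by assumption. f_equal. ring.
Qed.

Lemma dp_mult (q : nat) (f g : C -> C) : is_prime q ->
  dirichlet_poly q f -> dirichlet_poly q g -> dirichlet_poly q (fun s => f s * g s)%C.
Proof.
  intros Hq Hf Hg. induction Hf as [| n k Hn Hd | f1 f2 _ I1 _ I2 | f1 f2 E _ I].
  - apply (dp_ext q (fun _ => 0)); [intro; ring | constructor].
  - induction Hg as [| n' k' Hn' Hd' | g1 g2 _ I1 _ I2 | g1 g2 E _ I].
    + apply (dp_ext q (fun _ => 0)); [intro; ring | constructor].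
    + apply (dp_ext q (fun s => (k * k') * Rcpow (INR (n * n')) (- s))%C).
      * intro s. rewrite mult_INR, Rcpow_mult_base by (apply lt_0_INR; lia). ring.
      * constructor; [nia |]. intro D. apply is_prime_divide in D; [| exact Hq]. tauto.
    + apply (dp_ext q (fun s => k * Rcpow (INR n) (- s) * g1 s + k * Rcpow (INR n) (- s) * g2 s)%C);
        [intro; ring | now constructor].
    + eapply dp_ext; [| exact I]. intro s. cbv beta. now rewrite E.
  - apply (dp_ext q (fun s => f1 s * g s + f2 s * g s)%C); [intro; ring | now constructor].
  - eapply dp_ext; [| exact I]. intro s. cbv beta. now rewrite E.
Qed.

Lemma dp_bounded (q : nat) (f : C -> C) : dirichlet_poly q f ->
  exists B, forall y, Cmod (f (4, y)) <= B.
Proof.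
  intros Hf. induction Hf as [| n k Hn Hd | f1 f2 _ [B1 H1] _ [B2 H2] | f1 f2 E _ [B HB]].
  - exists 0. intro. rewrite Cmod_0. lra.
  - exists (Cmod k * Rpower (INR n) (- 4)). intro y. rewrite Cmod_mult, Cmod_Rcpow. apply Rle_refl.
  - exists (B1 + B2). intro y. eapply Rle_trans; [apply Cmod_triangle |]. specialize (H1 y); specialize (H2 y); lra.
  - exists B. intro y. now rewrite <- E.
Qed.

Lemma ln_INR_inj (n k : nat) : (1 <= n)%nat -> (1 <= k)%nat -> ln (INR n) = ln (INR k) -> n = k.
Proof. intros Hn Hk E. apply INR_eq. apply ln_inv; [apply lt_0_INR; lia | apply lt_0_INR; lia | exact E]. Qed.

Lemma ln_prime_pos (q : nat) : is_prime q -> 0 < ln (INR q).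
Proof.
  intro Hq. apply is_prime_ge2 in Hq. rewrite <- ln_1. apply ln_increasing; [lra |].
  replace 1 with (INR 1) by reflexivity. apply lt_INR. lia.
Qed.

Lemma INR_pow (q k : nat) : INR (q ^ k) = INR q ^ k.
Proof. induction k as [| k IH]; [reflexivity |]. rewrite Nat.pow_succ_r', mult_INR, IH. reflexivity. Qed.

Lemma ln_INR_pow (q k : nat) : (1 <= q)%nat -> ln (INR (q ^ k)) = INR k * ln (INR q).
Proof. intro Hq. rewrite INR_pow, ln_pow; [reflexivity | apply lt_0_INR; lia]. Qed.

Lemma ln_nat_prime_power (q n : nat) (z : Z) : is_prime q -> (1 <= n)%nat ->
  IZR z * ln (INR q) = ln (INR n) -> (0 <= z)%Z /\ n = (q ^ Z.to_nat z)%nat.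
Proof.
  intros Hq Hn E. pose proof (ln_prime_pos q Hq) as Hl.
  assert (Hz : (0 <= z)%Z).
  { apply le_IZR. assert (0 <= ln (INR n)).
    { rewrite <- ln_1. apply ln_le; [lra |]. replace 1 with (INR 1) by reflexivity. now apply le_INR. }
    simpl. nra. }
  split; [exact Hz |]. pose proof (is_prime_ge2 q Hq).
  apply ln_INR_inj; [exact Hn | |].
  - assert (q ^ Z.to_nat z <> 0)%nat by (apply Nat.pow_nonzero; lia). lia.
  - rewrite ln_INR_pow by lia. rewrite <- E. f_equal. now rewrite INR_IZR_INZ, Z2Nat.id.
Qed.

(** A resonance [z ln q = ln n] would make [n] a power of [q]: the power 1 is excluded by [2 <= n],
    the others by [q] not dividing [n]. *)
Lemma dp_mean (q : nat) (f : C -> C) (z : Z) : is_prime q -> dirichlet_poly q f ->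
  mean_value_at f (IZR z * ln (INR q)) 0.
Proof.
  intros Hq Hf. induction Hf as [| n k Hn Hd | f1 f2 _ I1 _ I2 | f1 f2 E _ I].
  - pose proof (mean_const 0 (IZR z * ln (INR q))) as H. destruct Req_dec_T in H; exact H.
  - pose proof (mean_dirichlet_term k n (IZR z * ln (INR q))) as H.
    destruct Req_dec_T as [E | _]; [| exact H]. exfalso.
    apply ln_nat_prime_power in E; [| exact Hq | lia]. destruct E as [Hz ->].
    destruct (Z.to_nat z) as [| j]; [simpl in Hn; lia |].
    apply Hd. exists (q ^ j)%nat. rewrite Nat.pow_succ_r'. lia.
  - replace (RtoC 0) with (0 + 0)%C by ring. now apply mean_plus.
  - eapply mean_ext; [| exact I]. intro y. now rewrite E.
Qed.

(** Models a Euler product from which the factor at [q] has been removed: its only mean value at the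
    frequencies [z ln q] is the constant term 1. *)
Definition almost_poly1 (q : nat) (f : C -> C) : Prop :=
  forall eps, 0 < eps -> exists g, dirichlet_poly q g /\
    forall y, Cmod (f (4, y) - 1 - g (4, y))%C <= eps.

Lemma ap1_mean (q : nat) (f : C -> C) (z : Z) : is_prime q -> almost_poly1 q f ->
  mean_value_at f (IZR z * ln (INR q)) (if Z.eq_dec z 0 then 1 else 0).
Proof.
  intros Hq Hf. apply mean_unif. intros eps Heps. destruct (Hf eps Heps) as (g & Hg & H).
  exists (fun s => 1 + g s)%C. split.
  - replace (if Z.eq_dec z 0 then RtoC 1 else RtoC 0) with ((if Z.eq_dec z 0 then RtoC 1 else RtoC 0) + 0)%C by ring.
    apply (mean_plus (fun _ => 1)); [| now apply dp_mean].
    pose proof (mean_const 1 (IZR z * ln (INR q))) as H1. pose proof (ln_prime_pos q Hq).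
    destruct (Z.eq_dec z 0) as [-> | Hz]; destruct Req_dec_T as [E | E]; try exact H1; exfalso.
    + apply E. ring.
    + apply Rmult_integral in E. destruct E as [E | E]; [apply Hz; now apply eq_IZR | lra].
  - intro y. replace (f (4, y) - (1 + g (4, y)))%C with (f (4, y) - 1 - g (4, y))%C by ring. apply H.
Qed.

Lemma ap1_bounded (q : nat) (f : C -> C) : almost_poly1 q f -> exists B, 0 < B /\ forall y, Cmod (f (4, y)) <= B.
Proof.
  intro Hf. destruct (Hf 1 Rlt_0_1) as (g & Hg & H). destruct (dp_bounded q g Hg) as [B HB].
  assert (HB0 : 0 <= B) by (eapply Rle_trans; [apply Cmod_ge_0 | apply (HB 0)]).
  exists (B + 2). split; [lra |]. intro y.
  replace (f (4, y)) with ((f (4, y) - 1 - g (4, y)) + (1 + g (4, y)))%C by ring.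
  eapply Rle_trans; [apply Cmod_triangle |]. specialize (H y). specialize (HB y).
  pose proof (Cmod_triangle 1 (g (4, y))) as T. rewrite Cmod_1 in T. lra.
Qed.

Lemma ap1_mult (q : nat) (f1 f2 : C -> C) : is_prime q ->
  almost_poly1 q f1 -> almost_poly1 q f2 -> almost_poly1 q (fun s => f1 s * f2 s)%C.
Proof.
  intros Hq H1 H2 eps Heps.
  destruct (ap1_bounded q f1 H1) as (B1 & HB1 & K1). destruct (ap1_bounded q f2 H2) as (B2 & HB2 & K2).
  (* The bound 1 guarantees [|1 + g2| <= B2 + 1], which then fixes the accuracy required of [g1]. *)
  destruct (H2 (Rmin 1 (eps / (2 * B1)))) as (g2 & Hg2 & E2).
  { apply Rmin_pos; [lra |]. apply Rdiv_lt_0_compat; lra. }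
  destruct (H1 (eps / (2 * (B2 + 1)))) as (g1 & Hg1 & E1).
  { apply Rdiv_lt_0_compat; lra. }
  exists (fun s => g1 s + g2 s + g1 s * g2 s)%C. split.
  - constructor; [now constructor | now apply dp_mult].
  - intro y. specialize (E1 y). specialize (E2 y). specialize (K1 y). specialize (K2 y).
    set (u := f1 (4, y)) in *. set (v := f2 (4, y)) in *.
    set (a := g1 (4, y)) in *. set (b := g2 (4, y)) in *.
    replace (u * v - 1 - (a + b + a * b))%C with (u * (v - 1 - b) + (u - 1 - a) * (1 + b))%C by ring.
    eapply Rle_trans; [apply Cmod_triangle |]. rewrite !Cmod_mult.
    pose proof (Rmin_l 1 (eps / (2 * B1))). pose proof (Rmin_r 1 (eps / (2 * B1))).
    assert (Hb : Cmod (1 + b) <= B2 + 1).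
    { replace (1 + b)%C with (v + - (v - 1 - b))%C by ring.
      eapply Rle_trans; [apply Cmod_triangle |]. rewrite Cmod_opp. lra. }
    assert (Cmod u * Cmod (v - 1 - b) <= B1 * (eps / (2 * B1))).
    { apply Rmult_le_compat; try apply Cmod_ge_0; lra. }
    assert (Cmod (u - 1 - a) * Cmod (1 + b) <= eps / (2 * (B2 + 1)) * (B2 + 1)).
    { apply Rmult_le_compat; try apply Cmod_ge_0; lra. }
    replace (B1 * (eps / (2 * B1))) with (eps / 2) in * by (field; lra).
    replace (eps / (2 * (B2 + 1)) * (B2 + 1)) with (eps / 2) in * by (field; lra). lra.
Qed.

Lemma ap1_one (q : nat) : almost_poly1 q (fun _ => 1).
Proof.
  intros eps Heps. exists (fun _ => 0). split; [constructor |]. intro y.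
  replace (1 - 1 - 0)%C with (RtoC 0) by ring. rewrite Cmod_0. lra.
Qed.

Lemma ap1_lim (q : nat) (f : C -> C) :
  (forall eps, 0 < eps -> exists g, almost_poly1 q g /\ forall y, Cmod (f (4, y) - g (4, y)) <= eps) ->
  almost_poly1 q f.
Proof.
  intros H eps Heps. destruct (H (eps / 2)) as (g & Hg & E); [lra |].
  destruct (Hg (eps / 2)) as (p & Hp & E2); [lra |]. exists p. split; [exact Hp |].
  intro y. replace (f (4, y) - 1 - p (4, y))%C with ((f (4, y) - g (4, y)) + (g (4, y) - 1 - p (4, y)))%C by ring.
  eapply Rle_trans; [apply Cmod_triangle |]. specialize (E y); specialize (E2 y); lra.
Qed.

Lemma ap1_prod (q m : nat) (F : nat -> C -> C) : is_prime q ->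
  (forall j, (1 <= j <= m)%nat -> almost_poly1 q (F j)) ->
  almost_poly1 q (fun s => Cprod (fun j => F j s) m).
Proof.
  intros Hq. induction m as [| m IH]; intro H.
  - apply ap1_one.
  - simpl. apply (ap1_mult q (fun s => Cprod (fun j => F j s) m)); [exact Hq | |].
    + apply IH. intros; apply H; lia.
    + apply H. lia.
Qed.

Lemma prime_not_divide_pow (p q k : nat) : is_prime p -> is_prime q -> p <> q -> ~ Nat.divide q (p ^ k).
Proof.
  intros Hp Hq Hne. induction k as [| k IH]; intro D.
  - apply Nat.divide_1_r in D. apply is_prime_ge2 in Hq. lia.
  - rewrite Nat.pow_succ_r' in D. apply is_prime_divide in D; [| exact Hq].
    destruct D as [D | D]; [| now apply IH]. apply is_prime_divide_prime in D; [congruence | exact Hq | exact Hp].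
Qed.

(** The crude bound [|al| <= p] costs one power of [p]; on the line Re s = 4 a summable [p^(-3)]
    remains. *)
Lemma local_term_small (al : C) (p : nat) (y : R) : is_prime p -> Cmod al <= INR p ->
  Cmod (al * Rcpow (INR p) (- (4, y)))%C <= / INR p ^ 3 /\ / INR p ^ 3 <= 1 / 8.
Proof.
  intros Hp Hal. apply is_prime_ge2 in Hp.
  assert (Hp2 : 2 <= INR p) by (replace 2 with (INR 2) by (simpl; ring); now apply le_INR).
  split.
  - rewrite Cmod_mult, Cmod_Rcpow. simpl Re.
    replace (Rpower (INR p) (- (4))) with (/ INR p ^ 4).
    + assert (0 < / INR p ^ 4) by (apply Rinv_0_lt_compat, pow_lt; lra).
      apply Rle_trans with (INR p * / INR p ^ 4); [apply Rmult_le_compat_r; lra |].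
      right. field. lra.
    + rewrite Rpower_Ropp. f_equal. replace 4 with (INR 4) by (simpl; ring). symmetry. apply Rpower_pow. lra.
  - replace (1 / 8) with (/ 8) by field. apply Rinv_le_contravar; [lra |].
    replace 8 with (2 ^ 3) by ring. apply pow_incr. lra.
Qed.

(** Truncated geometric series: its frequencies are powers of [p], which [q] does not divide. *)
Lemma ap1_euler_factor (p q : nat) (al : C) : is_prime p -> is_prime q -> p <> q -> Cmod al <= INR p ->
  almost_poly1 q (fun s => / (1 - al * Rcpow (INR p) (- s)))%C.
Proof.
  intros Hp Hq Hne Hal eps Heps.
  assert (Hgeo : forall K, exists g, dirichlet_poly q g /\
    forall s, (1 + g s = Csum_lt (fun k => (al * Rcpow (INR p) (- s)) ^ k) (S K))%C).
  { induction K as [| K (g & Hg & E)].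
    - exists (fun _ => 0). split; [constructor |]. intro s. simpl. ring.
    - exists (fun s => g s + al ^ (S K) * Rcpow (INR (p ^ S K)) (- s))%C. split.
      + constructor; [exact Hg |]. constructor.
        * pose proof (is_prime_ge2 p Hp). rewrite Nat.pow_succ_r'.
          assert (p ^ K <> 0)%nat by (apply Nat.pow_nonzero; lia). nia.
        * now apply prime_not_divide_pow.
      + intro s. rewrite Cplus_assoc, E.
        change (Csum_lt (fun k => (al * Rcpow (INR p) (- s)) ^ k)%C (S (S K)))
          with (Csum_lt (fun k => (al * Rcpow (INR p) (- s)) ^ k)%C (S K) + (al * Rcpow (INR p) (- s)) ^ (S K))%C.
        f_equal. rewrite Cpow_mult_l. f_equal.
        unfold Rcpow. rewrite <- Cexp_INR. f_equal.
        pose proof (is_prime_ge2 p Hp). rewrite ln_INR_pow by lia. rewrite RtoC_mult. ring. }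
  destruct (pow_lt_1_zero (1 / 8)) with (y := eps / 2) as [N HN].
  { rewrite Rabs_pos_eq; lra. } { lra. }
  destruct (Hgeo N) as (g & Hg & E). exists g. split; [exact Hg |]. intro y.
  destruct (local_term_small al p y Hp Hal) as [Hw1 Hw2].
  set (w := (al * Rcpow (INR p) (- (4, y)))%C) in *.
  assert (Hw : Cmod w <= 1 / 8) by lra.
  assert (Hd : 1 / 2 <= Cmod (1 - w)).
  { pose proof (Cmod_triangle (1 - w) w) as T. replace (1 - w + w)%C with (RtoC 1) in T by ring.
    rewrite Cmod_1 in T. lra. }
  assert (Hd0 : (1 - w)%C <> 0) by (apply Cmod_gt_0; lra).
  replace (/ (1 - w) - 1 - g (4, y))%C with (w ^ S N / (1 - w))%C.
  - rewrite Cmod_div by exact Hd0. rewrite Cmod_pow. apply Rle_div_l; [lra |].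
    specialize (HN (S N) ltac:(lia)).
    assert (Hpw : Cmod w ^ S N <= (1 / 8) ^ S N) by (apply pow_incr; split; [apply Cmod_ge_0 | exact Hw]).
    rewrite Rabs_pos_eq in HN by (apply pow_le; lra). nra.
  - pose proof (Csum_lt_geom w (S N)) as G. specialize (E (4, y)). fold w in E. rewrite <- E in G.
    replace (/ (1 - w) - 1 - g (4, y))%C with ((1 - (1 + g (4, y)) * (1 - w)) / (1 - w))%C by (field; exact Hd0).
    rewrite G. f_equal. ring.
Qed.

(** * Uniform convergence of the Euler product *)

Fixpoint Rprod1 (d : nat -> R) (n : nat) : R :=
  match n with O => 1 | S n' => Rprod1 d n' * (1 + d n) end.

Lemma Rprod1_ge1 (d : nat -> R) (n : nat) : (forall i, 0 <= d i) -> 1 <= Rprod1 d n.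
Proof. intro H. induction n as [| n IH]; simpl; [lra |]. specialize (H (S n)). nra. Qed.

(** Expanding the products, each term is dominated by its real counterpart, so the increments of a
    convergent real product control those of the complex one uniformly. *)
Lemma Cprod_majorant (c : nat -> C) (d : nat -> R) (N k : nat) :
  (forall i, 0 <= d i) ->
  (forall i, (1 <= i <= N + k)%nat -> Cmod (c i - 1) <= d i) ->
  Cmod (Cprod c (N + k)) <= Rprod1 d (N + k) /\
  Cmod (Cprod c (N + k) - Cprod c N) <= Rprod1 d (N + k) - Rprod1 d N.
Proof.
  intros Hd Hc.
  assert (H1 : forall M, (M <= N + k)%nat -> Cmod (Cprod c M) <= Rprod1 d M).
  { induction M as [| M IH]; intro HM; simpl.
    - rewrite Cmod_1. lra.
    - rewrite Cmod_mult. apply Rmult_le_compat; try apply Cmod_ge_0; [apply IH; lia |].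
      replace (c (S M)) with (1 + (c (S M) - 1))%C by ring.
      eapply Rle_trans; [apply Cmod_triangle |]. rewrite Cmod_1. specialize (Hc (S M) ltac:(lia)). lra. }
  split; [now apply H1 |].
  induction k as [| k IH].
  - rewrite Nat.add_0_r. replace (Cprod c N - Cprod c N)%C with (RtoC 0) by ring. rewrite Cmod_0. lra.
  - rewrite Nat.add_succ_r. simpl.
    replace (Cprod c (N + k) * c (S (N + k)) - Cprod c N)%C
      with (Cprod c (N + k) * (c (S (N + k)) - 1) + (Cprod c (N + k) - Cprod c N))%C by ring.
    eapply Rle_trans; [apply Cmod_triangle |]. rewrite Cmod_mult.
    specialize (IH ltac:(intros; apply Hc; lia) ltac:(intros; apply H1; lia)).
    specialize (H1 (N + k)%nat ltac:(lia)). specialize (Hc (S (N + k)) ltac:(lia)).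
    pose proof (Cmod_ge_0 (Cprod c (N + k))). pose proof (Cmod_ge_0 (c (S (N + k)) - 1)). nra.
Qed.

Lemma Rprod1_const (x : R) (m : nat) : Rprod1 (fun _ => x) m = (1 + x) ^ m.
Proof. induction m as [| m IH]; simpl; [reflexivity | rewrite IH; ring]. Qed.

(** It comes from [|1 / (1 - w) - 1| <= 2 |w|] for [|w| <= 1/2], used for each of the [m] factors
    with [|w| <= p^(-3)]. *)
Definition local_majorant (m : nat) (p : nat) : R := (1 + 2 * / INR p ^ 3) ^ m - 1.

Lemma inv_INR_cube_nonneg (p : nat) : 0 <= / INR p ^ 3.
Proof.
  destruct p as [| p]; [simpl; rewrite Rmult_0_l, Rinv_0; lra |].
  apply Rlt_le, Rinv_0_lt_compat, pow_lt, INR_S_pos.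
Qed.

Lemma local_majorant_nonneg (m p : nat) : 0 <= local_majorant m p.
Proof.
  unfold local_majorant. pose proof (inv_INR_cube_nonneg p).
  pose proof (pow_R1_Rle (1 + 2 * / INR p ^ 3) m ltac:(lra)). lra.
Qed.

(** The product is taken over all integers. The exponent [4 - 2 / n] telescopes, since
    [2 / (n + 1)^3] is at most [2 / n - 2 / (n + 1)]. *)
Lemma local_majorant_prod_le (m N : nat) : Rprod1 (local_majorant m) N <= exp 4 ^ m.
Proof.
  set (P := Rprod1 (fun p => 2 * / INR p ^ 3)).
  assert (HP : forall N, Rprod1 (local_majorant m) N = P N ^ m).
  { induction N0 as [| M IH]; unfold P in *; simpl; [now rewrite pow1 |].
    rewrite IH, Rpow_mult_distr. unfold local_majorant. simpl. f_equal. ring. }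
  assert (HP0 : forall N, 1 <= P N).
  { intro M. apply Rprod1_ge1. intro i. pose proof (inv_INR_cube_nonneg i). lra. }
  assert (HPe : forall N, P (S N) <= exp (4 - 2 / INR (S N))).
  { induction N0 as [| M IH].
    - unfold P; simpl. pose proof (exp_ineq1_le (4 - 2 / 1)). rewrite Rmult_1_r. field_simplify. field_simplify in H. lra.
    - change (P (S (S M))) with (P (S M) * (1 + 2 * / INR (S (S M)) ^ 3)).
      pose proof (INR_S_pos M) as Hx. rewrite (S_INR (S M)). set (x := INR (S M)) in *.
      assert (Hi : 2 * / (x + 1) ^ 3 <= 2 / x - 2 / (x + 1)).
      { replace (2 / x - 2 / (x + 1)) with (2 * / (x * (x + 1))) by (field; lra).
        apply Rmult_le_compat_l; [lra |]. apply Rinv_le_contravar; [nra |]. simpl.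
        assert (x * (x + 1) <= (x + 1) * (x + 1)) by nra. nra. }
      replace (4 - 2 / (x + 1)) with ((4 - 2 / x) + (2 / x - 2 / (x + 1))) by ring. rewrite exp_plus.
      specialize (HP0 (S M)).
      assert (0 < / (x + 1) ^ 3) by (apply Rinv_0_lt_compat, pow_lt; lra).
      apply Rmult_le_compat; [lra | lra | exact IH |].
      eapply Rle_trans; [| apply exp_ineq1_le]. lra. }
  rewrite HP. apply pow_incr. split; [specialize (HP0 N); lra |].
  destruct N as [| N].
  - unfold P; simpl. pose proof (exp_ineq1_le 4). lra.
  - eapply Rle_trans; [apply HPe |]. apply exp_le_mono.
    assert (0 < 2 / INR (S N)) by (apply Rdiv_lt_0_compat; [lra | apply INR_S_pos]). lra.
Qed.

Section EulerProduct.
Variables (L : C -> C) (m : nat) (alpha : nat -> nat -> C).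
Hypothesis HE : euler_product L m alpha.

(** If [|alpha_j(p)| > p], the Euler factor would vanish at [s = log alpha_j(p) / log p], a point
    with [Re s > 1]. *)
Lemma alpha_le_p (p j : nat) : is_prime p -> (1 <= j <= m)%nat -> Cmod (alpha j p) <= INR p.
Proof.
  intros Hp Hj. destruct (Rle_dec (Cmod (alpha j p)) (INR p)) as [| Hn]; [assumption | exfalso].
  apply Rnot_le_lt in Hn. pose proof (ln_prime_pos p Hp) as Hl.
  assert (Hp0 : 0 < INR p) by (apply lt_0_INR; apply is_prime_ge2 in Hp; lia).
  assert (Ha : alpha j p <> 0) by (apply Cmod_gt_0; lra).
  destruct (polar _ Ha) as (th & _ & E).
  set (s := (ln (Cmod (alpha j p)) / ln (INR p), th / ln (INR p)) : C).
  destruct (HE s) as [Hnz _].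
  { simpl. apply Rlt_div_r; [exact Hl |]. rewrite Rmult_1_l. now apply ln_increasing. }
  apply (Hnz p j Hp Hj). rewrite Rcpow_neg_line.
  rewrite E at 1. rewrite <- Cexp_plus.
  replace ((ln (Cmod (alpha j p)), th) + - ln (INR p) * s)%C with (RtoC 0).
  - rewrite Cexp_0. ring.
  - unfold s, Cplus, Cmult, Copp, RtoC; simpl. f_equal; field; lra.
Qed.

Definition euler_factor (p : nat) (s : C) : C :=
  Cprod (fun j => / (1 - alpha j p * Rcpow (INR p) (- s)))%C m.

Lemma euler_factor_majorant (p : nat) (y : R) : is_prime p ->
  Cmod (euler_factor p (4, y) - 1) <= local_majorant m p.
Proof.
  intro Hp. unfold local_majorant. rewrite <- Rprod1_const.
  pose proof (inv_INR_cube_nonneg p) as Hi.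
  destruct (Cprod_majorant (fun j => / (1 - alpha j p * Rcpow (INR p) (- (4, y))))%C
    (fun _ => 2 * / INR p ^ 3) 0 m) as [_ H]; [intro; lra | | exact H].
  intros j Hj. rewrite Nat.add_0_l in Hj.
  destruct (local_term_small (alpha j p) p y Hp (alpha_le_p p j Hp Hj)) as [Hw1 Hw2].
  set (w := (alpha j p * Rcpow (INR p) (- (4, y)))%C) in *.
  assert (Hd : 1 / 2 <= Cmod (1 - w)).
  { pose proof (Cmod_triangle (1 - w) w) as T. replace (1 - w + w)%C with (RtoC 1) in T by ring.
    rewrite Cmod_1 in T. lra. }
  assert (Hd0 : (1 - w)%C <> 0) by (apply Cmod_gt_0; lra).
  replace (/ (1 - w) - 1)%C with (w / (1 - w))%C by (field; exact Hd0).
  rewrite Cmod_div by exact Hd0. apply Rle_div_l; [lra |].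
  pose proof (Cmod_ge_0 w). nra.
Qed.

Definition euler_partial (N : nat) (s : C) : C := Cprod (at_primes 1 (fun p => euler_factor p s)) N.

(** The real majorant increases and is bounded, hence is Cauchy with an index independent of [y];
    pointwise convergence to [L] then transfers the estimate to the limit. *)
Lemma euler_partial_uniform (eps : R) : 0 < eps ->
  exists N0, forall N y, (N0 <= N)%nat -> Cmod (L (4, y) - euler_partial N (4, y)) <= eps.
Proof.
  intro Heps. set (D := Rprod1 (local_majorant m)).
  destruct (ex_finite_lim_seq_incr D (exp 4 ^ m)) as [l Hl].
  { intro n. unfold D; simpl. pose proof (local_majorant_nonneg m (S n)).
    pose proof (Rprod1_ge1 (local_majorant m) n (local_majorant_nonneg m)). nra. }
  { intro n. apply local_majorant_prod_le. }
  apply is_lim_seq_spec in Hl. destruct (Hl (mkposreal (eps / 3) ltac:(lra))) as [N0 HN0]. simpl in HN0.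
  exists N0. intros N y HN. apply Rle_plus_epsilon. intros e He.
  destruct (HE (4, y) ltac:(simpl; lra)) as [_ Hlim].
  destruct (Cis_lim_seq_eps _ _ Hlim e He) as [N1 HN1].
  specialize (HN1 (N + N1)%nat ltac:(lia)).
  pose proof (HN0 N HN) as G1. pose proof (HN0 (N + N1)%nat ltac:(lia)) as G2.
  apply Rabs_lt_between in G1. apply Rabs_lt_between in G2.
  destruct (Cprod_majorant (at_primes 1 (fun p => euler_factor p (4, y))) (local_majorant m) N N1) as [_ H].
  { apply local_majorant_nonneg. }
  { intros i _. unfold at_primes. destruct prime_dec as [Hp | Hp].
    - now apply euler_factor_majorant.
    - replace (1 - 1)%C with (RtoC 0) by ring. rewrite Cmod_0. apply local_majorant_nonneg. }
  fold (euler_partial (N + N1) (4, y)) in H. fold (euler_partial N (4, y)) in H.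
  change (Cmod (euler_partial (N + N1) (4, y) - L (4, y)) < e) in HN1.
  fold D in H.
  replace (L (4, y) - euler_partial N (4, y))%C
    with (- (euler_partial (N + N1) (4, y) - L (4, y)) + (euler_partial (N + N1) (4, y) - euler_partial N (4, y)))%C by ring.
  eapply Rle_trans; [apply Cmod_triangle |]. rewrite Cmod_opp. lra.
Qed.

Definition without (q : nat) (g : nat -> C) (p : nat) : C := if Nat.eq_dec p q then 1 else g p.

Definition reciprocal_factor (beta : nat -> C) (q i : nat) (s : C) : C :=
  Cprod (fun j => 1 - beta j * Rcpow (INR q) (- s))%C i.

Lemma reciprocal_factor_mul (q : nat) (s : C) : is_prime q -> 1 < Re s ->
  (euler_factor q s * reciprocal_factor (fun j => alpha j q) q m s)%C = 1.
Proof.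
  intros Hq Hs. destruct (HE s Hs) as [Hnz _]. unfold euler_factor, reciprocal_factor.
  assert (H : forall i, (i <= m)%nat -> (Cprod (fun j => / (1 - alpha j q * Rcpow (INR q) (- s))) i *
    Cprod (fun j => 1 - alpha j q * Rcpow (INR q) (- s)) i)%C = 1); [| now apply H].
  induction i as [| i IH]; intro Hi; simpl; [ring |].
  specialize (IH ltac:(lia)). specialize (Hnz q (S i) Hq ltac:(lia)).
  set (A := Cprod _ i) in *. set (B := Cprod (fun j => 1 - alpha j q * Rcpow (INR q) (- s))%C i) in *.
  replace (A * / (1 - alpha (S i) q * Rcpow (INR q) (- s)) * (B * (1 - alpha (S i) q * Rcpow (INR q) (- s))))%C
    with (A * B)%C by (field; exact Hnz). exact IH.
Qed.

Lemma euler_partial_without (q : nat) (s : C) (N : nat) : is_prime q -> 1 < Re s -> (q <= N)%nat ->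
  (euler_partial N s * reciprocal_factor (fun j => alpha j q) q m s)%C
  = Cprod (at_primes 1 (without q (fun p => euler_factor p s))) N.
Proof.
  intros Hq Hs. induction N as [| N IH]; intro HN.
  - apply is_prime_ge2 in Hq. lia.
  - unfold euler_partial in *. simpl. destruct (Nat.eq_dec q (S N)) as [E | E].
    + assert (E2 : forall M, (M < q)%nat -> Cprod (at_primes 1 (fun p => euler_factor p s)) M
        = Cprod (at_primes 1 (without q (fun p => euler_factor p s))) M).
      { induction M as [| M IM]; intro HM; simpl; [reflexivity |]. rewrite IM by lia. f_equal.
        unfold at_primes, without. destruct prime_dec; [destruct Nat.eq_dec |]; try reflexivity. lia. }
      rewrite (E2 N) by lia.
      replace (at_primes 1 (fun p => euler_factor p s) (S N)) with (euler_factor q s).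
      2: { unfold at_primes. rewrite <- E. destruct prime_dec; [reflexivity | contradiction]. }
      replace (at_primes 1 (without q (fun p => euler_factor p s)) (S N)) with (RtoC 1).
      2: { unfold at_primes, without. destruct prime_dec; [destruct Nat.eq_dec |]; try reflexivity. congruence. }
      rewrite <- Cmult_assoc, reciprocal_factor_mul by assumption. ring.
    + rewrite <- IH by lia.
      replace (at_primes 1 (without q (fun p => euler_factor p s)) (S N))
        with (at_primes 1 (fun p => euler_factor p s) (S N)); [ring |].
      unfold at_primes, without. destruct prime_dec; [destruct Nat.eq_dec |]; try reflexivity. congruence.
Qed.

Lemma reciprocal_factor_bounded (beta : nat -> C) (q i : nat) :
  exists B, 0 < B /\ forall y, Cmod (reciprocal_factor beta q i (4, y)) <= B.
Proof.
  unfold reciprocal_factor. induction i as [| i (B & HB & H)]; simpl.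
  - exists 1. split; [lra |]. intro. rewrite Cmod_1. lra.
  - set (c := Cmod (beta (S i)) * Rpower (INR q) (- (4))).
    assert (Hc : 0 <= c) by (apply Rmult_le_pos; [apply Cmod_ge_0 | apply Rlt_le, exp_pos]).
    exists (B * (1 + c)). split; [nra |]. intro y. rewrite Cmod_mult.
    apply Rmult_le_compat; try apply Cmod_ge_0; [apply H |].
    unfold Cminus. eapply Rle_trans; [apply Cmod_triangle |].
    rewrite Cmod_opp, Cmod_1, Cmod_mult, Cmod_Rcpow. apply Rle_refl.
Qed.

(** Multiplication by the reciprocal factor cancels the factor at [q] in each partial product, and
    it is bounded on the line, so uniform convergence persists. *)
Lemma ap1_without (q : nat) : is_prime q ->
  almost_poly1 q (fun s => L s * reciprocal_factor (fun j => alpha j q) q m s)%C.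
Proof.
  intro Hq. apply ap1_lim. intros eps Heps.
  destruct (reciprocal_factor_bounded (fun j => alpha j q) q m) as (B & HB & HQ).
  destruct (euler_partial_uniform (eps / B)) as [N0 HN0]; [now apply Rdiv_lt_0_compat |].
  exists (fun s => Cprod (fun i => at_primes 1 (without q (fun p => euler_factor p s)) i) (N0 + q)). split.
  - apply (ap1_prod q (N0 + q) (fun i s => at_primes 1 (without q (fun p => euler_factor p s)) i)); [exact Hq |].
    intros i _. unfold at_primes, without.
    destruct prime_dec as [Hp | Hp]; [| apply ap1_one].
    destruct Nat.eq_dec as [E | E]; [apply ap1_one |].
    apply ap1_prod; [exact Hq |]. intros j Hj.
    apply ap1_euler_factor; try assumption. now apply alpha_le_p.
  - intro y.
    change (Cprod (fun i => at_primes 1 (without q (fun p => euler_factor p (4, y))) i) (N0 + q))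
      with (Cprod (at_primes 1 (without q (fun p => euler_factor p (4, y)))) (N0 + q)).
    rewrite <- euler_partial_without by (assumption || (simpl; lra) || lia).
    replace (L (4, y) * reciprocal_factor (fun j => alpha j q) q m (4, y)
      - euler_partial (N0 + q) (4, y) * reciprocal_factor (fun j => alpha j q) q m (4, y))%C
      with ((L (4, y) - euler_partial (N0 + q) (4, y)) * reciprocal_factor (fun j => alpha j q) q m (4, y))%C by ring.
    rewrite Cmod_mult. apply Rle_trans with (eps / B * B); [| right; field; lra].
    apply Rmult_le_compat; try apply Cmod_ge_0; [apply HN0; lia | apply HQ].
Qed.
End EulerProduct.

(** * Dirichlet coefficients at prime powers *)

Section DirichletSeries.
Variables (a : nat -> C) (L : C -> C).
Hypothesis HD : forall s : C, 1 < Re s ->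
  Cis_series (fun n => (a (S n) * Rcpow (INR (S n)) (- s))%C) (L s).
Hypothesis HR : forall eps : R, 0 < eps ->
  exists M : R, forall n : nat, (1 <= n)%nat -> Cmod (a n) <= M * Rpower (INR n) eps.

Definition dirichlet_partial (K : nat) (s : C) : C :=
  Csum_lt (fun n => a (S n) * Rcpow (INR (S n)) (- s))%C K.

Lemma dirichlet_partial_lim (s : C) : 1 < Re s -> Cis_lim_seq (fun n => dirichlet_partial (S n) s) (L s).
Proof.
  intro Hs. pose proof (HD s Hs) as H. unfold Cis_series, is_series in H.
  eapply filterlim_ext; [| exact H]. intro n. cbv beta.
  induction n as [| n IH].
  - rewrite sum_O. unfold dirichlet_partial. cbn [Csum_lt]. ring.
  - rewrite sum_Sn, IH. reflexivity.
Qed.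

Lemma dirichlet_partial_uniform (eps : R) : 0 < eps ->
  exists N0, forall N y, (N0 <= N)%nat -> Cmod (L (4, y) - dirichlet_partial N (4, y)) <= eps.
Proof.
  (* The exponent 1 suffices on the line Re s = 4: the terms are at most [M n^(-3)] and are compared
     with a telescoping sum. *)
  intro Heps. destruct (HR 1 Rlt_0_1) as [M HM].
  assert (HM0 : 0 <= M).
  { specialize (HM 1%nat ltac:(lia)). simpl in HM. rewrite Rpower_1 in HM by lra.
    pose proof (Cmod_ge_0 (a 1)). lra. }
  assert (Hterm : forall n y, Cmod (a (S (S n)) * Rcpow (INR (S (S n))) (- (4, y)))%C
    <= M * (/ INR (S n) - / INR (S (S n)))).
  { intros n y. rewrite Cmod_mult, Cmod_Rcpow. simpl Re. specialize (HM (S (S n)) ltac:(lia)).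
    pose proof (INR_S_pos n) as Hx. rewrite (S_INR (S n)) in *. set (x := INR (S n)) in *.
    rewrite Rpower_1 in HM by lra.
    replace (Rpower (x + 1) (- (4))) with (/ (x + 1) ^ 4).
    2: { rewrite Rpower_Ropp. f_equal. replace 4 with (INR 4) by (simpl; ring). symmetry. apply Rpower_pow. lra. }
    assert (Hp : 0 < / (x + 1) ^ 4) by (apply Rinv_0_lt_compat, pow_lt; lra).
    apply Rle_trans with (M * (x + 1) * / (x + 1) ^ 4); [apply Rmult_le_compat_r; lra |].
    rewrite Rmult_assoc. apply Rmult_le_compat_l; [exact HM0 |].
    replace ((x + 1) * / (x + 1) ^ 4) with (/ (x + 1) ^ 3) by (field; lra).
    replace (/ x - / (x + 1)) with (/ (x * (x + 1))) by (field; lra).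
    apply Rinv_le_contravar; [nra |]. simpl. assert (x * (x + 1) <= (x + 1) * (x + 1)) by nra. nra. }
  assert (Htail : forall N k y, Cmod (dirichlet_partial (S N + k) (4, y) - dirichlet_partial (S N) (4, y))
    <= M * (/ INR (S N) - / INR (S N + k))).
  { intros N k y. induction k as [| k IH].
    - rewrite Nat.add_0_r. replace (dirichlet_partial (S N) (4, y) - dirichlet_partial (S N) (4, y))%C with (RtoC 0) by ring.
      rewrite Cmod_0. lra.
    - replace (S N + S k)%nat with (S (S (N + k))) by lia. replace (S N + k)%nat with (S (N + k)) in IH by lia.
      change (dirichlet_partial (S (S (N + k))) (4, y)) with
        (dirichlet_partial (S (N + k)) (4, y) + a (S (S (N + k))) * Rcpow (INR (S (S (N + k)))) (- (4, y)))%C.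
      replace (dirichlet_partial (S (N + k)) (4, y) + a (S (S (N + k))) * Rcpow (INR (S (S (N + k)))) (- (4, y))
        - dirichlet_partial (S N) (4, y))%C
        with ((dirichlet_partial (S (N + k)) (4, y) - dirichlet_partial (S N) (4, y))
          + a (S (S (N + k))) * Rcpow (INR (S (S (N + k)))) (- (4, y)))%C by ring.
      eapply Rle_trans; [apply Cmod_triangle |]. specialize (Hterm (N + k)%nat y). lra. }
  destruct (INR_unbounded (M / eps)) as [N0 HN0].
  exists (S N0). intros N y HN. apply Rle_plus_epsilon. intros e He.
  destruct N as [| N]; [lia |].
  destruct (Cis_lim_seq_eps _ _ (dirichlet_partial_lim (4, y) ltac:(simpl; lra)) e He) as [N1 HN1].
  specialize (HN1 (N + N1)%nat ltac:(lia)). cbv beta in HN1.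
  specialize (Htail N N1 y). replace (S N + N1)%nat with (S (N + N1)) in Htail by lia.
  replace (L (4, y) - dirichlet_partial (S N) (4, y))%C
    with (- (dirichlet_partial (S (N + N1)) (4, y) - L (4, y))
      + (dirichlet_partial (S (N + N1)) (4, y) - dirichlet_partial (S N) (4, y)))%C by ring.
  eapply Rle_trans; [apply Cmod_triangle |]. rewrite Cmod_opp.
  assert (M * (/ INR (S N) - / INR (S (N + N1))) <= eps).
  { pose proof (INR_S_pos N) as HSN. assert (0 < / INR (S (N + N1))) by apply Rinv_0_lt_compat, INR_S_pos.
    apply Rle_trans with (M * / INR (S N)); [apply Rmult_le_compat_l; lra |].
    apply Rle_div_l; [exact HSN |]. assert (INR N0 <= INR (S N)) by (apply le_INR; lia).
    apply Rlt_le in HN0. apply Rle_div_l in HN0; [| exact Heps]. nra. }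
  lra.
Qed.

(** Index 0 represents a frequency that no term carries; the value [a 0] is not part of the series
    and is arbitrary. *)
Definition coef (n : nat) : C := match n with O => 0 | S _ => a n end.

Lemma dirichlet_partial_mean (x : R) (n0 K : nat) :
  (forall n, (1 <= n)%nat -> (x = ln (INR n) <-> n = n0)) -> (n0 <= K)%nat ->
  mean_value_at (dirichlet_partial K) x (coef n0).
Proof.
  intros Hx HK.
  assert (H : forall K, mean_value_at (dirichlet_partial K) x (if le_dec n0 K then coef n0 else 0)).
  { induction K0 as [| M IH].
    - replace (if le_dec n0 0 then coef n0 else 0) with (RtoC 0).
      + pose proof (mean_const 0 x) as H. destruct Req_dec_T in H; exact H.
      + destruct le_dec as [H |]; [| reflexivity]. apply Nat.le_0_r in H. now subst n0.
    - pose proof (mean_plus _ _ _ _ _ IH (mean_dirichlet_term (a (S M)) (S M) x)) as H.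
      match type of H with mean_value_at _ _ ?v => replace (if le_dec n0 (S M) then coef n0 else 0) with v; [exact H |] end.
      specialize (Hx (S M) ltac:(lia)).
      destruct Req_dec_T as [E | E]; destruct (le_dec n0 M), (le_dec n0 (S M)); try lia.
      + apply Hx in E. lia.
      + apply Hx in E. subst n0. simpl. ring.
      + apply Hx in E. lia.
      + ring.
      + exfalso. apply E, Hx. lia.
      + ring. }
  specialize (H K). destruct le_dec; [exact H | contradiction].
Qed.

Lemma dirichlet_series_mean (x : R) (n0 : nat) :
  (forall n, (1 <= n)%nat -> (x = ln (INR n) <-> n = n0)) -> mean_value_at L x (coef n0).
Proof.
  intro Hx. apply mean_unif. intros eps Heps.
  destruct (dirichlet_partial_uniform eps Heps) as [N0 HN0].
  exists (dirichlet_partial (N0 + n0)). split.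
  - apply dirichlet_partial_mean; [exact Hx | lia].
  - intro y. apply HN0. lia.
Qed.

(** Integer exponents, with value 0 at negative ones, let the recursions refer to [z - 1] without a
    case distinction. *)
Definition prime_power_coef (q : nat) (z : Z) : C :=
  if Z_le_dec 0 z then a (q ^ Z.to_nat z)%nat else 0.

Lemma prime_power_mean (q : nat) (z : Z) : is_prime q ->
  mean_value_at L (IZR z * ln (INR q)) (prime_power_coef q z).
Proof.
  intro Hq. unfold prime_power_coef. destruct (Z_le_dec 0 z) as [Hz | Hz].
  - assert (Hpos : (q ^ Z.to_nat z <> 0)%nat) by (apply is_prime_ge2 in Hq; apply Nat.pow_nonzero; lia).
    replace (a (q ^ Z.to_nat z)%nat) with (coef (q ^ Z.to_nat z)%nat)
      by (destruct (q ^ Z.to_nat z)%nat; [lia | reflexivity]).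
    apply dirichlet_series_mean. intros n Hn. split.
    + intro E. apply ln_nat_prime_power in E; tauto.
    + intros ->. rewrite ln_INR_pow by (apply is_prime_ge2 in Hq; lia).
      rewrite (INR_IZR_INZ (Z.to_nat z)), Z2Nat.id by exact Hz. reflexivity.
  - change (RtoC 0) with (coef 0). apply dirichlet_series_mean. intros n Hn. split.
    + intro E. apply ln_nat_prime_power in E; tauto.
    + intro E. lia.
Qed.

Fixpoint filtered_coef (beta : nat -> C) (q i : nat) (z : Z) : C :=
  match i with
  | O => prime_power_coef q z
  | S i' => (filtered_coef beta q i' z - beta i * filtered_coef beta q i' (z - 1))%C
  end.

(** Multiplication by [q^(-s)] moves every frequency by [ln q], so its mean at [z] is the former
    mean at [z - 1]. *)
Lemma mean_shift (f : C -> C) (q : nat) (z : Z) (b v w : C) :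
  mean_value_at f (IZR z * ln (INR q)) v -> mean_value_at f (IZR (z - 1) * ln (INR q)) w ->
  mean_value_at (fun s => f s * (1 - b * Rcpow (INR q) (- s)))%C (IZR z * ln (INR q)) (v - b * w)%C.
Proof.
  intros Hv Hw.
  assert (H1 : mean_value_at (fun s => f s * Rcpow (INR q) (- s))%C (IZR z * ln (INR q)) w).
  { eapply mean_ext; [| exact Hw]. intro y. rewrite <- Cmult_assoc, Rcpow_neg_line, <- Cexp_plus.
    f_equal. f_equal. rewrite minus_IZR, !RtoC_mult, RtoC_minus. ring. }
  pose proof (mean_plus _ _ _ _ _ Hv (mean_scal (- b) _ _ _ H1)) as H.
  replace (v - b * w)%C with (v + - b * w)%C by ring.
  eapply mean_ext; [| exact H]. intro y. cbv beta. ring.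
Qed.

Lemma filtered_mean (beta : nat -> C) (q i : nat) (z : Z) : is_prime q ->
  mean_value_at (fun s => L s * reciprocal_factor beta q i s)%C (IZR z * ln (INR q)) (filtered_coef beta q i z).
Proof.
  intro Hq. revert z. induction i as [| i IH]; intro z.
  - eapply mean_ext; [| apply (prime_power_mean q z Hq)]. intro y. unfold reciprocal_factor; simpl. ring.
  - simpl filtered_coef.
    pose proof (mean_shift _ q z (beta (S i)) _ _ (IH z) (IH (z - 1)%Z)) as H.
    eapply mean_ext; [| exact H]. intro y. unfold reciprocal_factor; simpl. ring.
Qed.

Lemma filtered_coef_growth (beta : nat -> C) (q i : nat) (rho : R) : is_prime q -> 1 < rho ->
  exists K, 0 < K /\ (forall n, Cmod (filtered_coef beta q i (Z.of_nat n)) <= K * rho ^ n) /\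
    forall z, (z < 0)%Z -> filtered_coef beta q i z = 0.
Proof.
  intros Hq Hrho. induction i as [| i (K & HK & H1 & H2)].
  - pose proof (ln_prime_pos q Hq) as Hl. pose proof (is_prime_ge2 q Hq) as Hq2.
    assert (Hlr : 0 < ln rho) by (rewrite <- ln_1; apply ln_increasing; lra).
    (* With this exponent, [(q^n)^eps] is exactly [rho^n]. *)
    destruct (HR (ln rho / ln (INR q))) as [M HM]; [now apply Rdiv_lt_0_compat |].
    exists (Rmax 1 M). split; [pose proof (Rmax_l 1 M); lra |]. split.
    + intro n. simpl. unfold prime_power_coef. destruct Z_le_dec; [| lia]. rewrite Nat2Z.id.
      assert (Hpos : (q ^ n <> 0)%nat) by (apply Nat.pow_nonzero; lia).
      specialize (HM (q ^ n)%nat ltac:(lia)).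
      replace (Rpower (INR (q ^ n)) (ln rho / ln (INR q))) with (rho ^ n) in HM.
      * eapply Rle_trans; [exact HM |]. apply Rmult_le_compat_r; [apply pow_le; lra | apply Rmax_r].
      * unfold Rpower. rewrite ln_INR_pow by lia.
        replace (ln rho / ln (INR q) * (INR n * ln (INR q))) with (INR n * ln rho) by (field; lra).
        rewrite <- ln_pow by lra. now rewrite exp_ln by (apply pow_lt; lra).
    + intros z Hz. simpl. unfold prime_power_coef. destruct Z_le_dec; [lia | reflexivity].
  - pose proof (Cmod_ge_0 (beta (S i))) as Hb.
    exists (K * (1 + Cmod (beta (S i)))). split; [nra |]. split.
    + intro n. simpl. unfold Cminus. eapply Rle_trans; [apply Cmod_triangle |].
      rewrite Cmod_opp, Cmod_mult.
      assert (Hprev : Cmod (filtered_coef beta q i (Z.of_nat n - 1)) <= K * rho ^ n).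
      { destruct n as [| n].
        - rewrite H2 by lia. rewrite Cmod_0. simpl. lra.
        - replace (Z.of_nat (S n) - 1)%Z with (Z.of_nat n) by lia.
          eapply Rle_trans; [apply H1 |]. apply Rmult_le_compat_l; [lra |].
          simpl. assert (0 < rho ^ n) by (apply pow_lt; lra). nra. }
      specialize (H1 n). assert (0 <= K * rho ^ n) by (apply Rmult_le_pos; [lra | apply pow_le; lra]). nra.
    + intros z Hz. simpl. rewrite !H2 by lia. ring.
Qed.
End DirichletSeries.

Lemma pow_bounded_le_1 (x K : R) : 0 <= x -> (forall n, x ^ n <= K) -> x <= 1.
Proof.
  intros Hx H. destruct (Rle_dec x 1) as [| Hn]; [assumption | exfalso].
  destruct (Pow_x_infinity x) with (b := K + 1) as [N HN].
  { rewrite Rabs_pos_eq; lra. }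
  specialize (HN N (Nat.le_refl N)). specialize (H N). rewrite Rabs_pos_eq in HN by (apply pow_le; lra). lra.
Qed.

Lemma reciprocal_factor_split (g : nat -> C) (q m j0 : nat) (s : C) : (1 <= j0 <= m)%nat ->
  reciprocal_factor g q m s
  = (reciprocal_factor (fun j => if Nat.eq_dec j j0 then 0 else g j) q m s * (1 - g j0 * Rcpow (INR q) (- s)))%C.
Proof.
  unfold reciprocal_factor. intro Hj. induction m as [| m IH]; [lia |]. cbn [Cprod].
  destruct (Nat.eq_dec (S m) j0) as [E | E].
  - subst j0.
    assert (E2 : forall i, (i <= m)%nat -> Cprod (fun j => 1 - g j * Rcpow (INR q) (- s))%C i
      = Cprod (fun j => 1 - (if Nat.eq_dec j (S m) then 0 else g j) * Rcpow (INR q) (- s))%C i).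
    { induction i as [| i Ii]; intro Hi; simpl; [reflexivity |]. rewrite Ii by lia.
      destruct Nat.eq_dec; [lia | reflexivity]. }
    rewrite E2 by lia. ring.
  - rewrite IH by lia. ring.
Qed.

(* Multiplying [L] by all factors [1 - alpha_j(q) q^(-s)], [j <> j0], leaves a
   Dirichlet series whose coefficient at [q^n] is [alpha_j0(q)^n] on the one
   hand and [O(rho^n)] for every [rho > 1] on the other hand. *)
Lemma SP_alpha_le_1 (a : nat -> C) (L : C -> C) (m : nat) (alpha : nat -> nat -> C) (d : R) :
  SP a L m alpha d -> forall p j, is_prime p -> (1 <= j <= m)%nat -> Cmod (alpha j p) <= 1.
Proof.
  intros HS q j0 Hq Hj0. destruct HS as [HD HR _ _ _ HE].
  set (al := alpha j0 q). set (g := fun j => alpha j q).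
  (* A zero parameter makes the factor at [j0] equal to 1, so omitting it leaves the index range
     unchanged. *)
  set (beta := fun j => if Nat.eq_dec j j0 then RtoC 0 else g j).
  set (v := filtered_coef a beta q m).
  (* Both sides are the mean at [z ln q] of [L] times all reciprocal factors: once from the
     Dirichlet series, with the factor [j0] split off, and once from the Euler product without
     [q]. *)
  assert (Hrec : forall z, (v z - al * v (z - 1)%Z)%C = (if Z.eq_dec z 0 then 1 else 0)).
  { intro z. apply (mean_unique (fun s => L s * reciprocal_factor g q m s)%C (IZR z * ln (INR q))).
    - pose proof (mean_shift _ q z al _ _ (filtered_mean a L HD HR beta q m z Hq)
        (filtered_mean a L HD HR beta q m (z - 1)%Z Hq)) as H.
      eapply mean_ext; [| exact H]. intro y. cbv beta.
      rewrite (reciprocal_factor_split g q m j0) by exact Hj0. fold beta. unfold g at 1. fold al. ring.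
    - apply ap1_mean; [exact Hq |]. now apply (ap1_without L m alpha HE). }
  apply Rnot_lt_le. intro Hgt. fold al in Hgt.
  (* The midpoint between 1 and [|al|]: the bound [|al|^n <= K rho^n] for all [n] would force
     [|al| <= rho]. *)
  set (rho := (1 + Cmod al) / 2).
  destruct (filtered_coef_growth a HR beta q m rho Hq ltac:(unfold rho; lra)) as (K & HK & H1 & H2).
  fold v in H1, H2.
  assert (Hv : forall n, v (Z.of_nat n) = (al ^ n)%C).
  { induction n as [| n IH].
    - specialize (Hrec 0%Z). rewrite (H2 (0 - 1)%Z) in Hrec by lia. simpl in *.
      replace (v 0%Z) with (v 0%Z - al * 0)%C by ring. exact Hrec.
    - specialize (Hrec (Z.of_nat (S n))). replace (Z.of_nat (S n) - 1)%Z with (Z.of_nat n) in Hrec by lia.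
      destruct Z.eq_dec as [E |]; [lia |]. rewrite IH in Hrec. rewrite Cpow_S.
      replace (v (Z.of_nat (S n))) with ((v (Z.of_nat (S n)) - al * al ^ n) + al * al ^ n)%C by ring.
      rewrite Hrec. ring. }
  assert (Hr : 0 < rho) by (unfold rho; lra).
  assert (Hle : Cmod al / rho <= 1).
  { apply (pow_bounded_le_1 _ K); [apply Rdiv_le_0_compat; lra |]. intro n.
    unfold Rdiv. rewrite Rpow_mult_distr, pow_inv. specialize (H1 n). rewrite Hv, Cmod_pow in H1.
    apply Rle_div_l; [now apply pow_lt | exact H1]. }
  apply Rle_div_l in Hle; [| exact Hr]. unfold rho in Hle. lra.
Qed.

(** * The logarithm inside the critical strip *)

Lemma zeta_partial_antitone (e e' : R) (N : nat) : e <= e' -> zeta_partial e' N <= zeta_partial e N.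
Proof.
  intro H. induction N as [| N IH].
  - unfold zeta_partial. rewrite !(@sum_n_m_zero R_AbelianMonoid) by lia. apply Rle_refl.
  - rewrite !zeta_partial_S. apply Rplus_le_compat; [exact IH |].
    unfold Rpower. apply exp_le_mono.
    assert (0 <= ln (INR (S N))).
    { rewrite <- ln_1. apply ln_le; [lra |]. replace 1 with (INR 1) by reflexivity. apply le_INR. lia. }
    nra.
Qed.

(** Two uses of [ln u <= u - 1], one for each logarithm; the bound is the tangent at [x0]. *)
Lemma loglog_increment (c x0 x : R) : 0 < c -> 0 < x0 -> x0 <= x -> 0 < ln (c * x0) ->
  ln (ln (c * x)) - ln (ln (c * x0)) <= (x - x0) / (x0 * ln (c * x0)).
Proof.
  intros Hc Hx0 Hx Hl.
  assert (E : ln (c * x) - ln (c * x0) <= (x - x0) / x0).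
  { rewrite !ln_mult by lra.
    pose proof (ln_le_sub1 (x / x0) ltac:(apply Rdiv_lt_0_compat; lra)) as H.
    rewrite ln_div in H by lra. replace ((x - x0) / x0) with (x / x0 - 1) by (field; lra). lra. }
  assert (Hl2 : ln (c * x0) <= ln (c * x)) by (apply ln_le; nra).
  pose proof (ln_le_sub1 (ln (c * x) / ln (c * x0)) ltac:(apply Rdiv_lt_0_compat; lra)) as H.
  rewrite ln_div in H by lra. eapply Rle_trans; [exact H |].
  replace ((x - x0) / (x0 * ln (c * x0))) with ((x - x0) / x0 / ln (c * x0)) by (field; lra).
  replace (ln (c * x) / ln (c * x0) - 1) with ((ln (c * x) - ln (c * x0)) / ln (c * x0)) by (field; lra).
  apply Rmult_le_compat_r; [apply Rlt_le, Rinv_0_lt_compat, Hl | exact E].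
Qed.

(** Used to remove [c], with [Y] going from [ln (c * x)] down to [ln x]. With [v] the fraction
    inside the logarithm, the derivative is nonpositive because [C3 / x <= v] and
    [v / (1 + v) <= ln (1 + v)]. *)
Lemma ln_ratio_antitone (C3 x Y1 Y2 : R) : 1 <= C3 -> 0 < x -> exp 1 <= Y1 -> Y1 <= Y2 ->
  ln (1 + (C3 * ln Y2 + 3 / 2) / x) / Y2 <= ln (1 + (C3 * ln Y1 + 3 / 2) / x) / Y1.
Proof.
  intros HC3 Hx HY1 HY12. pose proof (exp_pos 1) as He.
  assert (Hln : forall Y, Y1 <= Y -> 1 <= ln Y) by (intros Y HY; rewrite <- (ln_exp 1); apply ln_le; lra).
  assert (Hv : forall Y, Y1 <= Y -> 0 < (C3 * ln Y + 3 / 2) / x).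
  { intros Y HY. specialize (Hln Y HY). apply Rdiv_lt_0_compat; nra. }
  apply (derive_nonpos_decr (fun Y => ln (1 + (C3 * ln Y + 3 / 2) / x) / Y)
    (fun Y => (C3 / x / (1 + (C3 * ln Y + 3 / 2) / x) - ln (1 + (C3 * ln Y + 3 / 2) / x)) / Y ^ 2) Y1 Y2 HY12).
  - intros Y [HY _]. specialize (Hln Y HY). specialize (Hv Y HY).
    auto_derive.
    + unfold Rdiv in Hv. repeat split; try lra.
    + change ((C3 * ln Y + 3 / 2) / x) with ((C3 * ln Y + 3 / 2) * / x) in *. field. repeat split; try lra.
      assert (C3 * ln Y + 3 / 2 > 0) by nra. lra.
  - intros Y [HY _]. specialize (Hln Y HY). specialize (Hv Y HY).
    assert (Hden : 0 < Y ^ 2) by (apply pow_lt; lra).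
    set (v := (C3 * ln Y + 3 / 2) / x) in *.
    assert (Hlow : v / (1 + v) <= ln (1 + v)).
    { pose proof (ln_le_sub1 (/ (1 + v)) ltac:(apply Rinv_0_lt_compat; lra)) as H.
      rewrite ln_Rinv in H by lra. replace (/ (1 + v) - 1) with (- (v / (1 + v))) in H by (field; lra). lra. }
    assert (Hc : C3 / x / (1 + v) <= v / (1 + v)).
    { apply Rmult_le_compat_r; [apply Rlt_le, Rinv_0_lt_compat; lra |].
      unfold v. apply Rmult_le_compat_r; [apply Rlt_le, Rinv_0_lt_compat; lra | nra]. }
    assert (0 <= (ln (1 + v) - C3 / x / (1 + v)) / Y ^ 2) by (apply Rdiv_le_0_compat; lra).
    replace ((C3 / x / (1 + v) - ln (1 + v)) / Y ^ 2) with (- ((ln (1 + v) - C3 / x / (1 + v)) / Y ^ 2)); [lra |].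
    field. repeat split; lra.
Qed.

(** Origin of the second factor of [b1_const]: the relative increase of the logarithm is first freed
    from [c], then evaluated at [T1] by monotonicity in [x]. *)
Lemma ln_shift_le (C3 T1 c x : R) : 1 <= C3 -> exp (exp 1) <= T1 -> T1 <= x -> 1 <= c ->
  ln (c * (x + (C3 * ln (ln (c * x)) + 3 / 2)))
  <= ln (c * x) * (1 + ln (1 + (C3 * ln (ln T1) + 3 / 2) / T1) / ln T1).
Proof.
  intros HC3 HT1 Hx Hc. pose proof (exp_pos (exp 1)) as He. pose proof (exp_pos 1) as He1.
  assert (HlT : exp 1 <= ln T1) by (rewrite <- (ln_exp (exp 1)); now apply ln_le).
  assert (Hlx : ln T1 <= ln x) by (apply ln_le; lra).
  assert (Hlcx : ln x <= ln (c * x)) by (apply ln_le; nra).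
  assert (HllT : 1 <= ln (ln T1)) by (rewrite <- (ln_exp 1) at 1; now apply ln_le).
  assert (Hllx : ln (ln T1) <= ln (ln x)) by (apply ln_le; lra).
  assert (Hll : ln (ln x) <= ln (ln (c * x))) by (apply ln_le; lra).
  set (u := C3 * ln (ln (c * x)) + 3 / 2).
  assert (Hu : 0 < u) by (unfold u; nra).
  replace (c * (x + u)) with (c * x * (1 + u / x)) by (field; lra).
  assert (Hux : 0 < u / x) by (apply Rdiv_lt_0_compat; lra).
  rewrite ln_mult by nra.
  rewrite Rmult_plus_distr_l, Rmult_1_r. apply Rplus_le_compat_l.
  assert (H1 : ln (1 + u / x) / ln (c * x) <= ln (1 + (C3 * ln (ln x) + 3 / 2) / x) / ln x).
  { apply (ln_ratio_antitone C3 x (ln x) (ln (c * x))); lra. }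
  (* The numerator grows more slowly than [x]: its increment is at most [C3 (x - T1) / T1], and [C3]
     is below the numerator at [T1]. *)
  assert (H2 : (C3 * ln (ln x) + 3 / 2) / x <= (C3 * ln (ln T1) + 3 / 2) / T1).
  { pose proof (loglog_increment 1 T1 x ltac:(lra) ltac:(lra) Hx ltac:(rewrite Rmult_1_l; lra)) as H.
    rewrite !Rmult_1_l in H.
    apply Rle_div_l; [lra |].
    replace ((C3 * ln (ln T1) + 3 / 2) / T1 * x) with ((C3 * ln (ln T1) + 3 / 2) + (C3 * ln (ln T1) + 3 / 2) * ((x - T1) / T1)) by (field; lra).
    assert (Hq : 0 <= (x - T1) / T1) by (apply Rdiv_le_0_compat; lra).
    assert (H3 : (x - T1) / (T1 * ln T1) <= (x - T1) / T1).
    { replace ((x - T1) / (T1 * ln T1)) with ((x - T1) / T1 * / ln T1) by (field; lra).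
      assert (/ ln T1 <= 1).
      { rewrite <- Rinv_1. apply Rinv_le_contravar; [lra |]. pose proof (exp_ineq1_le 1). lra. }
      nra. }
    assert (C3 * (ln (ln x) - ln (ln T1)) <= C3 * ((x - T1) / T1)) by (apply Rmult_le_compat_l; lra).
    assert (C3 * ((x - T1) / T1) <= (C3 * ln (ln T1) + 3 / 2) * ((x - T1) / T1)) by (apply Rmult_le_compat_r; nra).
    lra. }
  assert (H3 : 0 < (C3 * ln (ln x) + 3 / 2) / x) by (apply Rdiv_lt_0_compat; nra).
  assert (H4 : ln (1 + (C3 * ln (ln x) + 3 / 2) / x) / ln x <= ln (1 + (C3 * ln (ln T1) + 3 / 2) / T1) / ln T1).
  { assert (Hn : 0 <= ln (1 + (C3 * ln (ln x) + 3 / 2) / x)) by (rewrite <- ln_1; apply ln_le; lra).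
    unfold Rdiv at 1 3. apply Rmult_le_compat; [exact Hn | apply Rlt_le, Rinv_0_lt_compat; lra | |].
    - apply ln_le; lra.
    - apply Rinv_le_contravar; lra. }
  replace (ln (1 + u / x)) with (ln (c * x) * (ln (1 + u / x) / ln (c * x))) by (field; lra).
  apply Rmult_le_compat_l; lra.
Qed.

Lemma ln_div_antitone (x y : R) : exp 1 <= x -> x <= y -> ln y / y <= ln x / x.
Proof.
  intros Hx Hxy. pose proof (exp_pos 1).
  assert (1 <= ln x) by (rewrite <- (ln_exp 1); now apply ln_le).
  pose proof (ln_le_sub1 (y / x) ltac:(apply Rdiv_lt_0_compat; lra)) as Hl. rewrite ln_div in Hl by lra.
  apply Rle_div_l; [lra |].
  replace (ln x / x * y) with (ln x + ln x * (y / x - 1)) by (field; lra).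
  assert (0 <= y / x - 1); [| nra].
  replace (y / x - 1) with ((y - x) / x) by (field; lra). apply Rdiv_le_0_compat; lra.
Qed.

(** With [q = 1 / (4 rho)], the numerator is at most [4 q x] and the denominator at least
    [2 q (1 - q)]. The quotient [2 x / (1 - q)] is [2 x + 2 x q / (1 - q)], and [2 x <= 1]. *)
Lemma log_radius_ratio_le (rho x : R) : 1 <= rho -> 0 <= x <= 1 / 2 ->
  ln ((rho + x) / rho) / ln ((rho + 1 / 2) / rho) <= 2 * x + 1 / (4 * rho) / (1 - 1 / (4 * rho)).
Proof.
  intros Hr Hx. set (q := 1 / (4 * rho)).
  assert (Hq : 0 < q <= 1 / 4).
  { unfold q. split; [apply Rdiv_lt_0_compat; lra |]. apply Rle_div_l; lra. }
  assert (H1 : ln ((rho + x) / rho) <= 4 * q * x).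
  { eapply Rle_trans; [apply ln_le_sub1, Rdiv_lt_0_compat; lra |]. right. unfold q. field. lra. }
  assert (H2 : 2 * q * (1 - q) <= ln ((rho + 1 / 2) / rho)).
  { replace ((rho + 1 / 2) / rho) with (1 + 2 * q) by (unfold q; field; lra).
    pose proof (derive_nonpos_decr (fun y => y - y ^ 2 / 2 - ln (1 + y)) (fun y => - (y ^ 2 / (1 + y))) 0 (2 * q) ltac:(lra)) as H.
    assert (2 * q - (2 * q) ^ 2 / 2 - ln (1 + 2 * q) <= 0 - 0 ^ 2 / 2 - ln (1 + 0)); [apply H |].
    - intros y Hy. auto_derive; [lra | field; lra].
    - intros y Hy. assert (0 <= y ^ 2 / (1 + y)) by (apply Rdiv_le_0_compat; [apply pow2_ge_0 | lra]). lra.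
    - rewrite Rplus_0_r, ln_1 in H0. nra. }
  assert (Hd : 0 < 2 * q * (1 - q)) by nra.
  apply Rle_div_l; [lra |].
  apply Rle_trans with ((2 * x + q / (1 - q)) * (2 * q * (1 - q))).
  - replace ((2 * x + q / (1 - q)) * (2 * q * (1 - q))) with (4 * q * x * (1 - q) + 2 * q * q) by (field; lra).
    nra.
  - apply Rmult_le_compat_l; [| exact H2].
    assert (0 <= q / (1 - q)) by (apply Rdiv_le_0_compat; lra). lra.
Qed.

Lemma log_plus_nonneg (u : R) : 0 <= log_plus u.
Proof. apply Rmax_l. Qed.

(** The left side is the Borel-Caratheodory bound for radius [1/2 + eta] before division by the
    distance to the boundary. The quotients [ln X / X] and [1 / X] decrease, so replacing [X] by
    [ln u] in them produces [K_const]; the sign condition allows this for the zeta term. *)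
Lemma K_const_bound (d l C0 C1 u X : R) (m : nat) :
  0 < d -> 0 < l -> 0 < C1 -> exp (exp 1) <= u -> ln u <= X ->
  let eta := C1 / ln (ln u) in 0 <= ln (exp (EulerMascheroni * eta) / eta) ->
  2 * (1 / 2 + eta) * (1 / 4 * d * X + l * ln X + log_plus C0
      + INR m * ln (exp (EulerMascheroni * eta) / eta))
  <= K_const d m l C0 C1 u * X.
Proof.
  intros Hd Hl HC1 Hu HX eta Hz. pose proof (exp_pos 1) as He1. pose proof (exp_pos (exp 1)).
  assert (HLu : exp 1 <= ln u) by (rewrite <- (ln_exp (exp 1)); now apply ln_le).
  assert (HLLu : 1 <= ln (ln u)) by (rewrite <- (ln_exp 1) at 1; now apply ln_le).
  assert (Heta : 0 < eta) by (apply Rdiv_lt_0_compat; lra).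
  assert (E : ln (exp (EulerMascheroni * eta) / eta)
    = ln (ln (ln u)) + ln (1 / C1) + EulerMascheroni * C1 / ln (ln u)).
  { rewrite ln_div by (try apply exp_pos; lra). rewrite ln_exp. unfold eta at 2. rewrite !ln_div by lra.
    rewrite ln_1. unfold eta, Rdiv. ring. }
  rewrite E in *. set (Z := ln (ln (ln u)) + ln (1 / C1) + EulerMascheroni * C1 / ln (ln u)) in *.
  unfold K_const. fold Z. pose proof (log_plus_nonneg C0) as Hp. pose proof (pos_INR m) as Hm.
  set (lu := ln u) in *. set (llu := ln lu) in *.
  assert (HX1 : 1 <= X / lu) by (apply Rle_div_r; lra).
  assert (A1 : l * ln X <= l * (llu / lu * X)).
  { apply Rmult_le_compat_l; [lra |]. apply (proj1 (Rle_div_l (ln X) (llu / lu) X ltac:(lra))).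
    now apply ln_div_antitone. }
  assert (A2 : INR m * Z <= INR m * Z * (X / lu)).
  { rewrite <- (Rmult_1_r (INR m * Z)) at 1. apply Rmult_le_compat_l; [| exact HX1]. now apply Rmult_le_pos. }
  assert (A3 : log_plus C0 <= log_plus C0 * (X / lu)).
  { rewrite <- (Rmult_1_r (log_plus C0)) at 1. now apply Rmult_le_compat_l. }
  replace ((1 / 4 * d + C1 * d / (2 * llu) + (1 + 2 * C1 / llu) * (l * llu / lu + INR m / lu * Z + log_plus C0 / lu)) * X)
    with (2 * (1 / 2 + eta) * (1 / 4 * d * X + l * (llu / lu * X) + log_plus C0 * (X / lu) + INR m * Z * (X / lu)))
    by (unfold eta; field; lra).
  apply Rmult_le_compat_l; lra.
Qed.

(** * Estimates of log L *)

Lemma holo_log (L : C -> C) (m : nat) (alpha : nat -> nat -> C) (D : C -> Prop) (logL : C -> C) (z : C) :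
  log_branch L m alpha D logL -> 1 < Re z \/ D z ->
  holo_at logL z /\ L z <> 0 /\ Re (logL z) = ln (Cmod (L z)).
Proof.
  intros [_ H] Hz. destruct (H z Hz) as [H1 H2]. repeat split.
  - destruct (Cderivable_cdiff _ _ H1) as [E HE]. now exists E.
  - rewrite <- H2. apply Cexp_nz.
  - now rewrite <- H2, Cmod_Cexp, ln_exp.
Qed.

(** The partial sums of zeta decrease in the abscissa, so one bound at [1 + e] serves the whole
    half-plane to its right. *)
Lemma log_bound_right (a : nat -> C) (L : C -> C) (m : nat) (alpha : nat -> nat -> C) (d : R)
    (D : C -> Prop) (logL : C -> C) (e W : R) (z : C) :
  SP a L m alpha d -> log_branch L m alpha D logL -> 0 < e ->
  (forall X, zeta_partial e X <= W) -> 1 + e <= Re z -> Cmod (logL z) <= INR m * ln W.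
Proof.
  intros HS [Hlog _] He HW Hz. apply (log_series_bound m alpha z (logL z) W).
  - intros p j Hp Hj. now apply (SP_alpha_le_1 a L m alpha d HS).
  - lra.
  - intro X. eapply Rle_trans; [| apply HW]. apply zeta_partial_antitone. lra.
  - apply Hlog. lra.
Qed.

Lemma zeta_bound_ge_1 (e W : R) : (forall X, zeta_partial e X <= W) -> 1 <= W.
Proof.
  intro H. specialize (H 1%nat). unfold zeta_partial in H. rewrite sum_n_n in H.
  simpl INR in H. unfold Rpower in H. rewrite ln_1, Rmult_0_r, exp_0 in H. exact H.
Qed.

Lemma ln_exp_le (x y : R) : exp x <= y -> x <= ln y.
Proof. intro H. rewrite <- (ln_exp x). apply ln_le; [apply exp_pos | exact H]. Qed.

Theorem theorem4 (a : nat -> C) (L : C -> C) (m : nat)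
    (alpha : nat -> nat -> C) (d : R)
    (hL : SP a L m alpha d) (hd : 0 < d)
    (C0 l c T : R) (hC0 : 0 < C0) (hl : 0 < l) (hc : 1 <= c) (hT : exp 1 <= T)
    (hgrowth : forall s : C, T <= Rabs (Im s) -> 1 / 2 <= Re s -> L s <> 0 ->
       ln (Cmod (L s)) <= 1 / 4 * d * ln (c * Rabs (Im s))
                          + l * ln (ln (c * Rabs (Im s))) + log_plus C0)
    (C1 C2 C3 : R) (hC1 : 0 < C1 <= 1) (hC2 : 0 < C2 <= 2 * C1) (hC3 : 1 <= C3)
    (t t0 T1 T2 : R) (ht : t0 <= Rabs t) (ht0 : T1 <= t0)
    (hT1 : Rmax (Rmax (exp (exp (2 * C2))) (exp (4 * INR m / d)))
                (Rmax C3 (exp (exp 2))) <= T1)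
    (ht0T2 : T2 <= t0 - C3 * ln (ln (c * t0)) - 1 / 2)
    (hT2 : Rmax (T + 1) (exp (exp 2)) <= T2)
    (hT1' : 0 <= T1 - 2 * C3 * ln (ln T1))
    (hzero : forall z : C, 1 / 2 < Re z ->
       Rabs (Im z - t) <= C3 * ln (ln (c * Rabs t)) + 2 -> L z <> 0)
    (logL : C -> C)
    (hlog : log_branch L m alpha
       (fun z => 1 / 2 < Re z /\
                 Rabs (Im z - t) < C3 * ln (ln (c * Rabs t)) + 2) logL)
    (sigma : R)
    (hsigma : 1 / 2 + C2 / ln (ln (c * Rabs t)) <= sigma
              <= 1 + C2 / ln (ln (c * Rabs t))) :
  Cmod (logL (sigma, t))
    <= a1_const d m l C0 C1 C2 C3 T1 T2
       * Rpower (b1_const d m l C0 C1 C3 T1 T2 * ln (c * Rabs t))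
                (2 * (1 - sigma))
       * ln (ln (c * Rabs t)).
Proof.
  assert (H1a : exp (exp (2 * C2)) <= T1) by (eapply Rle_trans; [| exact hT1]; eapply Rle_trans; [apply Rmax_l | apply Rmax_l]).
  assert (H1b : exp (4 * INR m / d) <= T1) by (eapply Rle_trans; [| exact hT1]; eapply Rle_trans; [apply Rmax_r | apply Rmax_l]).
  assert (H1c : C3 <= T1) by (eapply Rle_trans; [| exact hT1]; eapply Rle_trans; [apply Rmax_l | apply Rmax_r]).
  assert (H1d : exp (exp 2) <= T1) by (eapply Rle_trans; [| exact hT1]; eapply Rle_trans; [apply Rmax_r | apply Rmax_r]).
  assert (H2a : T + 1 <= T2) by (eapply Rle_trans; [apply Rmax_l | exact hT2]).
  assert (H2b : exp (exp 2) <= T2) by (eapply Rle_trans; [apply Rmax_r | exact hT2]).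
  pose proof (exp_ineq1_le 2) as Hexp2. pose proof (exp_pos (exp 2)) as Hee2.
  pose proof (exp_ineq1_le (exp 2)) as Hexpe.
  assert (He12 : exp 1 <= exp 2) by (apply exp_le_mono; lra).
  assert (Hee12 : exp (exp 1) <= exp (exp 2)) by now apply exp_le_mono.
  set (x := Rabs t) in *.
  assert (Hm1 : (1 <= m)%nat) by apply (SP_order_pos _ _ _ _ _ hL).
  assert (Hm : 1 <= INR m) by (replace 1 with (INR 1) by reflexivity; now apply le_INR).
  set (X0 := ln (c * x)) in *. set (tau := ln X0) in *.
  set (LT1 := ln T1) in *. set (LL1 := ln LT1) in *.
  assert (HLT1 : exp 2 <= LT1) by now apply ln_exp_le.
  assert (HLL1 : 2 <= LL1) by now apply ln_exp_le.
  assert (Hcx : forall u v, 0 <= u -> u <= v -> u <= c * v) by (clear - hc; intros; nra).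
  assert (HX0T : LT1 <= X0) by (apply ln_le; [lra | apply Hcx; lra]).
  assert (HtauT : LL1 <= tau) by (apply ln_le; lra).
  assert (Htau2 : 2 <= tau) by lra.
  assert (HtauC2 : 2 * C2 <= tau).
  { apply Rle_trans with LL1; [| exact HtauT]. apply ln_exp_le. now apply ln_exp_le. }
  assert (HX0m : 4 * INR m / d <= X0) by (apply Rle_trans with LT1; [now apply ln_exp_le | exact HX0T]).
  set (delta := C2 / tau) in *.
  assert (Hdelta : 0 < delta <= 1 / 2).
  { split; [apply Rdiv_lt_0_compat; lra |]. apply Rle_div_l; lra. }
  set (LT2 := ln T2). set (LL2 := ln LT2).
  assert (HLT2 : exp 2 <= LT2) by now apply ln_exp_le.
  assert (HLL2 : 2 <= LL2) by now apply ln_exp_le.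
  set (eta := C1 / LL2).
  assert (Heta : 0 < eta <= 1 / 2).
  { split; [apply Rdiv_lt_0_compat; lra |]. apply Rle_div_l; lra. }
  set (rho := C3 * tau) in *.
  assert (Hrho : 2 <= rho) by (unfold rho; clear - hC3 Htau2; nra).
  (* The hypothesis is stated at [t0]; it passes to [|t|] because log log (c x) has slope at most
     [1 / C3] beyond [t0 >= C3]. *)
  assert (Hlow : T2 <= x - rho - 1 / 2).
  { pose proof (loglog_increment c t0 x ltac:(lra) ltac:(lra) ht) as H.
    assert (Hl0 : LT1 <= ln (c * t0)) by (apply ln_le; [lra | apply Hcx; lra]).
    specialize (H ltac:(lra)). fold X0 tau in H.
    assert (Hq : (x - t0) / (t0 * ln (c * t0)) <= (x - t0) / C3).
    { apply Rmult_le_compat_l; [lra |]. apply Rinv_le_contravar; [lra |].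
      assert (H1 : 1 <= ln (c * t0)) by lra. assert (H3 : C3 <= t0) by lra. clear - hC3 H1 H3. nra. }
    assert (C3 * (tau - ln (ln (c * t0))) <= C3 * ((x - t0) / C3)) by (apply Rmult_le_compat_l; lra).
    replace (C3 * ((x - t0) / C3)) with (x - t0) in H0 by (field; lra). unfold rho. lra. }
  (* The centres are within [rho + 1/2] of height [t] and the radii [1/2 + eta] are at most 1, so
     heights stay within [rho + 3/2]. *)
  set (X := ln (c * (x + (rho + 3 / 2)))).
  assert (HXT2 : LT2 <= X) by (apply ln_le; [lra | apply Hcx; lra]).
  (* The crude bound suffices at [delta], where [ln (1 + 1 / delta) <= 1 / delta] is used; the sharp
     one at [eta] produces the term of [K_const] in Euler's constant. *)
  set (Wd := 1 + 1 / delta). set (We := exp (EulerMascheroni * eta) / eta).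
  assert (HWd : forall N, zeta_partial delta N <= Wd) by (intro; apply zeta_partial_le; lra).
  assert (HWe : forall N, zeta_partial eta N <= We) by (intro; apply zeta_partial_le_exp; lra).
  assert (HlnWe : 0 <= ln We) by (rewrite <- ln_1; apply ln_le; [lra | exact (zeta_bound_ge_1 _ _ HWe)]).
  set (K := K_const d m l C0 C1 T2).
  assert (HK : 2 * (1 / 2 + eta) * (1 / 4 * d * X + l * ln X + log_plus C0 + INR m * ln We) <= K * X).
  { apply K_const_bound; try assumption; try lra. }
  pose proof (log_plus_nonneg C0) as Hlp.
  assert (HlnX : 0 <= ln X) by (rewrite <- ln_1; apply ln_le; lra).
  set (A := 1 / 4 * d * X + l * ln X + log_plus C0) in *.
  assert (HlX : 0 <= l * ln X) by (apply Rmult_le_pos; lra).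
  assert (HdX : 0 <= 1 / 4 * d * X) by (apply Rmult_le_pos; lra).
  assert (HA0 : 1 / 4 * d * X <= A) by (clear - HlX Hlp; unfold A; lra).
  assert (HmW : 0 <= INR m * ln We) by (apply Rmult_le_pos; lra).
  assert (HS : A + INR m * ln We <= K * X).
  { eapply Rle_trans; [| exact HK]. rewrite <- (Rmult_1_l (A + INR m * ln We)) at 1.
    apply Rmult_le_compat_r; lra. }
  assert (HKd : 1 / 4 * d <= K).
  { apply (Rmult_le_reg_r X); lra. }
  set (F1 := 1 + ln (1 + (C3 * LL1 + 3 / 2) / T1) / LT1).
  set (F2 := 1 + ln (1 + 1 / LT1 * ln (1 + (2 * C3 * LL1 + 1) / T1)) / LL1).
  set (b1 := b1_const d m l C0 C1 C3 T1 T2).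
  assert (Eb1 : b1 = 1 / INR m * K * F1 * F2) by reflexivity.
  assert (HlnF : forall u v, 0 <= u -> 0 < v -> 0 <= ln (1 + u) / v).
  { intros u v Hu Hv. apply Rdiv_le_0_compat; [| exact Hv]. rewrite <- ln_1. apply ln_le; lra. }
  assert (HC3L : 2 <= C3 * LL1) by (clear - hC3 HLL1; nra).
  assert (HF1 : 1 <= F1).
  { unfold F1. specialize (HlnF ((C3 * LL1 + 3 / 2) / T1) LT1).
    assert (0 <= (C3 * LL1 + 3 / 2) / T1) by (apply Rdiv_le_0_compat; lra).
    specialize (HlnF ltac:(assumption) ltac:(lra)). lra. }
  assert (HF2 : 1 <= F2).
  { unfold F2.
    assert (0 <= (2 * C3 * LL1 + 1) / T1) by (apply Rdiv_le_0_compat; lra).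
    assert (0 <= 1 / LT1 * ln (1 + (2 * C3 * LL1 + 1) / T1)).
    { apply Rmult_le_pos; [apply Rdiv_le_0_compat; lra |]. rewrite <- ln_1. apply ln_le; lra. }
    specialize (HlnF (1 / LT1 * ln (1 + (2 * C3 * LL1 + 1) / T1)) LL1 ltac:(assumption) ltac:(lra)). lra. }
  assert (HXF : X <= X0 * F1).
  { unfold X, rho, tau, X0, F1, LL1, LT1. apply ln_shift_le; lra. }
  set (B := b1 * X0).
  assert (HKX : K * X <= INR m * B).
  { unfold B. rewrite Eb1. replace (INR m * (1 / INR m * K * F1 * F2 * X0)) with (K * (X0 * F1) * F2) by (field; lra).
    assert (HKF : K * X <= K * (X0 * F1)) by (apply Rmult_le_compat_l; lra).
    assert (HKF0 : 0 <= K * (X0 * F1)) by (repeat apply Rmult_le_pos; lra).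
    clear - HKF HKF0 HF2. nra. }
  (* Here [X0 >= 4 m / d] and [K >= d / 4] give [K X >= m]. A base of at least 1 is needed to
     enlarge exponents below. *)
  assert (HB : 1 <= B).
  { assert (HmB : INR m <= INR m * B); [| clear - HmB Hm; nra].
    eapply Rle_trans; [| exact HKX]. apply Rle_trans with (1 / 4 * d * X0).
    - apply (Rmult_le_compat_l (1 / 4 * d)) in HX0m; [| lra].
      replace (1 / 4 * d * (4 * INR m / d)) with (INR m) in HX0m by (field; lra). exact HX0m.
    - assert (X0 <= X) by (apply ln_le; [| apply Rmult_le_compat_l]; lra || (apply Rmult_lt_0_compat; lra)).
      apply Rmult_le_compat; lra. }
  assert (Hb1 : 0 < b1).
  { apply (Rmult_lt_reg_r X0); [lra |]. fold B. lra. }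
  set (M1 := INR m / C2 * tau).
  assert (HM1 : 0 < M1) by (apply Rmult_lt_0_compat; [apply Rdiv_lt_0_compat; lra | lra]).
  assert (EM1 : M1 = INR m * (1 / delta)) by (unfold M1, delta; field; lra).
  assert (Hin : forall z, 1 + delta <= Re z -> Cmod (logL z) <= M1).
  { intros z Hz. eapply Rle_trans; [exact (log_bound_right a L m alpha d _ logL delta Wd z hL hlog ltac:(lra) HWd Hz) |].
    rewrite EM1. apply Rmult_le_compat_l; [lra |].
    assert (0 < 1 / delta) by (apply Rdiv_lt_0_compat; lra).
    pose proof (ln_le_sub1 Wd ltac:(unfold Wd; lra)). unfold Wd in *. lra. }
  assert (Hout : forall z, 1 / 2 + delta <= Re z -> Rabs (Im z - t) <= rho + 1 / 2 -> Cmod (logL z) <= M1 * B).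
  { intros z Hz1 Hz2.
    assert (Hgoal : 1 / delta * (2 * (1 / 2 + eta) * (A + INR m * ln We)) <= M1 * B).
    { replace (M1 * B) with (1 / delta * (INR m * B)) by (rewrite EM1; ring). apply Rmult_le_compat_l; [apply Rdiv_le_0_compat; lra |]. lra. }
    eapply Rle_trans; [| exact Hgoal].
    destruct (Rle_dec (1 + eta) (Re z)) as [Hr | Hr].
    - eapply Rle_trans; [exact (log_bound_right a L m alpha d _ logL eta We z hL hlog ltac:(lra) HWe Hr) |].
      assert (H : 1 <= 1 / delta) by (apply Rle_div_r; lra).
      set (v := INR m * ln We) in *.
      assert (Hv : v <= 2 * (1 / 2 + eta) * (A + v)).
      { apply Rle_trans with (1 * (A + v)); [lra | apply Rmult_le_compat_r; lra]. }
      clear - Hv HmW H. nra.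
    (* With the centre at the height of [z], the distance from [z] to the boundary circle is
       [Re z - 1/2 >= delta], whence the factor [1 / delta]. *)
    - apply Rnot_le_lt in Hr. set (s0 := (1 + eta, Im z) : C).
      assert (Hd0 : Cmod (z - s0) = 1 + eta - Re z).
      { replace (z - s0)%C with (RtoC (Re z - (1 + eta))).
        - rewrite Cmod_R, Rabs_left; lra.
        - destruct z as [u v]. unfold s0, Re, Im, RtoC, Cminus, Cplus, Copp; simpl. f_equal; ring. }
      assert (Hdom : forall w, Cmod (w - s0) < 1 / 2 + eta ->
        1 / 2 < Re w /\ Rabs (Im w - t) < rho + 3 / 2).
      { intros w Hw. pose proof (re_le_Cmod (w - s0)) as Hre. pose proof (im_le_Cmod (w - s0)) as Him.
        apply Rabs_le_between in Hre. apply Rabs_le_between in Him. apply Rabs_le_between in Hz2.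
        destruct w as [u v]. unfold s0, Re, Im in *; simpl in *. split; [lra |]. apply Rabs_lt_between. lra. }
      assert (Hw : forall w, Cmod (w - s0) < 1 / 2 + eta ->
        holo_at logL w /\ L w <> 0 /\ Re (logL w) = ln (Cmod (L w))).
      { intros w Hw. eapply holo_log; [exact hlog |]. right. destruct (Hdom w Hw). split; [assumption | lra]. }
      pose proof (borel_caratheodory_open logL s0 (1 / 2 + eta) A ltac:(lra) ltac:(intros; now apply Hw)) as Hbc.
      assert (HRe : forall w, Cmod (w - s0) < 1 / 2 + eta -> Re (logL w) <= A).
      { intros w Hww. destruct (Hw w Hww) as (_ & Hnz & ->). destruct (Hdom w Hww) as [Hd1 Hd2].
        assert (Hupper : Rabs (Im w) <= x + (rho + 3 / 2)).
        { replace (Im w) with (t + (Im w - t)) by ring. eapply Rle_trans; [apply Rabs_triang |]. fold x. lra. }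
        (* The lower bound on [|Im w|] is at least [T2 - 1], and [T2 >= T + 1]. *)
        assert (Hlower : T <= Rabs (Im w)).
        { assert (Rabs (Im w - t) <= rho + 3 / 2) by lra.
          assert (Hlo : x - Rabs (Im w - t) <= Rabs (Im w)).
          { pose proof (Rabs_triang (Im w) (- (Im w - t))) as Tr. rewrite Rabs_Ropp in Tr.
            replace (Im w + - (Im w - t)) with t in Tr by ring. fold x in Tr. lra. }
          lra. }
        eapply Rle_trans; [apply hgrowth; [exact Hlower | lra | exact Hnz] |].
        pose proof (exp_pos 1) as He1.
        assert (Hl1 : 1 <= ln (c * Rabs (Im w))).
        { rewrite <- (ln_exp 1). apply ln_le; [lra |]. clear - hc hT Hlower. pose proof (exp_pos 1). nra. }
        assert (Hl2 : ln (c * Rabs (Im w)) <= X).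
        { apply ln_le; [apply Rmult_lt_0_compat; lra | apply Rmult_le_compat_l; lra]. }
        assert (ln (ln (c * Rabs (Im w))) <= ln X) by (apply ln_le; lra).
        unfold A. apply Rplus_le_compat_r, Rplus_le_compat; apply Rmult_le_compat_l; lra. }
      specialize (Hbc HRe z). rewrite Hd0 in Hbc. specialize (Hbc ltac:(lra)).
      assert (Hs0 : Cmod (logL s0) <= INR m * ln We).
      { exact (log_bound_right a L m alpha d _ logL eta We s0 hL hlog ltac:(lra) HWe (Rle_refl _)). }
      eapply Rle_trans; [exact Hbc |].
      replace (1 / 2 + eta - (1 + eta - Re z)) with (Re z - 1 / 2) by field.
      rewrite <- Rmult_assoc. pose proof (Cmod_ge_0 (logL s0)).
      assert (/ (Re z - 1 / 2) <= / delta) by (apply Rinv_le_contravar; lra).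
      assert (0 < / (Re z - 1 / 2)) by (apply Rinv_0_lt_compat; lra).
      apply Rmult_le_compat; [| lra | | lra].
      + apply Rdiv_le_0_compat; lra.
      + replace (1 / delta * (2 * (1 / 2 + eta))) with (2 * (1 / 2 + eta) * / delta) by (field; lra).
        apply Rmult_le_compat_l; lra. }
  set (s1 := (1 + delta + rho, t) : C).
  assert (Hpt : forall z, Cmod (z - s1) <= rho + 1 / 2 ->
    1 / 2 + delta <= Re z /\ Rabs (Im z - t) <= rho + 1 / 2).
  { intros z Hz. pose proof (re_le_Cmod (z - s1)) as Hre. pose proof (im_le_Cmod (z - s1)) as Him.
    apply Rabs_le_between in Hre. apply Rabs_le_between in Him.
    destruct z as [u v]. unfold s1, Re, Im in *; simpl in *. split; [lra |]. apply Rabs_le_between. lra. }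
  assert (Hr : Cmod ((sigma, t) - s1) = rho + (1 + delta - sigma)).
  { unfold s1. rewrite Cmod_horizontal, Rabs_left; lra. }
  pose proof (three_circles logL s1 rho (rho + 1 / 2) M1 (M1 * B) ltac:(lra) ltac:(lra) HM1 ltac:(apply Rmult_lt_0_compat; lra)) as H3.
  assert (Hmain : Cmod (logL (sigma, t))
    <= M1 * Rpower (M1 * B / M1) (ln (Cmod ((sigma, t) - s1) / rho) / ln ((rho + 1 / 2) / rho))).
  { apply H3.
    - intros z [_ Hz]. destruct (Hpt z Hz) as [P1 P2].
      apply (holo_log L m alpha _ logL z hlog). right. split; lra.
    - intros z Hz. apply Hin. pose proof (re_le_Cmod (z - s1)) as Hre. apply Rabs_le_between in Hre.
      destruct z as [u v]. unfold s1, Re in *; simpl in *. lra.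
    - intros z Hz. destruct (Hpt z ltac:(lra)). now apply Hout.
    - rewrite Hr. lra. }
  rewrite Hr in Hmain. replace (M1 * B / M1) with B in Hmain by (field; lra).
  set (R1 := R1_const C2 C3 T1).
  (* The lemma is applied with [x = 1 + delta - sigma], which lies in [0, 1/2]. The surplus
     [2 delta] is [2 C2 / tau], and [1 / (4 rho)] is [1 / (4 C3 tau)]: together they stay below
     [R1 / tau]. *)
  assert (Hexpo : ln ((rho + (1 + delta - sigma)) / rho) / ln ((rho + 1 / 2) / rho) <= 2 * (1 - sigma) + R1 / tau).
  { eapply Rle_trans; [apply log_radius_ratio_le; lra |].
    set (q1 := 1 / (4 * C3 * LL1)).
    assert (Hq1 : 0 < q1 <= 1 / 8).
    { unfold q1. split; [apply Rdiv_lt_0_compat; lra |]. apply Rle_div_l; lra. }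
    assert (Hq2 : 1 / (4 * rho) <= q1).
    { unfold q1, Rdiv. rewrite !Rmult_1_l. unfold rho. apply Rinv_le_contravar; [lra |].
      clear - hC3 HtauT. nra. }
    assert (Hq3 : 1 / (4 * rho) = 1 / (4 * C3) / tau) by (unfold rho; field; lra).
    assert (HC3' : 0 < 1 / (4 * C3)) by (apply Rdiv_lt_0_compat; lra).
    assert (HR1 : 2 * C2 + 1 / (4 * C3) / (1 - q1) <= R1).
    { unfold R1, R1_const. fold LT1 LL1. fold q1.
      assert (H : 1 <= / (1 - q1)) by (rewrite <- Rinv_1 at 1; apply Rinv_le_contravar; lra).
      replace (1 / (2 * C3)) with (2 * (1 / (4 * C3))) by (field; lra).
      unfold Rdiv at 2. rewrite Rmult_plus_distr_r. apply Rplus_le_compat.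
      - clear - hC2 H. nra.
      - apply Rmult_le_compat_r; lra. }
    assert (Hs : 1 / (4 * rho) / (1 - 1 / (4 * rho)) <= 1 / (4 * C3) / (1 - q1) / tau).
    { rewrite Hq3 at 1. replace (1 / (4 * C3) / (1 - q1) / tau) with (1 / (4 * C3) / tau / (1 - q1)) by (field; lra).
      apply Rmult_le_compat_l; [apply Rdiv_le_0_compat; lra |]. apply Rinv_le_contravar; lra. }
    apply Rle_trans with (2 * (1 - sigma) + (2 * C2 + 1 / (4 * C3) / (1 - q1)) / tau).
    - replace ((2 * C2 + 1 / (4 * C3) / (1 - q1)) / tau) with (2 * delta + 1 / (4 * C3) / (1 - q1) / tau) by (unfold delta; field; lra).
      lra.
    - apply Rplus_le_compat_l, Rmult_le_compat_r; [apply Rlt_le, Rinv_0_lt_compat; lra | exact HR1]. }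
  assert (HR1 : 0 <= R1).
  { unfold R1, R1_const. fold LT1 LL1.
    assert (Hq : 1 / (4 * C3 * LL1) <= 1 / 8) by (apply Rle_div_l; lra).
    apply Rmult_le_pos; [| apply Rlt_le, Rinv_0_lt_compat; lra].
    assert (0 < 1 / (2 * C3)) by (apply Rdiv_lt_0_compat; lra). lra. }
  eapply Rle_trans; [exact Hmain |].
  apply Rle_trans with (M1 * (Rpower B (2 * (1 - sigma)) * exp ((1 + log_plus b1 / LL1) * R1))).
  2: { unfold a1_const. fold b1 LT1 LL1 R1 X0 tau B. unfold M1. right. ring. }
  apply Rmult_le_compat_l; [lra |].
  apply Rle_trans with (Rpower B (2 * (1 - sigma) + R1 / tau)).
  - destruct HB as [HB | <-].
    + apply Rle_Rpower; lra.
    + unfold Rpower. rewrite ln_1, !Rmult_0_r. lra.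
  (* Since [ln B = ln b1 + tau], the factor [B^(R1 / tau)] is [exp ((1 + ln b1 / tau) R1)]. The
     positive part is taken because [1 / tau <= 1 / LL1] enlarges only nonnegative terms. *)
  - rewrite Rpower_plus. apply Rmult_le_compat_l; [apply Rlt_le, exp_pos |].
    unfold Rpower at 1. apply exp_le_mono. unfold B. rewrite ln_mult by lra. fold tau.
    replace (R1 / tau * (ln b1 + tau)) with ((1 + ln b1 / tau) * R1) by (field; lra).
    apply Rmult_le_compat_r; [exact HR1 |]. apply Rplus_le_compat_l.
    apply Rle_trans with (log_plus b1 / tau).
    + apply Rmult_le_compat_r; [apply Rlt_le, Rinv_0_lt_compat; lra | apply Rmax_r].
    + apply Rmult_le_compat_l; [apply log_plus_nonneg | apply Rinv_le_contravar; lra].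
Qed.
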